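(* The quotient space $\mathfrak X_{\mathcal F_s'}^*/(\mathfrak X_{\mathcal F_s'})_*$ is isomorphic to $c_0(\Gamma)$, where the set $\Gamma$ coincides with the set of all survivor $\sigma_{\mathcal F}$ special sequences.
   Context: Notation. $c_{00}(\mathbb N)$ is the space of finitely supported real sequences, $(e_n)$ its unit vectors; $e_n^*$ is the same unit vector regarded as a functional; $f\in c_{00}(\mathbb N)$ acts by $f(x)=\sum_nf(n)x(n)$; $\operatorname{ran}f$ is the smallest interval containing $\operatorname{supp}f$; $Ef$ is the restriction of $f$ to an interval $E$; $f<g$ means $\max\operatorname{supp}f<\min\operatorname{supp}g$; $\mathrm{conv}_{\mathbb Q}$ denotes the set of convex combinations with rational coefficients; $\|x\|_B=\sup\{|f(x)|:f\in B\}$ for $B\subset c_{00}(\mathbb N)$. Schreier families: $\mathcal S_1=\{F\subset\mathbb N:\#F\le\min F\}\cup\{\emptyset\}$, $\mathcal S_{n+1}=\{\bigcup_{i=1}^dF_i:F_i\in\mathcal S_n,\ F_1<\dots<F_d,\ d\le\min F_1\}$. A sequence $f_1<\dots<f_d$ is $\mathcal S_n$ admissible if $\{\min\operatorname{supp}f_i:i\le d\}\in\mathcal S_n$. Put $m_1=2$, $m_{j+1}=m_j^{m_j}$; $n_1=1$, $n_{j+1}=2^{2m_{j+1}}n_j$. $\sigma_{\mathcal F}$ special sequences. Let $F_0=\{\pm e_n^*:n\in\mathbb N\}$, $F_j=\{\frac1{m_{4j-3}^2}\sum_{i\in I}\pm e_i^*:I\in\mathcal S_{n_{4j-3}}\}\cup\{0\}$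 for $j\ge1$, and $F=\bigcup_{j\ge0}F_j$. Fix disjoint infinite $\Xi_1,\Xi_2\subset\mathbb N$ and an injective $\sigma_{\mathcal F}$ from the set of finite sequences $(f_1<\dots<f_d)$ in $\bigcup_{j\ge1}F_j\setminus\{0\}$ into $\Xi_2$ with $\sigma_{\mathcal F}(f_1,\dots,f_d)>\max\{k:\exists i,\ f_i\in F_k\}$. A finite or infinite block sequence $(f_i)_i$ in $\bigcup_{j\ge1}F_j\setminus\{0\}$ is $\sigma_{\mathcal F}$ special if $f_1\in\bigcup_{l\in\Xi_1}F_l$ and $f_{i+1}\in F_{\sigma_{\mathcal F}(f_1,\dots,f_i)}$ for all $i$; its indices are $\operatorname{ind}(f_1)=\min\{j:f_1\in F_j\}$ and $\operatorname{ind}(f_i)=\sigma_{\mathcal F}(f_1,\dots,f_{i-1})$ for $i\ge2$. For $\Phi=\pm E\sum_i\phi_i$ with $(\phi_i)$ special, $\operatorname{ind}(\Phi)=\{\operatorname{ind}(\phi_i):E\cap\operatorname{ran}\phi_i\ne\emptyset\}$. Coding $\sigma$. Let $\mathbb Q_s$ be the set of finite sequences $(\phi_1<\dots<\phi_d)$ of nonzero elements of $c_{00}(\mathbb N)$ with rational coordinates. Fix disjoint infinite $\Omega_1,\Omega_2\subset\mathbb N$, an injective $\sigma:\mathbb Q_s\to\{2j:j\in\Omega_2\}$ with $m_{\sigma(\phi_1,\dots,\phi_d)}>\max\{1/|\phi_i(e_l)|:l\in\operatorname{supp}\phi_i,\ i\le d\}\cdot\max\operatorname{supp}\phi_d$,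 and pairwise disjoint infinite $\Lambda_i\subset\mathbb N$ with $\min\Lambda_i>m_i$. Below, $w(f)=m_j$ means $f\in K^j_n$ for some $n$ (weights need not be unique). An $\mathcal S_{n_{4j-1}}$ special sequence is an $\mathcal S_{n_{4j-1}}$ admissible $(f_1,\dots,f_d)\in\mathbb Q_s$ with $w(f_1)=m_{2k}$ for some $k\in\Omega_1$ with $m_{2k}^{1/2}>n_{4j-1}$ and $w(f_{i+1})=m_{\sigma(f_1,\dots,f_i)}$ for $1\le i<d$. An $\mathcal S_{n_{4j-3}}$ attractor sequence is an $\mathcal S_{n_{4j-3}}$ admissible $(f_1,\dots,f_d)\in\mathbb Q_s$ with $w(f_1)=m_{2k}$ for some $k\in\Omega_1$ with $m_{2k}^{1/2}>n_{4j-3}$, $w(f_{2i+1})=m_{\sigma(f_1,\dots,f_{2i})}$ for $1\le i<\frac d2$, and $f_{2i}=e_{l_{2i}}^*$ with $l_{2i}\in\Lambda_{\sigma(f_1,\dots,f_{2i-1})}$ for $1\le i\le\frac d2$. Norming set. Put $K_0=K_0^0=F$, $K_0^j=\emptyset$ ($j\ge1$), $G_0=F$, $\tau_0=\emptyset$, $D_0=\mathrm{conv}_{\mathbb Q}(F)$. For $n\ge1$: $K_n^0=F$; $K_n^{2j}=K_{n-1}^{2j}\cup\{\frac1{m_{2j}}\sum_{i=1}^df_i:f_1<\dots<f_d\ \mathcal S_{n_{2j}}\text{ admissible},\ f_i\in D_{n-1}\}$; $K_n^{4j-3}=K_{n-1}^{4j-3}\cup\{\pm E(\frac1{m_{4j-3}}\sum_{i=1}^df_i):(f_i)_{i=1}^d$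 an $\mathcal S_{n_{4j-3}}$ attractor sequence, $f_i\in K_{n-1}$, $E$ an interval$\}$; $K_n^{4j-1}=K_{n-1}^{4j-1}\cup\{\pm E(\frac1{m_{4j-1}}\sum_{i=1}^df_i):(f_i)_{i=1}^d$ an $\mathcal S_{n_{4j-1}}$ special sequence, $f_i\in K_{n-1}$, $E$ an interval$\}$; $K_n=\bigcup_{j\ge0}K_n^j$. A functional $f\in F$ is $(D_{n-1},j)$ exact if $f\in F_j$ and there is $x\in c_{00}(\mathbb N)$ with $\|x\|_{D_{n-1}}\le1000$, $\operatorname{ran}(x)\subset\operatorname{ran}(f)$, $f(x)=1$, and for $i\ge1$, $i\ne j$: $\|x\|_{F_i}\le\frac{1000}{m_{4i-3}^2}$ if $i<j$, and $\|x\|_{F_i}\le1000\frac{m_{4j-3}^2}{m_{4i-3}^2}$ if $i>j$. $\tau_n=\{\pm E(\sum_{i=1}^d\phi_i):d\le n,\ E$ an interval, $(\phi_i)_{i=1}^d$ $\sigma_{\mathcal F}$ special and each $\phi_i$ is $(D_{n-1},\operatorname{ind}(\phi_i))$ exact$\}$; $G_n=\{\sum_{i=1}^d\varepsilon_i\Phi_i:\Phi_i\in\tau_n,\ \varepsilon_i\in\{-1,1\},\ \min\operatorname{supp}\Phi_i\ge d,\ (\operatorname{ind}(\Phi_i))_{i=1}^d$ pairwise disjoint$\}$; $D_n=\mathrm{conv}_{\mathbb Q}(K_n\cup G_n\cup D_{n-1})$. Put $D=\bigcup_nD_n$, $\tau=\bigcup_n\tau_n$, $\mathcal F_s'=\bigcup_nG_n$.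 $\mathfrak X_{\mathcal F_s'}$ is the completion of $c_{00}(\mathbb N)$ under $\|x\|=\sup\{f(x):f\in D\}$ and $(\mathfrak X_{\mathcal F_s'})_*$ is the closed linear span of $\{e_n^*:n\in\mathbb N\}$ in $\mathfrak X_{\mathcal F_s'}^*$. An infinite $\sigma_{\mathcal F}$ special sequence $(\phi_i)_{i\in\mathbb N}$ is called survivor if $\sum_{i=1}^d\phi_i\in\tau$ for all $d\in\mathbb N$. *)

(* Defs.v *)
From HB Require Import structures.
From mathcomp Require Import all_boot all_order all_algebra.
From mathcomp Require Import finmap generic_quotient ring_quotient.
From mathcomp Require Import all_classical all_reals all_analysis.

Set Implicit Arguments.
Unset Strict Implicit.
Unset Printing Implicit Defensive.

Import Order.TTheory GRing.Theory Num.Theory.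
Import numFieldNormedType.Exports.

Local Open Scope classical_set_scope.
Local Open Scope ring_scope.

Section dual.
Variables (R : realType) (X : normedModType R).

Definition dual_pred : {pred X -> R^o} :=
  fun f => `[< linear f /\ continuous f >].
Record dual := Dual { dual_fun :> X -> R^o; dualP : dual_fun \in dual_pred }.
HB.instance Definition _ := [isSub for dual_fun].
HB.instance Definition _ := [Choice of dual by <:].

Lemma dual_submod : submod_closed dual_pred.
Proof.
have E a (f g : X -> R^o) x : (a *: f + g) x = a *: f x + g x by [].
split=> [|a f g /asboolP[lf cf] /asboolP[lg cg]]; apply/asboolP; split.
- by move=> a x y; rewrite /= scaler0 addr0.
- by move=> x; exact: cst_continuous.
- by move=> b x y; rewrite !E lf lg !scalerDr addrACA !scalerA mulrC.
- move=> x; apply: (@cvgD _ _ _ _ _ (a \*: f) g); last exact: cg.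
  exact: cvgZl_tmp (cf x).
Qed.
HB.instance Definition _ :=
  GRing.isSubmodClosed.Build _ _ dual_pred dual_submod.
HB.instance Definition _ := [SubChoice_isSubLmodule of dual by <:].

Implicit Types f g : dual.

Definition opnorm f : R := sup [set `|f x| | x in [set x : X | `|x| <= 1]].

Lemma dual_linear f : linear f.
Proof. by case: f => f /= /asboolP[]. Qed.

Lemma dual_continuous f : continuous f.
Proof. by case: f => f /= /asboolP[]. Qed.

HB.instance Definition _ f := GRing.isLinear.Build R X R^o _ f (dual_linear f).

Lemma opnorm_has_sup f :
  has_sup [set `|f x| | x in [set x : X | `|x| <= 1]].
Proof.
split; first by exists `|f 0|, 0 => //=; rewrite normr0.
have /bounded_funP/(_ 1)[M fM] :=
  continuous_linear_bounded 0 (@dual_continuous f 0).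
by exists M => _ [x /= x1 <-]; exact: fM.
Qed.

Lemma opnorm_ub f x : `|x| <= 1 -> `|f x| <= opnorm f.
Proof.
by move=> x1; apply: (ub_le_sup (opnorm_has_sup f).2); exists x.
Qed.

Lemma opnorm_ge0 f : 0 <= opnorm f.
Proof. by apply: le_trans (opnorm_ub f (x := 0) _); rewrite ?normr0. Qed.

Lemma opnorm_le f M :
  (forall x, `|x| <= 1 -> `|f x| <= M) -> opnorm f <= M.
Proof.
move=> fM; apply: ge_sup => [|_ [x /= x1 <-]]; last exact: fM.
exact: (opnorm_has_sup f).1.
Qed.

Lemma opnormD f g : opnorm (f + g) <= opnorm f + opnorm g.
Proof.
apply: opnorm_le => x x1; apply: le_trans (ler_normD _ _) _.
by apply: lerD; exact: opnorm_ub.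
Qed.

Lemma opnormZ (a : R) f : opnorm (a *: f) = `|a| * opnorm f.
Proof.
have le b h : opnorm (b *: h) <= `|b| * opnorm h.
  apply: opnorm_le => x x1; rewrite [X in `|X|](_ : _ = b * h x)// normrM.
  by rewrite ler_wpM2l// opnorm_ub.
apply/eqP; rewrite eq_le le /=.
have [->|a0] := eqVneq a 0; first by rewrite normr0 mul0r opnorm_ge0.
rewrite -ler_pdivlMl ?normr_gt0// -normfV.
by apply: le_trans (le _ _); rewrite scalerA mulVf// scale1r.
Qed.

Lemma opnorm_eq0 f : opnorm f = 0 -> f = 0.
Proof.
move=> f0; apply/val_inj/funext => x /=.
have [->|x0] := eqVneq x 0; first exact: linear0.
have := @opnorm_ub f (`|x|^-1 *: x).
rewrite normrZ normfV normr_id mulVf ?normr_eq0// f0 linearZ /=.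
move=> /(_ (lexx _)); rewrite normrM normfV normr_id.
by rewrite pmulr_rle0 ?invr_gt0 ?normr_gt0// normr_le0 => /eqP.
Qed.

HB.instance Definition _ :=
  Lmodule_isNormed.Build R dual opnormD opnormZ opnorm_eq0.

Lemma dual_normE f : `|f| = opnorm f. Proof. by []. Qed.
End dual.

Section c0.
Variables (R : realType) (T : Type).

Definition c0_pred : {pred T -> R^o} :=
  fun x => `[< forall e : R, 0 < e -> finite_set [set t | e <= `|x t|] >].
Record c0 := C0 { c0_fun :> T -> R^o; c0P : c0_fun \in c0_pred }.
HB.instance Definition _ := [isSub for c0_fun].
HB.instance Definition _ := [Choice of c0 by <:].

Lemma c0_submod : submod_closed c0_pred.
Proof.
have E a (f g : T -> R^o) x : (a *: f + g) x = a *: f x + g x by [].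
split=> [|a f g /asboolP cf /asboolP cg]; apply/asboolP => e e0.
  rewrite (_ : mkset _ = set0) // -subset0 => t /=.
  by rewrite normr0 leNgt e0.
have d0 : 0 < e / 2 / (`|a| + 1) by rewrite !divr_gt0// ltr_wpDl.
apply: (@sub_finite_set _ _ ([set t | e / 2 / (`|a| + 1) <= `|f t|] `|`
   [set t | e / 2 <= `|g t|])); last first.
  by rewrite finite_setU; split; [exact: cf|apply: cg; rewrite divr_gt0].
move=> t /=; rewrite E => ef; apply: contrapT => /not_orP[/negP + /negP].
rewrite -!ltNge => ft gt; move: ef; apply/negP; rewrite -ltNge.
rewrite (le_lt_trans (ler_normD _ _))// [e]splitr ltrD// normrM.
rewrite ltr_pdivlMr ?ltr_wpDl// in ft; apply: le_lt_trans ft.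
by rewrite mulrC ler_wpM2l// lerDl.
Qed.
HB.instance Definition _ := GRing.isSubmodClosed.Build _ _ c0_pred c0_submod.
HB.instance Definition _ := [SubChoice_isSubLmodule of c0 by <:].

Implicit Types x y : c0.

(* The 0 accounts for an empty T. *)
Definition supnorm x : R := sup (0 |` range (fun t => `|x t|)).

Lemma supnorm_has_sup x : has_sup (0 |` range (fun t => `|x t|)).
Proof.
split; first by exists 0; left.
have /asboolP/(_ 1 ltr01) fin := c0P x.
have /finite_seqP[s sE] := finite_image (fun t => `|x t|) fin.
exists (1 + \sum_(r <- s) `|r|) => _ [->|[t _ <-]].
  by rewrite addr_ge0 ?sumr_ge0.
have [x1|/ltW x1] := leP 1 `|x t|; last by rewrite ler_wpDr ?sumr_ge0.
have ts : `|x t| \in s by have : [set` s] `|x t| by rewrite -sE; exists t.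
by rewrite ler_wpDl// (big_rem _ ts) /= normr_id lerDl sumr_ge0.
Qed.

Lemma supnorm_ub x t : `|x t| <= supnorm x.
Proof. by apply: (ub_le_sup (supnorm_has_sup x).2); right; exists t. Qed.

Lemma supnorm_ge0 x : 0 <= supnorm x.
Proof. by apply: (ub_le_sup (supnorm_has_sup x).2); left. Qed.

Lemma supnorm_le x M : 0 <= M -> (forall t, `|x t| <= M) -> supnorm x <= M.
Proof.
by move=> M0 xM; apply: ge_sup => [|_ [->//|[t _ <-]]//]; exists 0; left.
Qed.

Lemma supnormD x y : supnorm (x + y) <= supnorm x + supnorm y.
Proof.
apply: supnorm_le => [|t]; first by rewrite addr_ge0 ?supnorm_ge0.
by apply: le_trans (ler_normD _ _) _; apply: lerD; exact: supnorm_ub.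
Qed.

Lemma supnormZ (a : R) x : supnorm (a *: x) = `|a| * supnorm x.
Proof.
have le b y : supnorm (b *: y) <= `|b| * supnorm y.
  apply: supnorm_le => [|t]; first by rewrite mulr_ge0 ?supnorm_ge0.
  rewrite [X in `|X|](_ : _ = b * y t)// normrM.
  by rewrite ler_wpM2l// supnorm_ub.
apply/eqP; rewrite eq_le le /=.
have [->|a0] := eqVneq a 0; first by rewrite normr0 mul0r supnorm_ge0.
rewrite -ler_pdivlMl ?normr_gt0// -normfV.
by apply: le_trans (le _ _); rewrite scalerA mulVf// scale1r.
Qed.

Lemma supnorm_eq0 x : supnorm x = 0 -> x = 0.
Proof.
move=> x0; apply/val_inj/funext => t; apply/eqP.
by rewrite -normr_le0 -x0 supnorm_ub.
Qed.

HB.instance Definition _ :=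
  Lmodule_isNormed.Build R c0 supnormD supnormZ supnorm_eq0.
End c0.

Section quotient.
Variables (R : realType) (V : normedModType R).

Record closed_subspace := ClosedSubspace {
  subspace_set : set V;
  subspaceP : submod_closed [pred v | `[< subspace_set v >]];
  subspace_closed : closed subspace_set }.

Definition in_subspace (M : closed_subspace) : {pred V} :=
  [pred v | `[< subspace_set M v >]].

Variable M : closed_subspace.
HB.instance Definition _ :=
  GRing.isSubmodClosed.Build R V (in_subspace M) (subspaceP M).

Definition quotient_space : Type := Quotient.quot (in_subspace M).

HB.instance Definition _ := GRing.Zmodule.on quotient_space.

Local Open Scope quotient_scope.

Definition quotient_proj (v : V) : quotient_space :=
  \pi_(Quotient.quot (in_subspace M)) v.

Lemma quotient_projD : {morph quotient_proj : u v / u + v}.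
Proof. exact: Quotient.pi_add. Qed.

Lemma quotient_proj_eq u v :
  quotient_proj u = quotient_proj v <-> subspace_set M (u - v).
Proof.
rewrite /quotient_proj; split=> [/eqP|Muv].
  by rewrite -Quotient.idealrBE => /asboolP.
by apply/eqP; rewrite -Quotient.idealrBE; apply/asboolP.
Qed.

Lemma quotient_projP (q : quotient_space) : exists v, quotient_proj v = q.
Proof.
exists (repr (q : Quotient.quot (in_subspace M))).
by rewrite /quotient_proj reprK.
Qed.

Definition quotient_scale (a : R) (q : quotient_space) : quotient_space :=
  quotient_proj (a *: repr (q : Quotient.quot (in_subspace M))).

Lemma quotient_scaleE a v :
  quotient_scale a (quotient_proj v) = quotient_proj (a *: v).
Proof.
apply/quotient_proj_eq; rewrite -scalerBr.
have /asboolP : a *: (repr (\pi_(Quotient.quot (in_subspace M)) v) - v)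
    \in in_subspace M.
  by rewrite rpredZ// Quotient.idealrBE reprK.
by [].
Qed.

Lemma quotient_scaleA a b q :
  quotient_scale a (quotient_scale b q) = quotient_scale (a * b) q.
Proof.
by have [v <-] := quotient_projP q; rewrite !quotient_scaleE scalerA.
Qed.

Lemma quotient_scale1 : left_id 1 quotient_scale.
Proof.
by move=> q; have [v <-] := quotient_projP q; rewrite quotient_scaleE scale1r.
Qed.

Lemma quotient_scaleDr : right_distributive quotient_scale +%R.
Proof.
move=> a q r; have [u <-] := quotient_projP q; have [v <-] := quotient_projP r.
by rewrite -quotient_projD !quotient_scaleE scalerDr quotient_projD.
Qed.

Lemma quotient_scaleDl q : {morph quotient_scale^~ q : a b / a + b}.
Proof.
move=> a b; have [v <-] := quotient_projP q.
by rewrite !quotient_scaleE scalerDl quotient_projD.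
Qed.

HB.instance Definition _ := GRing.Zmodule_isLmodule.Build R quotient_space
  quotient_scaleA quotient_scale1 quotient_scaleDr quotient_scaleDl.

Lemma quotient_projZ a v : quotient_proj (a *: v) = a *: quotient_proj v.
Proof. exact/esym/quotient_scaleE. Qed.

Lemma quotient_proj0 : quotient_proj 0 = 0.
Proof. by rewrite -(scale0r 0) quotient_projZ scale0r. Qed.

Implicit Types q r : quotient_space.

Definition quotient_norm q : R :=
  inf [set `|v| | v in [set v | quotient_proj v = q]].

Lemma quotient_norm_lb q :
  has_lbound [set `|v| | v in [set v | quotient_proj v = q]].
Proof. by exists 0 => _ [v _ <-]. Qed.

Lemma quotient_norm_le v : quotient_norm (quotient_proj v) <= `|v|.
Proof. by apply: (ge_inf (quotient_norm_lb _)); exists v. Qed.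

Lemma quotient_norm_ge q c :
  (forall v, quotient_proj v = q -> c <= `|v|) -> c <= quotient_norm q.
Proof.
move=> cq; apply: lb_le_inf => [|_ [v vq <-]]; last exact: cq.
by have [v vq] := quotient_projP q; exists `|v|, v.
Qed.

Lemma quotient_normD q r :
  quotient_norm (q + r) <= quotient_norm q + quotient_norm r.
Proof.
rewrite -lerBlDr; apply: quotient_norm_ge => u <-.
rewrite lerBlDr -lerBlDl; apply: quotient_norm_ge => v <-.
rewrite lerBlDl -quotient_projD.
by apply: le_trans (quotient_norm_le _) _; rewrite ler_normD.
Qed.

Lemma quotient_normZ (a : R) q :
  quotient_norm (a *: q) = `|a| * quotient_norm q.
Proof.
have le b r : quotient_norm (b *: r) <= `|b| * quotient_norm r.
  have [->|b0] := eqVneq b 0.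
    rewrite scale0r normr0 mul0r -quotient_proj0.
    by rewrite (le_trans (quotient_norm_le _))// normr0.
  rewrite -ler_pdivrMl ?normr_gt0//; apply: quotient_norm_ge => v <-.
  by rewrite ler_pdivrMl ?normr_gt0// -normrZ -quotient_projZ quotient_norm_le.
apply/eqP; rewrite eq_le le /=.
have [->|a0] := eqVneq a 0.
  by rewrite normr0 mul0r; apply: quotient_norm_ge => v _.
rewrite -ler_pdivlMl ?normr_gt0// -normfV.
by apply: le_trans (le _ _); rewrite scalerA mulVf// scale1r.
Qed.

Lemma quotient_norm_eq0 q : quotient_norm q = 0 -> q = 0.
Proof.
have [v <-] := quotient_projP q => v0; rewrite -quotient_proj0.
apply/quotient_proj_eq; rewrite subr0; apply: (subspace_closed (c:=M)).
move=> B /nbhs_ballP[e /= e0 eB].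
have [|_ [u /= uv <-]] := inf_adherent e0
    (E := [set `|w| | w in [set w | quotient_proj w = quotient_proj v]]).
  by split; [exists `|v|, v|exact: quotient_norm_lb].
rewrite [inf _]v0 add0r => ue; exists (v - u); split; first exact/quotient_proj_eq.
by apply: eB; rewrite -ball_normE /ball_ /= opprB addrC subrK.
Qed.

HB.instance Definition _ := Lmodule_isNormed.Build R quotient_space
  quotient_normD quotient_normZ quotient_norm_eq0.

End quotient.

Section closed_span.
Variables (R : realType) (V : normedModType R).

Definition lin_span (A : set V) : set V :=
  [set v | exists2 s : seq (R * V),
    (forall p, p \in s -> A p.2) & v = \sum_(p <- s) p.1 *: p.2].

Lemma lin_span_submod (A : set V) (a : R) u v :
  lin_span A u -> lin_span A v -> lin_span A (a *: u + v).
Proof.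
move=> [s As ->] [t At ->]; exists ([seq (a * p.1, p.2) | p <- s] ++ t).
  by move=> p; rewrite mem_cat => /orP[/mapP[q /As Aq ->]|/At].
rewrite big_cat big_map scaler_sumr /=; congr (_ + _).
by apply: eq_bigr => p _; rewrite scalerA.
Qed.

Lemma closure_ballP (A : set V) v :
  closure A v <-> forall e, 0 < e -> exists2 w, A w & `|v - w| < e.
Proof.
split=> [Av e e0|Av B /nbhs_ballP[e /= e0 eB]].
  have [|w [Aw vw]] := Av (ball v e); first exact: nbhsx_ballx.
  by exists w => //; move: vw; rewrite -ball_normE.
have [w Aw vw] := Av e e0; exists w; split => //; apply: eB.
by rewrite -ball_normE.
Qed.

Lemma closed_span_submod (A : set V) :
  submod_closed [pred v | `[< closure (lin_span A) v >]].
Proof.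
split=> [|a u v /asboolP/closure_ballP uA /asboolP/closure_ballP vA];
    apply/asboolP.
  by apply: subset_closure; exists [::] => //; rewrite big_nil.
apply/closure_ballP => e e0.
have a0 : 0 < `|a| + 1 by rewrite ltr_wpDl.
have [u' Au' uu'] := uA (e / 2 / (`|a| + 1)) ltac:(by rewrite !divr_gt0).
have [v' Av' vv'] := vA (e / 2) ltac:(by rewrite divr_gt0).
exists (a *: u' + v'); first exact: lin_span_submod.
rewrite opprD addrACA -scalerBr (le_lt_trans (ler_normD _ _))// [e]splitr.
rewrite ltrD// normrZ; apply: le_lt_trans (_ : (`|a| + 1) * `|u - u'| < _).
  by rewrite ler_wpM2r// lerDl.
by rewrite -ltr_pdivlMl// mulrC.
Qed.

Definition closed_span (A : set V) : closed_subspace V :=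
  ClosedSubspace (closed_span_submod A) (@closed_closure _ (lin_span A)).
End closed_span.

Definition isomorphic (R : realType) (V W : normedModType R) : Prop :=
  exists (T : {linear V -> W}) (S : W -> V),
    [/\ continuous T, continuous S, cancel T S & cancel S T].

(* N is {1, 2, ...}: a sequence is indexed by nat with a dummy zero entry at
   index 0. *)
Section c00.
Variable R : realType.
Definition c00_pred : {pred nat -> R^o} :=
  fun x => `[< x 0%N = 0 /\ finite_set [set n | x n != 0] >].
Record c00 := C00 { c00_fun :> nat -> R^o; c00P : c00_fun \in c00_pred }.
HB.instance Definition _ := [isSub for c00_fun].
HB.instance Definition _ := [Choice of c00 by <:].
Lemma c00_submod : submod_closed c00_pred.
Proof.
have E a (x y : nat -> R^o) n : (a *: x + y) n = a * x n + y n by [].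
split=> [|a x y /asboolP[x0 xfin] /asboolP[y0 yfin]]; apply/asboolP.
- by split=> //; rewrite (_ : mkset _ = set0) // -subset0 => n /=; rewrite eqxx.
- split; first by rewrite E x0 y0 mulr0 addr0.
  apply: (@sub_finite_set _ _ ([set n | x n != 0] `|` [set n | y n != 0])).
    move=> n /=; rewrite E; case: (eqVneq (x n) 0) => [->|]; last by left.
    by rewrite mulr0 add0r; right.
  by rewrite finite_setU.
Qed.
HB.instance Definition _ := GRing.isSubmodClosed.Build _ _ c00_pred c00_submod.
HB.instance Definition _ := [SubChoice_isSubLmodule of c00 by <:].

Lemma c00_memP (x : nat -> R^o) N :
  x 0%N = 0 -> (forall n, (N <= n)%N -> x n = 0) -> x \in c00_pred.
Proof.
move=> x0 xN; apply/asboolP; split => //.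
apply: (@sub_finite_set _ _ `I_N); last exact: finite_II.
by move=> n /= xn; rewrite ltnNge; apply: contra_neqN xn => /xN.
Qed.

(* Both e_n and the functional e_n^*; unit_vec 0 is the zero sequence. *)
Definition unit_vec_fun (n k : nat) : R^o := ((k == n) && (0 < n)%N)%:R.

Lemma unit_vec_subproof n : unit_vec_fun n \in c00_pred.
Proof.
apply: (@c00_memP _ n.+1) => [|k nk]; rewrite /unit_vec_fun.
  by case: n.
by rewrite gtn_eqF.
Qed.

Definition unit_vec n : c00 := C00 (unit_vec_subproof n).

Definition restrict_fun (E : interval nat) (f : c00) : nat -> R^o :=
  fun n => if n \in E then f n else 0.

Lemma restrict_subproof E f : restrict_fun E f \in c00_pred.
Proof.
have /asboolP[f0 ffin] := c00P f; apply/asboolP; split.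
  by rewrite /restrict_fun f0; case: ifP.
apply: sub_finite_set ffin => n /=; rewrite /restrict_fun.
by case: ifP => //; rewrite eqxx.
Qed.

Definition restrict E f : c00 := C00 (restrict_subproof E f).

Definition pairing (f x : c00) : R := \sum_(n \in [set: nat]) f n * x n.

Definition supp (f : c00) : set nat := [set n | f n != 0].

Definition ran (f : c00) : set nat :=
  [set n | exists k l, [/\ supp f k, supp f l & (k <= n <= l)%N]].

(* The norm takes values in \bar R, so that the supremum is never a dummy
   value. *)
Definition norm_of (B : set c00) (x : c00) : \bar R :=
  ereal_sup [set `|pairing f x|%:E | f in B].

Definition convQ (A : set c00) : set c00 :=
  [set f | exists s : seq (rat * c00),
    [/\ forall p, p \in s -> 0 <= p.1 /\ A p.2,
        \sum_(p <- s) p.1 = 1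
      & f = \sum_(p <- s) (ratr p.1 : R) *: p.2]].

End c00.

Arguments unit_vec {R} n.

Definition natmin (A : set nat) : nat :=
  xget 0%N [set n | A n /\ forall k, A k -> (n <= k)%N].

Definition before (A B : set nat) : Prop :=
  forall k l, A k -> B l -> (k < l)%N.

Definition schreier1 : set {fset nat} :=
  [set F | forall k, k \in F -> (#|` F| <= k)%N].

Definition schreier_step (S : set {fset nat}) : set {fset nat} :=
  [set F | exists s : seq {fset nat},
    [/\ forall A, A \in s -> S A /\ A != fset0,
        forall i, (i.+1 < size s)%N ->
          before [set` nth fset0 s i] [set` nth fset0 s i.+1],
        forall k, k \in nth fset0 s 0 -> (size s <= k)%N
      & F = \bigcup_(A <- s) A]%fset].

(* The Schreier family of index n, for n >= 1. *)
Definition schreier (n : nat) : set {fset nat} :=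
  iter n.-1 schreier_step schreier1.

(* m_ j and n_ j are meaningful for j >= 1. *)
Definition m_ (j : nat) : nat := iter j.-1 (fun m => (m ^ m)%N) 2.

Fixpoint n_ (j : nat) : nat :=
  match j with
  | (_.+1 as j').+1 => (2 ^ (2 * m_ j) * n_ j')%N
  | _ => 1%N
  end.

Section norming_set.
Variable R : realType.
Local Notation c00 := (c00 R).
Implicit Types (f g x : c00) (s : seq c00) (D : set c00).

Definition F_ (j : nat) : set c00 :=
  if j is 0 then
    [set f | exists b : bool,
      exists2 n, (0 < n)%N & f = (-1) ^+ b *: unit_vec n]
  else
    [set f | exists2 I, schreier (n_ (4 * j - 3)) I &
      exists b : nat -> bool, f = ((m_ (4 * j - 3))%:R ^+ 2)^-1 *:
        \sum_(i <- I) (-1) ^+ b i *: unit_vec i] `|` [set 0].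

Definition Fset : set c00 := \bigcup_j F_ j.

Definition block s : Prop :=
  [/\ s <> [::], forall f, f \in s -> f <> 0
    & forall i, (i.+1 < size s)%N -> before (supp s`_i) (supp s`_i.+1)].

Definition admissible (n : nat) s : Prop :=
  block s /\ schreier n [fset natmin (supp f) | f in s]%fset.

Definition sigmaF_domain s : Prop :=
  block s /\ forall f, f \in s -> exists2 j, (0 < j)%N & F_ j f.

Definition rational_blocks s : Prop :=
  block s /\ forall f, f \in s -> forall n, exists q : rat, f n = ratr q.

Record codings := Codings {
  Xi1 : set nat;
  Xi2 : set nat;
  Xi_gt0 : forall k, (Xi1 `|` Xi2) k -> (0 < k)%N;
  Xi1_infinite : infinite_set Xi1;
  Xi2_infinite : infinite_set Xi2;
  Xi_disjoint : Xi1 `&` Xi2 = set0;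
  sigmaF : seq c00 -> nat;
  sigmaF_Xi2 : forall s, sigmaF_domain s -> Xi2 (sigmaF s);
  sigmaF_inj : forall s t, sigmaF_domain s -> sigmaF_domain t ->
    sigmaF s = sigmaF t -> s = t;
  sigmaF_gt : forall s, sigmaF_domain s ->
    forall f k, f \in s -> F_ k f -> (k < sigmaF s)%N;
  Omega1 : set nat;
  Omega2 : set nat;
  Omega_gt0 : forall k, (Omega1 `|` Omega2) k -> (0 < k)%N;
  Omega1_infinite : infinite_set Omega1;
  Omega2_infinite : infinite_set Omega2;
  Omega_disjoint : Omega1 `&` Omega2 = set0;
  sigma : seq c00 -> nat;
  sigma_Omega2 : forall s, rational_blocks s ->
    exists2 j, Omega2 j & sigma s = (2 * j)%N;
  sigma_inj : forall s t, rational_blocks s -> rational_blocks t ->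
    sigma s = sigma t -> s = t;
  sigma_gt : forall s, rational_blocks s ->
    forall f l k, f \in s -> supp f l -> supp (last 0 s) k ->
    1 / `|f l| * k%:R < (m_ (sigma s))%:R;
  Lambda : nat -> set nat;
  Lambda_infinite : forall i, (0 < i)%N -> infinite_set (Lambda i);
  Lambda_disjoint : trivIset [set i | (0 < i)%N] Lambda;
  Lambda_gt : forall i k, (0 < i)%N -> Lambda i k -> (m_ i < k)%N
}.

Variable c : codings.

Definition F_special s : Prop :=
  [/\ sigmaF_domain s, exists2 l, Xi1 c l & F_ l s`_0
    & forall i, (i.+1 < size s)%N -> F_ (sigmaF c (take i.+1 s)) s`_i.+1].

(* Position i counts from 0. *)
Definition ind s (i : nat) : nat :=
  if i is 0 then natmin [set j | F_ j s`_0] else sigmaF c (take i s).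

Definition F_special_infinite (phi : nat -> c00) : Prop :=
  [/\ forall i, phi i <> 0 /\ exists2 j, (0 < j)%N & F_ j (phi i),
      forall i, before (supp (phi i)) (supp (phi i.+1)),
      exists2 l, Xi1 c l & F_ l (phi 0%N)
    & forall i, F_ (sigmaF c (mkseq phi i.+1)) (phi i.+1)].

(* In the next two definitions K w f expresses that f has weight m_ w. *)
Definition special (K : nat -> set c00) (j : nat) s : Prop :=
  [/\ rational_blocks s, admissible (n_ (4 * j - 1)) s,
      exists k, [/\ Omega1 c k, K (2 * k)%N s`_0
        & (n_ (4 * j - 1))%:R < Num.sqrt (m_ (2 * k))%:R :> R]
    & forall i, (i.+1 < size s)%N -> K (sigma c (take i.+1 s)) s`_i.+1].

Definition attractor (K : nat -> set c00) (j : nat) s : Prop :=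
  [/\ rational_blocks s, admissible (n_ (4 * j - 3)) s,
      exists k, [/\ Omega1 c k, K (2 * k)%N s`_0
        & (n_ (4 * j - 3))%:R < Num.sqrt (m_ (2 * k))%:R :> R],
      forall i, (0 < i)%N -> (2 * i < size s)%N ->
        K (sigma c (take (2 * i) s)) s`_(2 * i)
    & forall i, ((2 * i).+1 < size s)%N ->
        exists2 l, Lambda c (sigma c (take (2 * i).+1 s)) l
          & s`_(2 * i).+1 = unit_vec l].

(* The passage from (K_{n-1}^w)_w and D_{n-1} to (K_n^w)_w. The weight of f
   inside this step is relative to the sets K_{n-1}^w, the only ones available
   at this stage of the recursion. *)
Inductive K_step (K : nat -> set c00) (D : set c00) : nat -> c00 -> Prop :=
| K_step_old w f : K w f -> K_step K D w f
| K_step_even j s : (0 < j)%N -> admissible (n_ (2 * j)) s ->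
    (forall f, f \in s -> D f) ->
    K_step K D (2 * j) ((m_ (2 * j))%:R^-1 *: \sum_(f <- s) f)
| K_step_attractor j s (b : bool) (E : interval nat) :
    (0 < j)%N -> attractor K j s ->
    (forall f, f \in s -> exists w, K w f) ->
    K_step K D (4 * j - 3) ((-1) ^+ b *:
      restrict E ((m_ (4 * j - 3))%:R^-1 *: \sum_(f <- s) f))
| K_step_special j s (b : bool) (E : interval nat) :
    (0 < j)%N -> special K j s ->
    (forall f, f \in s -> exists w, K w f) ->
    K_step K D (4 * j - 1) ((-1) ^+ b *:
      restrict E ((m_ (4 * j - 1))%:R^-1 *: \sum_(f <- s) f)).

Definition exact_functional D (j : nat) f : Prop :=
  F_ j f /\ exists x,
    [/\ (norm_of D x <= 1000%:E)%E, ran x `<=` ran f, pairing f x = 1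
      & forall i, (0 < i)%N ->
        ((i < j)%N ->
          (norm_of (F_ i) x <= (1000 / (m_ (4 * i - 3))%:R ^+ 2)%:E)%E) /\
        ((j < i)%N ->
          (norm_of (F_ i) x <= (1000 * ((m_ (4 * j - 3))%:R ^+ 2 /
                                        (m_ (4 * i - 3))%:R ^+ 2))%:E)%E)].

(* The index set depends on the representation of Phi, hence the extra
   argument. *)
Definition tau_rep D (n : nat) (Phi : c00) (I : set nat) : Prop :=
  exists s (b : bool) (E : interval nat),
    [/\ F_special s, (size s <= n)%N,
        forall i, (i < size s)%N -> exact_functional D (ind s i) s`_i,
        Phi = (-1) ^+ b *: restrict E (\sum_(f <- s) f)
      & I = [set ind s i | i in [set i | (i < size s)%N /\
                                exists2 k, k \in E & ran s`_i k]]].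

Definition G_step D (n : nat) : set c00 :=
  [set f | exists (d : nat) (Phi : 'I_d -> c00) (I : 'I_d -> set nat)
      (b : 'I_d -> bool),
    [/\ forall i, tau_rep D n (Phi i) (I i),
        forall i k, supp (Phi i) k -> (d <= k)%N,
        trivIset [set: 'I_d] I
      & f = \sum_i (-1) ^+ b i *: Phi i]].

Fixpoint stage (n : nat) : (nat -> set c00) * set c00 :=
  if n is n'.+1 then
    let: (K, D) := stage n' in
    (K_step K D,
     convQ ((\bigcup_w K_step K D w) `|` G_step D n `|` D))
  else (fun w => if w is 0 then Fset else set0, convQ Fset).

Definition K_ (n w : nat) : set c00 := (stage n).1 w.
Definition D_ (n : nat) : set c00 := (stage n).2.

Definition tau_ (n : nat) : set c00 :=
  if n is n'.+1 then [set Phi | exists I, tau_rep (D_ n') n Phi I] else set0.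

Definition norming_set : set c00 := \bigcup_n D_ n.
Definition tau : set c00 := \bigcup_n tau_ n.

Definition survivors : set (nat -> c00) :=
  [set phi | F_special_infinite phi /\
    forall d, (0 < d)%N -> tau (\sum_(i < d) phi i)].

Definition X_norm x : \bar R :=
  ereal_sup [set (pairing f x)%:E | f in norming_set].

End norming_set.

Section completion.
Variables (R : realType) (X : completeNormedModType R).

Definition is_completion (N : c00 R -> \bar R) (i : {linear c00 R -> X}) :
    Prop :=
  (forall x, `|i x|%:E = N x) /\ dense (range i).

(* The extension of e_n^* to the completion is determined by its values on the
   dense subspace range i. *)
Definition coordinate_functionals (i : {linear c00 R -> X}) : set (dual X) :=
  [set g | exists2 n, (0 < n)%N &
    forall x : c00 R, g (i x) = pairing (unit_vec n) x].

End completion.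

(* Main.v *)
(* Write N for the norm on c00 and call "branch" the functional attached to a
   survivor sequence.

   Density. Let f be a functional of norm at most 1 whose distance to the span of
   the coordinates and the branches exceeds 3/4. By Helly's theorem there are
   vectors x with f x = 1 and N x <= 4/3, supported arbitrarily far out, that are
   killed by any given finite set of branches. Only few branches can be large on a
   sequence of such vectors, so averages over several sequences, each killing the
   branches that are large on the previous ones, are eventually small on every
   branch. A pointwise limit of functionals in tau is finitely supported or comes
   from a survivor, so Simons' inequality yields convex combinations that are
   uniformly small on tau. As a sum of d elements of tau in G_n starts after d,
   averages of successive vectors of this kind are uniformly small on all G_n.
   Apply Simons' inequality once more, to the functionals of weight m_w: by
   compactness of the Schreier families, a limit of these is a finitely supported
   functional plus 1/m_w <= 1/2 times a functional of norm at most 1. This gives a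
   vector x with f x = 1 and N x < 1, which is absurd. So every functional is
   within 3/4 of its norm from the span, and one iterates.

   Coefficients. The blocks of a survivor are exact for every D_n. A limit of the
   witnessing vectors gives, for each block, a vector of norm at most 1000 on which
   the survivor takes the value 1; on these vectors every other branch and every
   coordinate tends to 0. The limit of g along them is the coefficient of g at the
   survivor. Conversely, sufficiently late tails of d distinct survivors have
   disjoint indices, so their signed sums belong to G_n and have norm at most 1.
   Hence the coefficients identify the quotient with c_0. *)

From HB Require Import structures.
From mathcomp Require Import all_boot all_order all_algebra finmap.
From mathcomp Require Import all_classical all_reals all_analysis.
From mathcomp Require Import zify lra.
Require Import Defs.

Set Implicit Arguments.
Unset Strict Implicit.
Unset Printing Implicit Defensive.

Import Order.TTheory GRing.Theory Num.Theory.
Import numFieldNormedType.Exports.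

Local Open Scope classical_set_scope.
Local Open Scope ring_scope.

(** * Schreier families *)

(** Transitivity of [before] passes through an element of the set in between, which is why the sets
    are required to be nonempty. *)
Lemma before_chain (A : nat -> set nat) m :
  (forall i, (i.+1 < m)%N -> before (A i) (A i.+1)) ->
  (forall i, (i < m)%N -> A i !=set0) ->
  forall i j, (i < j)%N -> (j < m)%N -> before (A i) (A j).
Proof.
move=> Ab A0 i; elim=> // j IH; rewrite ltnS leq_eqVlt => /orP[/eqP ->|ij] jm.
  exact: Ab.
move=> k l Ak Al; have [x Ax] := A0 j (ltnW jm).
by apply: ltn_trans (IH ij (ltnW jm) k x Ak Ax) _; exact: Ab Ax Al.
Qed.

Lemma before_index (A : nat -> set nat) m i j k l :
  (forall i, (i.+1 < m)%N -> before (A i) (A i.+1)) ->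
  (forall i, (i < m)%N -> A i !=set0) ->
  (i < m)%N -> (j < m)%N -> A i k -> A j l -> (k <= l)%N -> (i <= j)%N.
Proof.
move=> Ab A0 im jm Aik Ajl kl; rewrite leqNgt; apply/negP => ji.
by have := before_chain Ab A0 ji im Ajl Aik; rewrite ltnNge kl.
Qed.

Section schreier_compactness.

Lemma incr_homo (t : nat -> nat) :
  (forall k, (t k < t k.+1)%N) -> {homo t : x y / (x <= y)%N}.
Proof.
by move=> ht; apply: homo_leq => [x|y x z|k]; [|exact: leq_trans|exact: ltnW].
Qed.

Lemma slot_inj (t : nat -> nat) k l x y :
  (forall k, (t k < t k.+1)%N) -> (t k <= x < t k.+1)%N ->
  (t l <= y < t l.+1)%N -> (x <= y)%N -> (k <= l)%N.
Proof.
move=> /incr_homo tm /andP[kx _] /andP[_ yl] xy; rewrite -ltnS ltnNge.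
by apply/negP => /tm /(leq_trans yl); rewrite ltnNge (leq_trans kx).
Qed.

(** Compactness in a uniform finitary form; the sets [[t k, t k.+1[] are called slots below. *)
Definition misses_slot (t : nat -> nat) (S : set {fset nat}) M :=
  forall F, S F -> exists2 k, (k < M)%N &
    forall x, x \in F -> ~~ (t k <= x < t k.+1)%N.

Lemma schreier_misses n (t : nat -> nat) :
  (forall k, (t k < t k.+1)%N) -> exists M, misses_slot t (schreier n) M.
Proof.
rewrite /schreier; elim: n.-1 t => [|{}n IH] t ht.
  (* A set meeting all these slots has an element below [t 1], hence fewer than [t 1] elements,
     although it needs [t 1 + 1] of them. *)
  exists (t 1%N).+1 => F /= SF; apply: contrapT => nex.
  have hits k : (k < (t 1%N).+1)%N -> exists2 x, x \in F & (t k <= x < t k.+1)%N.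
    move=> kt; apply: contrapT => nx; apply: nex; exists k => // x xF.
    by apply/negP => xt; apply: nx; exists x.
  have /choice[g hg] : forall k, exists x, (k < (t 1%N).+1)%N ->
      x \in F /\ (t k <= x < t k.+1)%N.
    move=> k; have [/hits[x xF xt]|] := boolP (k < (t 1%N).+1)%N; last by exists 0%N.
    by exists x.
  have [x xF /andP[_ xt]] := hits 0%N isT.
  have := leq_ltn_trans (SF x xF) xt; apply/negP; rewrite -leqNgt.
  pose s := [seq g k | k <- iota 0 (t 1%N).+1].
  have us : uniq s.
    rewrite map_inj_in_uniq ?iota_uniq// => k l; rewrite !mem_iota /= add0n.
    move=> /hg[_ gk] /hg[_ gl] gkl; apply/eqP; rewrite eqn_leq.
    by rewrite (slot_inj ht gk gl) ?gkl// (slot_inj ht gl gk) ?gkl.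
  apply: leq_trans (_ : (size s <= _)%N); first by rewrite size_map size_iota.
  apply: uniq_leq_size => // y /mapP[k]; rewrite mem_iota /= add0n => kt ->.
  exact: (hg k kt).1.
(* For unions of at most [d] successive members, with [d] fixed, induct on [d]; the sets after the
   first are tested on the slots from [M1] on. *)
have dM d : forall t : nat -> nat, (forall k, (t k < t k.+1)%N) ->
    exists M, forall s : seq {fset nat}, (size s <= d)%N ->
      (forall A, A \in s -> iter n schreier_step schreier1 A /\ A != fset0) ->
      (forall i, (i.+1 < size s)%N ->
          before [set` nth fset0 s i] [set` nth fset0 s i.+1]) ->
      exists2 k, (k < M)%N & forall A x, A \in s -> x \in A ->
         ~~ (t k <= x < t k.+1)%N.
  elim: d => [|d IHd] {}t {}ht.
    by exists 1%N => s; rewrite leqn0 size_eq0 => /eqP -> _ _; exists 0%N.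
  have [M1 hM1] := IH t ht.
  have [M2 hM2] := IHd (fun k => t (M1 + k)%N) ltac:(by move=> k /=; rewrite addnS).
  exists (M1 + M2).+1 => -[|A s] /=; first by exists 0%N.
  rewrite ltnS => sd sS sb.
  have [k kM1 Ak] := hM1 A (sS A (mem_head _ _)).1.
  have [l lM2 sl] : exists2 k, (k < M2)%N & forall A x, A \in s -> x \in A ->
         ~~ (t (M1 + k)%N <= x < t (M1 + k.+1)%N)%N.
    apply: hM2 => // [B Bs|i ii]; first by apply: sS; rewrite in_cons Bs orbT.
    exact: sb i.+1 ii.
  (* If a later set meets the slot missed by [A], then [A] ends before the shifted slots begin, so a
     shifted slot missed by [s] is missed by [A] too. *)
  have [sk|/existsNP[B /existsNP[y /not_implyP[Bs /not_implyP[yB]]]]] :=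
    pselect (forall B x, B \in s -> x \in B -> ~~ (t k <= x < t k.+1)%N).
    exists k; first by lia.
    by move=> B x; rewrite in_cons => /predU1P[->|]; [exact: Ak|exact: sk].
  move=> /negP; rewrite negbK => /andP[_ yt].
  exists (M1 + l)%N; first by lia.
  move=> C x; rewrite in_cons => /predU1P[->{C} xA|Cs xC]; last first.
    by rewrite -addnS; exact: sl xC.
  apply/negP => /andP[tx _].
  have xy : (x < y)%N.
    have Bi : (index B s < size s)%N by rewrite index_mem.
    apply: (@before_chain (fun i => [set` nth fset0 (A :: s) i]) (size s).+1 sb _
       0 (index B s).+1) => //=; last by rewrite nth_index.
    move=> i ii; have /sS[_ /fset0Pn[z zi]] : nth fset0 (A :: s) i \in A :: s.
      by rewrite mem_nth.
    by exists z.
  have : (t k.+1 <= t (M1 + l))%N by apply: incr_homo => //; lia.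
  by lia.
have [M hM] := dM (t 1%N) t ht.
exists M.+1 => F /= [s [sS sb smin ->]].
have [s0|s0] := posnP (size s).
  by exists 0%N => // x; rewrite (size0nil s0) big_nil.
have A0s : nth fset0 s 0 \in s by exact: mem_nth.
have [_ /fset0Pn[a aA]] := sS _ A0s.
have inF x : x \in (\bigcup_(A <- s) A)%fset -> exists2 A, A \in s & x \in A.
  by move=> /bigfcupP[A]; rewrite andbT => As xA; exists A.
(* A union without elements below [t 1] misses slot 0. Otherwise it has at most [t 1] pieces, a
   bound independent of the set. *)
have [hit|nhit] := pselect (exists2 x, x \in (\bigcup_(A <- s) A)%fset & (x < t 1%N)%N); last first.
  exists 0%N => // x xF; apply/negP => /andP[_ xt].
  by apply: nhit; exists x.
move: hit => [x /inF[A As xA] xt].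
have at1 : (size s <= t 1%N)%N.
  have [iA0|iA] := posnP (index A s).
    apply/ltnW/(leq_ltn_trans _ xt)/smin.
    by rewrite -iA0 nth_index.
  apply: leq_trans (smin _ aA) _; apply: ltnW; apply: ltn_trans xt.
  apply: (@before_chain (fun i => [set` nth fset0 s i]) (size s) sb _ 0 (index A s)) => //=.
  - move=> i ii; have /sS[_ /fset0Pn[z zi]] := mem_nth fset0 ii.
    by exists z.
  - by rewrite index_mem.
  - by rewrite nth_index.
have [k kM kF] := hM s at1 sS sb.
exists k; first exact: ltnW.
by move=> z /inF[B Bs zB]; exact: kF zB.
Qed.

End schreier_compactness.

(** * Simons' inequality, Helly's theorem and ultralimits *)

Section simons.
Variables (R : realType) (V : lmodType R) (T : Type) (ev : T -> V -> R).
Hypothesis evl : forall b (a : R) x y, ev b (a *: x + y) = a * ev b x + ev b y.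
Variables (P : set T) (C : nat -> set V) (M m d : R).
Hypothesis Cdec : forall n x, C n.+1 x -> C n x.
Hypothesis Cconv : forall n x y (t : R), 0 <= t <= 1 -> C n x -> C n y ->
  C n (t *: x + (1 - t) *: y).
Hypothesis C0 : forall n, C n !=set0.
Hypothesis M0 : 0 < M.
Hypothesis CM : forall x b, C 0 x -> P b -> `|ev b x| <= M.
Hypothesis Cm : forall x, C 0 x -> exists2 b, P b & m <= ev b x.
Hypothesis dm : 0 < d <= m.

(** The supremum [S] is meaningful only for bounded sets of values, so the argument stays inside the
    subspace [W]. *)
Let W : set V := [set x | exists B : R, forall b, P b -> `|ev b x| <= B].
Let S x : R := sup [set ev b x | b in P].

Let P0 : P !=set0.
Proof. by have [x /Cm[b Pb _]] := C0 0; exists b. Qed.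

Let Wsup x : W x -> has_sup [set ev b x | b in P].
Proof.
move=> [B xB]; have [b Pb] := P0; split; first by exists (ev b x), b.
by exists B => _ [c /xB + <-]; apply: le_trans; rewrite ler_norm.
Qed.

Let S_ub x b : W x -> P b -> ev b x <= S x.
Proof. by move=> /Wsup[_ xB] Pb; apply: ub_le_sup => //; exists b. Qed.

Let S_adh x e : W x -> 0 < e -> exists2 b, P b & S x - e < ev b x.
Proof.
by move=> /Wsup xs e0; have [_ [b Pb <-] xb] := sup_adherent e0 xs; exists b.
Qed.

Let ev0 b : ev b 0 = 0.
Proof. by have := evl b 1 0 0; rewrite scaler0 addr0; lra. Qed.

Let WZD a x y : W x -> W y -> W (a *: x + y).
Proof.
move=> [B xB] [B' yB]; exists (`|a| * B + B') => b Pb; rewrite evl.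
rewrite (le_trans (ler_normD _ _))// lerD ?yB// normrM.
by rewrite ler_wpM2l// xB.
Qed.

Let CW n x : C n x -> W x.
Proof.
move=> Cx; exists M => b Pb; apply: CM => //.
by elim: n Cx => // n IH /Cdec.
Qed.

Let S_conv a x y : 0 <= a -> W x -> W y ->
  (1 + a) * S ((1 + a)^-1 *: (a *: x + y)) <= a * S x + S y.
Proof.
move=> a0 Wx Wy; rewrite -ler_pdivlMl ?ltr_wpDr//.
apply: ge_sup; first by have [b Pb] := P0; exists (ev b ((1 + a)^-1 *: (a *: x + y))), b.
move=> _ [b Pb <-]; rewrite -[X in ev b X]addr0 evl ev0 addr0 evl.
apply: ler_wpM2l; first by rewrite invr_ge0 addr_ge0.
by apply: lerD; [apply: ler_wpM2l => //; exact: S_ub|exact: S_ub].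
Qed.

(** The loss [d] is split in three: the errors [ep n] of the near-minimisers, the choice of an
    almost norming [b], and the tail of the series. The ratio [la] is chosen so that the sum of
    [la ^+ k * M] over [k > n] equals [la ^+ n * dl]. *)
Let dl : R := d / 3.
Let la : R := dl / (M + dl).
Let ep n : R := la ^+ n.+1 * (dl * 2^-1 ^+ n.+2).

Let dl0 : 0 < dl. Proof. by have /andP[] := dm; rewrite /dl; lra. Qed.
Let la0 : 0 < la. Proof. by rewrite divr_gt0// addr_gt0. Qed.
Let la1 : la < 1. Proof. by rewrite ltr_pdivrMr ?addr_gt0// mul1r ltrDr. Qed.
Let laM : la * M = dl * (1 - la).
Proof.
have h : la * (M + dl) = dl by rewrite divfK// lt0r_neq0// addr_gt0.
by rewrite mulrBr mulr1 [dl * la]mulrC -[X in X - _]h mulrDr addrK.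
Qed.
Let ep0 n : 0 < ep n.
Proof.
apply: mulr_gt0; first exact: exprn_gt0.
by apply: mulr_gt0 => //; apply: exprn_gt0; rewrite invr_gt0.
Qed.

Let near_min n z : W z -> exists y, C n y /\ forall y', C n y' ->
  S (la ^+ n *: y + z) <= S (la ^+ n *: y' + z) + ep n.
Proof.
move=> Wz.
pose A : set R := [set S (la ^+ n *: y + z) | y in C n].
have Ai : has_inf A.
  have [y Cy] := C0 n; split; first by exists (S (la ^+ n *: y + z)), y.
  have [b Pb] := P0; have [B zB] := Wz.
  exists (- (la ^+ n * M) - B) => _ [y' Cy' <-].
  apply: le_trans (S_ub (WZD (la ^+ n) (CW Cy') Wz) Pb); rewrite evl.
  have Cy0 : C 0 y' by elim: (n) Cy' => // k IH /Cdec.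
  have /ler_normlP[yM _] := CM Cy0 Pb; have /ler_normlP[zB' _] := zB b Pb.
  have : la ^+ n * - ev b y' <= la ^+ n * M by rewrite ler_wpM2l ?exprn_ge0 ?(ltW la0).
  by rewrite mulrN; lra.
have [_ [y Cy <-] yA] := inf_adherent (ep0 n) Ai.
exists y; split => // y' Cy'; apply: le_trans (ltW yA) _.
by rewrite lerD2r; apply: ge_inf; [exact: Ai.2|exists y'].
Qed.

(* [y n] nearly minimises [S (la ^+ n *: y + z n)] over [C n]. Comparing it with
   a convex combination of [y n] and [y n.+1] shows that the increments of [S]
   along [z] decay no faster than [m * la ^+ n]. *)
Lemma simons : exists y : nat -> V, (forall n, C n (y n)) /\
  forall N, exists2 b, P b & forall n, (n <= N)%N -> m - d <= ev b (y n).
Proof.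
have /choice[f hf] : forall nz : nat * V, exists y, W nz.2 -> C nz.1 y /\
    forall y', C nz.1 y' ->
    S (la ^+ nz.1 *: y + nz.2) <= S (la ^+ nz.1 *: y' + nz.2) + ep nz.1.
  move=> [n z] /=; have [/(near_min n)[y hy]|] := pselect (W z); first by exists y.
  by exists 0.
pose z := fix z n := if n is k.+1 then la ^+ k *: f (k, z k) + z k else 0.
have Wz n : W (z n).
  elim: n => [|n IH]; first by exists 0 => b _; rewrite ev0 normr0.
  by apply: WZD => //; exact: (@CW n _ (hf (n, z n) IH).1).
pose y n := f (n, z n).
have Cy n : C n (y n) by exact: (hf (n, z n) (Wz n)).1.
have zS n : z n.+1 = la ^+ n *: y n + z n by [].
have C0y n : C 0 (y n).
  have : C n (y n) := Cy n.
  by elim: (n in C n _) => // k IH /Cdec.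
(* With the competitor [(1 + la)^-1 *: (la *: y n.+1 + y n)] the vector to be minimised becomes
   [(1 + la)^-1 *: (la *: z n + z n.+2)], so near-minimality relates three consecutive values of [S]
   along [z]. *)
have step n : la * (S (z n.+1) - S (z n)) - 2 * ep n <= S (z n.+2) - S (z n.+1).
  have Cc : C n ((1 + la)^-1 *: (la *: y n.+1 + y n)).
    have -> : (1 + la)^-1 *: (la *: y n.+1 + y n) =
       (1 + la)^-1 *: y n + (1 - (1 + la)^-1) *: y n.+1.
      rewrite scalerDr addrC scalerA; congr (_ + _ *: _).
      have : (1 + la)^-1 * (1 + la) = 1 by rewrite mulVf// lt0r_neq0// addr_gt0.
      by rewrite mulrDr mulr1; lra.
    apply: Cconv => //; last exact: Cdec.
    by rewrite invr_ge0 invf_le1 ?addr_gt0// lerDl (ltW la0) addr_ge0 ?(ltW la0).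
  have := (hf (n, z n) (Wz n)).2 _ Cc; rewrite /= -zS.
  have -> : la ^+ n *: ((1 + la)^-1 *: (la *: y n.+1 + y n)) + z n =
     (1 + la)^-1 *: (la *: z n + z n.+2).
    have zE : z n = (1 + la)^-1 *: ((1 + la) *: z n).
      by rewrite scalerA mulVf ?scale1r// lt0r_neq0// addr_gt0.
    rewrite [X in _ + X = _]zE scalerA [X in X *: _ + _]mulrC -scalerA -scalerDr.
    congr (_ *: _); rewrite scalerDr scalerA -exprSr scalerDl scale1r !zS.
    by rewrite [RHS]addrC -!addrA.
  have := @S_conv la (z n) (z n.+2) (ltW la0) (Wz n) (Wz n.+2).
  set s := S (_ *: _) => h1 h2.
  have : (1 + la) * S (z n.+1) <= (1 + la) * (s + ep n).
    by rewrite ler_wpM2l ?addr_ge0 ?(ltW la0).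
  have := mulr_ge0 (ltW la0) (ltW (ep0 n)).
  have : la * ep n <= ep n by rewrite ler_piMl ?(ltW la1) ?(ltW (ep0 n)).
  rewrite !mulrDl !mulrDr !mul1r; rewrite mulrDl mul1r in h1; lra.
have S0 : S (z 0%N) = 0.
  rewrite /S /=; have [b Pb] := P0.
  rewrite (_ : [set ev b 0 | b in P] = [set 0]) ?sup1//; apply/seteqP; split=> [_ [c _ <-]|_ ->].
    by rewrite /= ev0.
  by exists b.
have grow n : la ^+ n * (m - dl * (1 - 2^-1 ^+ n)) <= S (z n.+1) - S (z n).
  elim: n => [|n IH].
    rewrite !expr0 subrr mulr0 subr0 mul1r S0 subr0.
    have [b Pb /le_trans] := Cm (C0y 0%N); apply.
    rewrite [leLHS](_ : _ = ev b (z 1%N)) ?S_ub//.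
    by rewrite zS evl expr0 mul1r ev0 addr0.
  apply: le_trans (step n).
  have : la * (la ^+ n * (m - dl * (1 - 2^-1 ^+ n))) <= la * (S (z n.+1) - S (z n)).
    by rewrite ler_wpM2l ?(ltW la0).
  rewrite /ep mulrA -exprS !mulrBr !mulr1 exprS [2^-1 ^+ n.+2]exprS [2^-1 ^+ n.+1]exprS.
  set A := la * la ^+ n; set B := (2^-1 : R) ^+ n.
  have -> : 2 * (A * (dl * (2^-1 * (2^-1 * B)))) = A * (dl * B) / 2 by lra.
  have -> : A * (dl * (2^-1 * B)) = A * (dl * B) / 2 by lra.
  lra.
have incr n : la ^+ n * (m - dl) <= S (z n.+1) - S (z n).
  apply: le_trans (grow n); rewrite ler_wpM2l ?exprn_ge0 ?(ltW la0)//.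
  have := mulr_gt0 dl0 (exprn_gt0 n (_ : 0 < 2^-1 :> R)).
  by rewrite invr_gt0 => /(_ (ltr0n _ 2)); rewrite mulrBr mulr1; lra.
have md : 0 <= m - dl by have /andP[] := dm; rewrite /dl; lra.
have Sm n k : S (z n) <= S (z (n + k)%N).
  elim: k => [|k IH]; first by rewrite addn0.
  apply: le_trans IH _; rewrite addnS -subr_ge0; apply: le_trans (incr _).
  by rewrite mulr_ge0 ?exprn_ge0 ?(ltW la0).
exists y; split=> // N.
have laN0 n : 0 < la ^+ n by rewrite exprn_gt0.
(* One [b] serves all [n <= N]: [ev b (z n)] is at most [S (z n)], and the terms after [n] add at
   most [la ^+ n * dl]. *)
have [b Pb bz] := @S_adh (z N.+1) (la ^+ N * dl) (Wz _) ltac:(by rewrite mulr_gt0).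
exists b => // n nN.
have tail k : (1 - la) * (ev b (z (n.+1 + k)%N) - ev b (z n.+1)) <=
    M * (la ^+ n.+1 - la ^+ (n.+1 + k)).
  elim: k => [|k IH]; first by rewrite addn0 !subrr !mulr0.
  rewrite addnS zS evl [la ^+ (n.+1 + k).+1]exprS.
  have /ler_normlP[_ yM] := CM (C0y (n.+1 + k)%N) Pb.
  have h : (1 - la) * la ^+ (n.+1 + k) * ev b (y (n.+1 + k)%N) <=
    (1 - la) * la ^+ (n.+1 + k) * M.
    by rewrite ler_wpM2l ?mulr_ge0 ?exprn_ge0 ?(ltW la0) ?subr_ge0 ?(ltW la1).
  lra.
have E : (n.+1 + (N - n) = N.+1)%N by rewrite addSn subnKC.
have := tail (N - n)%N; rewrite E; have := Sm n.+1 (N - n)%N; rewrite E.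
have := incr n; have := S_ub (Wz n) Pb.
have := laN0 N; have : la ^+ N <= la ^+ n by rewrite ler_wiXn2l ?(ltW la0) ?(ltW la1).
move=> laNn laN1 h1 h2 h3 h4.
have h5 : (1 - la) * (ev b (z N.+1) - ev b (z n.+1)) <=
   (1 - la) * (la ^+ n * dl).
  apply: le_trans h4 _; have := mulr_gt0 M0 (laN0 N.+1).
  have -> : (1 - la) * (la ^+ n * dl) = la ^+ n * (dl * (1 - la)) by lra.
  by rewrite -laM [la ^+ n.+1]exprS mulrBr; lra.
rewrite ler_pM2l ?subr_gt0// in h5.
have h6 : la ^+ N * dl <= la ^+ n * dl by rewrite ler_wpM2r ?(ltW dl0).
have : la ^+ n * (m - d) <= la ^+ n * ev b (y n).
  have -> : la ^+ n * ev b (y n) = ev b (z n.+1) - ev b (z n) by rewrite zS evl; lra.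
  have -> : d = 3 * dl by rewrite /dl; lra.
  lra.
by rewrite ler_pM2l.
Qed.

End simons.

(** * Helly's theorem for finitely many functionals *)

Section helly.
Variables (R : realType) (V : lmodType R) (p : V -> R) (th : R).
Hypothesis p_sub : forall x y, p (x - y) <= p x + p y.
Hypothesis pZ : forall (a : R) x, p (a *: x) = `|a| * p x.
Hypothesis th0 : 0 <= th.

Definition scalar_fun (f : V -> R) := forall (a : R) x y, f (a *: x + y) = a * f x + f y.

Lemma lfun0 f : scalar_fun f -> f 0 = 0.
Proof. by move=> fl; have := fl 1 0 0; rewrite scaler0 addr0; lra. Qed.

Lemma lfunZ f a x : scalar_fun f -> f (a *: x) = a * f x.
Proof. by move=> fl; have := fl a x 0; rewrite lfun0// !addr0. Qed.

Lemma lfunB f x y : scalar_fun f -> f (x - y) = f x - f y.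
Proof. by move=> fl; rewrite addrC -scaleN1r fl mulN1r addrC. Qed.

Lemma lfun_sum (I : eqType) (r : seq I) (a : I -> R) (g : I -> V -> R) :
  (forall q, q \in r -> scalar_fun (g q)) -> scalar_fun (fun x => \sum_(q <- r) a q * g q x).
Proof.
move=> gl b x y; rewrite mulr_sumr -big_split; apply: eq_big_seq => q /gl qr /=.
by rewrite qr mulrDr !mulrA [a q * b]mulrC.
Qed.

(** Two points of the slice [g = 1] differ by an element of the kernel of [g], so the intervals of
    radius [th * p x] around [f x] pairwise meet. The supremum of their left ends lies in all of
    them, and homogeneity covers the other nonzero values of [g]. *)
Lemma helly_step (W : set V) (f g : V -> R) : scalar_fun f -> scalar_fun g ->
  (forall a x y, W x -> W y -> W (a *: x + y)) ->
  (forall x, W x -> g x = 0 -> `|f x| <= th * p x) ->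
  exists a : R, forall x, W x -> `|f x - a * g x| <= th * p x.
Proof.
move=> fl gl Wl fp.
have WZ a x : W x -> W (a *: x).
  move=> Wx; have W0 : W 0 by have := Wl (-1) x x Wx Wx; rewrite scaleN1r addNr.
  by have := Wl a x 0 Wx W0; rewrite addr0.
pose A : set R := [set f x - th * p x | x in [set x | W x /\ g x = 1]].
have Aub y : W y -> g y = 1 -> ubound A (f y + th * p y).
  move=> Wy gy _ [x [Wx gx] <-].
  have Wxy : W (x - y) by have := Wl (-1) y x Wy Wx; rewrite scaleN1r addrC.
  have := fp _ Wxy; rewrite (lfunB x y fl) (lfunB x y gl) gx gy subrr.
  move=> /(_ erefl) /ler_normlP[_].
  by have := ler_wpM2l th0 (p_sub x y); rewrite mulrDr; lra.
exists (sup A).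
have key x : W x -> g x = 1 -> `|f x - sup A| <= th * p x.
  move=> Wx gx; have Ax : A (f x - th * p x) by exists x.
  have hA : has_sup A by split; [exists (f x - th * p x)|exists (f x + th * p x); exact: Aub].
  have := ub_le_sup hA.2 Ax; have := ge_sup hA.1 (Aub x Wx gx).
  by move=> h1 h2; rewrite ler_norml; apply/andP; split; lra.
move=> x Wx; have [gx0|gx0] := eqVneq (g x) 0; first by rewrite gx0 mulr0 subr0 fp.
have := key ((g x)^-1 *: x) (WZ _ _ Wx); rewrite (lfunZ _ _ fl) (lfunZ _ _ gl) mulVf// => /(_ erefl).
rewrite pZ => /(ler_wpM2l (normr_ge0 (g x))).
rewrite -normrM mulrCA normfV mulVKf ?normr_eq0//; congr (`|_| <= _).
by rewrite mulrDr mulrN mulVKf// [g x * _]mulrC.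
Qed.

(** Removes one functional at a time: on the common kernel of the others, a multiple of [g] corrects
    [f]. *)
Lemma helly (s : seq (V -> R)) (f : V -> R) : scalar_fun f ->
  (forall g, g \in s -> scalar_fun g) ->
  (forall x, (forall g, g \in s -> g x = 0) -> `|f x| <= th * p x) ->
  exists2 r : seq (R * (V -> R)), (forall q, q \in r -> q.2 \in s) &
    forall x, `|f x - \sum_(q <- r) q.1 * q.2 x| <= th * p x.
Proof.
elim: s f => [|g s IH] f fl sl fp.
  by exists [::] => // x; rewrite big_nil subr0; exact: fp.
have gl : scalar_fun g by apply: sl; exact: mem_head.
have sl' h : h \in s -> scalar_fun h by move=> hs; apply: sl; rewrite in_cons hs orbT.
have [||a ha] := @helly_step [set x | forall h, h \in s -> h x = 0] f g fl gl.
- by move=> a x y /= hx hy h hs; rewrite (sl' h hs) hx// hy// mulr0 addr0.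
- move=> x /= hx gx; apply: fp => h; rewrite in_cons => /predU1P[->//|]; exact: hx.
have fl' : scalar_fun (fun x => f x - a * g x).
  by move=> b x y; rewrite fl gl; lra.
have [r rs hr] := IH _ fl' sl' ha.
exists ((a, g) :: r).
  by move=> q; rewrite !in_cons => /predU1P[->|/rs ->]; rewrite ?eqxx ?orbT.
by move=> x; rewrite big_cons /= opprD addrA; exact: hr.
Qed.

End helly.

(** * Limits along a free ultrafilter *)

Section ultralimit.
Variable R : realType.

Lemma free_ultrafilter : exists2 U : set_system nat, UltraFilter U & \oo `<=` U.
Proof.
by have [U [UU ooU]] := @ultraFilterLemma nat \oo _; exists U.
Qed.

Lemma ultra_fmap (T T' : Type) (u : T -> T') (U : set_system T) :
  UltraFilter U -> UltraFilter (u @ U).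
Proof.
move=> UU; split; first exact: fmap_proper_filter.
move=> G PG sG; apply/seteqP; split => // A GA.
have [//|/= UA] := in_ultra_setVsetC (u @^-1` A) UU.
have /sG GnA : (u @ U) (~` A) by [].
by have := @filter_ex _ G PG _ (filterI GA GnA); rewrite setICr => -[].
Qed.

Lemma ultra_bounded_cvg (U : set_system nat) (u : nat -> R) (M : R) :
  UltraFilter U -> (forall n, `|u n| <= M) -> u @ U --> lim (u @ U).
Proof.
move=> UU uM; have := @segment_compact R (- M) M.
rewrite compact_ultra => cpt.
have FA : (u @ U) `[- M, M]%classic.
  apply: (@filterS _ U _ setT) filterT => n _.
  by rewrite /= in_itv /= -ler_norml; exact: uM.
have [l [_ ul]] := cpt (u @ U) (ultra_fmap u UU) FA.
by rewrite (cvg_lim _ ul).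
Qed.

Lemma ultra_finite (T : eqType) (U : set_system nat) (f : nat -> T) (s : seq T) :
  UltraFilter U -> (\forall n \near U, f n \in s) ->
  exists2 a, a \in s & \forall n \near U, f n = a.
Proof.
move=> UU; elim: s => [|a s IH] fs.
  by have [n] := @filter_ex _ U _ _ fs.
have [fa|nfa] := pselect (U [set n | f n = a]).
  by exists a => //; exact: mem_head.
have [//|/= {}nfa] := in_ultra_setVsetC [set n | f n = a] UU.
have [|b bs fb] := IH.
  apply: filterS2 fs nfa => n /=.
  by rewrite in_cons => /predU1P[->//|].
by exists b => //; rewrite in_cons bs orbT.
Qed.

End ultralimit.

(** * Finitely supported sequences *)

Section c00_action.
Variable R : realType.
Implicit Types (a b : nat -> R) (x y f : c00 R).

Lemma c00_bound x : exists M, forall k, (M <= k)%N -> x k = 0.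
Proof.
have /asboolP[_ fin] := c00P x.
have /finite_seqP[s sE] := fin.
exists (\max_(k <- s) k).+1 => k Mk; apply/eqP; apply: contraTT isT => xk.
have ks : k \in s by have : [set` s] k by rewrite -sE.
by have := leq_trans Mk (@leq_bigmax_seq _ _ predT id _ ks isT); rewrite ltnn.
Qed.

Lemma c00_at0 x : x 0%N = 0.
Proof. by have /asboolP[] := c00P x. Qed.

Lemma c00_neq0 x : x <> 0 -> supp x !=set0.
Proof.
move=> x0; apply: contrapT => nx; apply: x0; apply/val_inj/funext => k /=.
by apply: contrapT => /eqP xk; apply: nx; exists k.
Qed.

Lemma c00_linE (t : R) x y k : (t *: x + y) k = t * x k + y k.
Proof. by []. Qed.

Lemma c00_sumE (I : Type) (r : seq I) (P : pred I) (F : I -> c00 R) k :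
  (\sum_(j <- r | P j) F j) k = \sum_(j <- r | P j) F j k.
Proof.
by apply: (big_morph (fun x : c00 R => (x : nat -> R^o) k)).
Qed.

Lemma c00_trunc (u : nat -> R) (M : nat) :
  exists x : c00 R, forall k, x k = if (0 < k < M)%N then u k else 0.
Proof.
have xP : (fun k => if (0 < k < M)%N then u k else 0) \in @c00_pred R.
  apply: (@c00_memP _ _ M) => [//|k Mk].
  by rewrite [(k < M)%N]ltnNge Mk andbF.
by exists (C00 xP).
Qed.

(* [act f] is [pairing f] when [f] is in [c00]; branches of infinite special
   sequences act on [c00] as well but do not belong to it. *)
Definition act a x : R := \sum_(k \in [set: nat]) a k * x k.

Lemma pairing_act f x : pairing f x = act f x. Proof. by []. Qed.

Lemma actE a x M : (forall k, (M <= k)%N -> x k = 0) ->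
  act a x = \sum_(k < M) a k * x k.
Proof.
move=> xM; apply/esym; rewrite (fsbig_ord _ _ (fun k => a k * x k)).
apply: fsbig_widen => // k /= [_ /negP].
by rewrite -leqNgt => /xM ->; rewrite mulr0.
Qed.

Lemma act_lfun a : scalar_fun (act a).
Proof.
move=> t x y; have [M xM] := c00_bound x; have [N yN] := c00_bound y.
have hx k : (maxn M N <= k)%N -> x k = 0 by rewrite geq_max => /andP[/xM].
have hy k : (maxn M N <= k)%N -> y k = 0 by rewrite geq_max => /andP[_ /yN].
have H k : a k * (t *: x + y) k = t * (a k * x k) + a k * y k.
  by rewrite c00_linE mulrDr mulrCA.
rewrite (actE a hx) (actE a hy) (@actE a _ (maxn M N)) => [|k hk].
  by under eq_bigr do rewrite H; rewrite big_split mulr_sumr.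
by rewrite c00_linE hx// hy// mulr0 addr0.
Qed.

Lemma eq_act a b x : (forall k, x k != 0 -> a k = b k) -> act a x = act b x.
Proof.
move=> ab; apply: eq_fsbigr => k _.
by have [->|/ab ->//] := eqVneq (x k) 0; rewrite !mulr0.
Qed.

Lemma act0 a x : (forall k, x k != 0 -> a k = 0) -> act a x = 0.
Proof.
move=> a0; have [M xM] := c00_bound x; rewrite (actE _ xM) big1// => k _.
by have [->|/a0 ->] := eqVneq (x k) 0; rewrite ?mulr0 ?mul0r.
Qed.

Lemma actDl t a b x : act (fun k => t * a k + b k) x = t * act a x + act b x.
Proof.
have [M xM] := c00_bound x; rewrite !(actE _ xM) mulr_sumr -big_split.
by apply: eq_bigr => k _ /=; rewrite mulrDl mulrA.
Qed.

Lemma actZl t a x : act (fun k => t * a k) x = t * act a x.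
Proof.
have [M xM] := c00_bound x; rewrite !(actE _ xM) mulr_sumr.
by apply: eq_bigr => k _ /=; rewrite mulrA.
Qed.

Lemma act_suml (I : Type) (r : seq I) (P : pred I) (F : I -> nat -> R) x :
  act (fun k => \sum_(j <- r | P j) F j k) x = \sum_(j <- r | P j) act (F j) x.
Proof.
have [M xM] := c00_bound x; rewrite (actE _ xM).
under [RHS]eq_bigr do rewrite (actE _ xM).
by rewrite exchange_big /=; apply: eq_bigr => k _; rewrite mulr_suml.
Qed.

Lemma act_c00_sum (I : Type) (r : seq I) (P : pred I) (F : I -> c00 R) x :
  act (\sum_(j <- r | P j) F j) x = \sum_(j <- r | P j) act (F j) x.
Proof.
by rewrite -act_suml; apply: eq_act => k _; rewrite c00_sumE.
Qed.

Lemma act_c00Z t f x : act (t *: f) x = t * act f x.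
Proof. by rewrite -actZl; apply: eq_act. Qed.

Lemma act_neq0 a x : act a x != 0 -> exists2 k, x k != 0 & a k != 0.
Proof.
apply: contraNP => nk; apply/eqP/act0 => k xk; apply/eqP.
by apply: contrapT => /negP ak; apply: nk; exists k.
Qed.

Lemma act_unit n x : act (unit_vec n : c00 R) x = x n.
Proof.
have [->|n0] := posnP n.
  rewrite c00_at0 act0// => k _ /=; rewrite /unit_vec_fun.
  by rewrite andbF.
have [M xM] := c00_bound x; rewrite (@actE _ _ (maxn M n.+1)); last first.
  by move=> k; rewrite geq_max => /andP[/xM].
have nM : (n < maxn M n.+1)%N by rewrite leq_max leqnn orbT.
rewrite (bigD1 (Ordinal nM))//= big1 => [|k kn].
  by rewrite /unit_vec_fun eqxx n0 mul1r addr0.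
rewrite /unit_vec_fun (_ : (k == n :> nat) = false) ?mul0r//.
by apply/negP => /eqP kn'; move/eqP: kn; apply; apply/val_inj.
Qed.

Lemma act_bound x : exists2 B : R, 0 < B & forall a (t : R), 0 <= t ->
  (forall k, x k != 0 -> `|a k| <= t) -> `|act a x| <= t * B.
Proof.
(* One plus the sum of the absolute values, so that the bound is positive even for the zero
   vector. *)
have [M xM] := c00_bound x; exists (1 + \sum_(k < M) `|x k|).
  by rewrite ltr_pwDl// sumr_ge0.
move=> a t t0 at_; rewrite (actE _ xM) (le_trans (ler_norm_sum _ _ _))//.
rewrite mulrDr mulr1 ler_wpDl// mulr_sumr ler_sum// => k _.
rewrite normrM; have [->|/at_ h] := eqVneq (x k) 0; first by rewrite normr0 !mulr0.
by rewrite ler_wpM2r.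
Qed.

End c00_action.

(** * Block sequences and interval restrictions *)

Section block_sequences.
Variable R : realType.
Implicit Types (f g x : c00 R) (s : seq (c00 R)).

Lemma block_supp s i : block s -> (i < size s)%N -> supp s`_i !=set0.
Proof. by move=> [_ s0 _] si; apply: c00_neq0; apply: s0; exact: mem_nth. Qed.

Lemma block_index s i j k l : block s -> (i < size s)%N -> (j < size s)%N ->
  supp s`_i k -> supp s`_j l -> (k <= l)%N -> (i <= j)%N.
Proof.
move=> bs; have [_ _ sb] := bs.
by apply: before_index sb _ => h hs; exact: block_supp.
Qed.

Lemma block_index_eq s i j k : block s -> (i < size s)%N -> (j < size s)%N ->
  supp s`_i k -> supp s`_j k -> i = j.
Proof.
move=> bs si sj ik jk; apply/eqP; rewrite eqn_leq.
by rewrite (block_index bs si sj ik jk)// (block_index bs sj si jk ik).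
Qed.

Lemma block_sum_at s i k : block s -> (i < size s)%N -> supp s`_i k ->
  (\sum_(f <- s) f) k = s`_i k.
Proof.
move=> bs si ik; rewrite c00_sumE (big_nth 0) big_mkord (bigD1 (Ordinal si))//=.
rewrite big1 ?addr0// => j ji; apply/eqP; apply: contraNT ji => jk.
by apply/eqP/val_inj; apply: (block_index_eq bs _ si jk ik).
Qed.

Lemma block_sum_supp s k : supp (\sum_(f <- s) f) k ->
  exists2 i, (i < size s)%N & supp s`_i k.
Proof.
rewrite /supp /= c00_sumE (big_nth 0) big_mkord => h.
apply: contrapT => ni; move/eqP: h; apply; rewrite big1// => i _.
by apply: contrapT => /eqP ik; apply: ni; exists i.
Qed.

Lemma block_take s n : block s -> (0 < n)%N -> block (take n s).
Proof.
move=> [s0 sn sb] n0; split.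
- by case: s s0 {sn sb} => // f s _; case: n n0.
- by move=> f /mem_take; exact: sn.
- move=> i; rewrite size_take_min leq_min => /andP[h1 h2].
  by rewrite !nth_take// 1?ltnW//; exact: sb.
Qed.

Lemma restrict_in (E : interval nat) f k : k \in E -> restrict E f k = f k.
Proof. by move=> kE /=; rewrite /restrict_fun kE. Qed.

Lemma restrict_supp (E : interval nat) f k :
  supp (restrict E f) k -> k \in E /\ supp f k.
Proof. by rewrite /supp /= /restrict_fun; case: ifP => //; rewrite eqxx. Qed.

Lemma itv_nat_convex (E : interval nat) k l n :
  k \in E -> n \in E -> (k <= l <= n)%N -> l \in E.
Proof.
case: E => a b; rewrite !itv_boundlr => /andP[ak _] /andP[_ nb] /andP[kl ln].
apply/andP; split.
  by apply: le_trans ak _; rewrite bnd_simp.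
by apply: le_trans nb; rewrite bnd_simp.
Qed.

Lemma sign_norm (b : bool) (t : R) : `|(-1) ^+ b * t| = `|t|.
Proof. by rewrite normrM normrX normrN1 expr1n mul1r. Qed.

End block_sequences.

(** * Special sequences and their branches *)

Section weights.

Lemma m_S j : (0 < j)%N -> m_ j.+1 = (m_ j ^ m_ j)%N.
Proof. by case: j. Qed.

Lemma m_ge2 j : (2 <= m_ j)%N.
Proof.
case: j => // j; elim: j => // j IH; rewrite m_S//.
by apply: leq_trans (IH) _; rewrite -{1}[m_ j.+1]expn1 leq_exp2l ?(ltnW IH).
Qed.

Lemma m_sqr j : (0 < j)%N -> (m_ j ^ 2 <= m_ j.+1)%N.
Proof. by move=> j0; rewrite m_S// leq_exp2l ?m_ge2. Qed.

Lemma m_ltS j : (0 < j)%N -> (m_ j < m_ j.+1)%N.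
Proof.
move=> /m_sqr; apply: leq_trans.
by rewrite -[X in (X < _)%N]expn1 ltn_exp2l ?m_ge2.
Qed.

Lemma m_mono i j : (0 < i)%N -> (i <= j)%N -> (m_ i <= m_ j)%N.
Proof.
move=> i0; elim: j => [|j IH]; first by rewrite leqn0 => /eqP i00; rewrite i00 in i0.
rewrite leq_eqVlt => /orP[/eqP ->//|ij]; exact: leq_trans (IH ij) (ltnW (m_ltS (leq_trans i0 ij))).
Qed.

Lemma m_lt i j : (0 < i)%N -> (i < j)%N -> (m_ i < m_ j)%N.
Proof. by move=> i0 ij; apply: leq_trans (m_ltS i0) _; exact: m_mono. Qed.

Lemma m_ge_exp2 j : (0 < j)%N -> (2 ^ j <= m_ j)%N.
Proof.
case: j => // j _; elim: j => // j IH.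
apply: leq_trans (m_sqr _) => //; rewrite -(leq_exp2r _ _ (_ : 0 < 2)%N)// in IH.
by apply: leq_trans IH; rewrite -expnM leq_exp2l// ; lia.
Qed.

(** Both [2 ^ j] and [m_ (4 * i - 3)] are at most [m_ (4 * j - 4)], and [m_ (4 * j - 3)] is at least
    the square of the latter. The factor [2 ^ j] makes the estimates for exact functionals
    summable. *)
Lemma m_ratio i j : (0 < i)%N -> (i < j)%N ->
  (2 ^ j * m_ (4 * i - 3) ^ 2 <= m_ (4 * j - 3) ^ 2)%N.
Proof.
move=> i0 ij.
have -> : (4 * j - 3 = (4 * j - 4).+1)%N by lia.
have h1 : (m_ (4 * i - 3) <= m_ (4 * j - 4))%N by apply: m_mono; lia.
have h2 : (2 ^ (4 * j - 4) <= m_ (4 * j - 4))%N by apply: m_ge_exp2; lia.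
have h3 : (2 ^ j <= 2 ^ (4 * j - 4))%N by rewrite leq_exp2l//; lia.
have := @m_sqr (4 * j - 4) ltac:(lia).
set a := m_ (4 * i - 3) in h1 *; set b := m_ (4 * j - 4) in h1 h2 *.
set e := (2 ^ j)%N in h3 *; move=> h4.
have b1 : (1 <= b)%N by apply: leq_trans h2; rewrite expn_gt0.
apply: (@leq_trans ((b ^ 2) ^ 2)); last by rewrite leq_exp2r.
have -> : ((b ^ 2) ^ 2 = b * (b * b ^ 2))%N by rewrite -expnM !expnS expn0; lia.
rewrite leq_mul ?(leq_trans h3)//.
by apply: leq_trans (_ : b ^ 2 <= _)%N; rewrite ?leq_exp2r// leq_pmull.
Qed.

End weights.

(** * Values and supports of the functionals in [F_ j] *)

Section F_sets.
Variable R : realType.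
Implicit Types (f g x : c00 R) (s : seq (c00 R)).

(** The absolute value common to all nonzero coordinates of members of [F_ j]. *)
Definition F_value (j : nat) : R :=
  if j is 0 then 1 else ((m_ (4 * j - 3))%:R ^+ 2)^-1.

Lemma F_value_gt0 j : 0 < F_value j.
Proof.
case: j => // j; rewrite invr_gt0 exprn_gt0// ltr0n.
exact: ltnW (m_ge2 _).
Qed.

Lemma F_value_lt i j : (i < j)%N -> F_value j < F_value i.
Proof.
case: j => // j ij; have mj := m_ge2 (4 * j.+1 - 3).
case: i ij => [|i] ij; rewrite /F_value.
  rewrite invf_lt1 ?exprn_gt0 ?ltr0n ?(ltnW mj)// exprn_egt1// ?ltr1n//.
rewrite ltf_pV2 ?posrE ?exprn_gt0 ?ltr0n ?(ltnW (m_ge2 _))//.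
by rewrite ltrXn2r ?ler0n// ltr_nat m_lt//; lia.
Qed.

Lemma F_value_inj : injective F_value.
Proof.
move=> i j ij; apply/eqP; rewrite eqn_leq; apply/andP.
by split; rewrite leqNgt; apply/negP => /F_value_lt; rewrite ij ltxx.
Qed.

Lemma F_value_le i j : (i <= j)%N -> F_value j <= F_value i.
Proof. by rewrite leq_eqVlt => /orP[/eqP ->//|/F_value_lt/ltW]. Qed.

Lemma F_value_exp2 j : (0 < j)%N -> F_value j <= 2^-1 ^+ j.
Proof.
case: j => // j _; rewrite /F_value exprVn.
rewrite lef_pV2 ?posrE ?exprn_gt0 ?ltr0n ?(ltnW (m_ge2 _))//.
rewrite -!natrX ler_nat.
apply: (@leq_trans ((2 ^ (4 * j.+1 - 3)) ^ 2)); last by rewrite leq_exp2r// m_ge_exp2//; lia.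
by rewrite -expnM leq_exp2l//; lia.
Qed.

Lemma F_value_small (e : R) : 0 < e -> exists j, forall i, (j <= i)%N -> F_value i < e.
Proof.
move=> e0; have [n ne] := @ltr_add_invr R 0 e e0.
exists n.+1 => i ni; apply: le_lt_trans (F_value_le ni) _.
apply: le_lt_trans (F_value_exp2 _) _ => //.
rewrite add0r in ne; apply: le_lt_trans ne.
by rewrite exprVn lef_pV2 ?posrE ?exprn_gt0 ?ltr0n// -natrX ler_nat ltnW// ltn_expl.
Qed.

Lemma F_value_ratio i j : (0 < i)%N -> (i < j)%N ->
  (m_ (4 * i - 3))%:R ^+ 2 / (m_ (4 * j - 3))%:R ^+ 2 <= 2^-1 ^+ j :> R.
Proof.
move=> i0 ij.
rewrite ler_pdivrMr ?exprn_gt0 ?ltr0n ?(ltnW (m_ge2 _))//.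
rewrite exprVn ler_pdivlMl ?exprn_gt0//.
by rewrite -!natrX -natrM ler_nat m_ratio.
Qed.

Lemma F_shape j f : (0 < j)%N -> F_ j f -> exists2 I, schreier (n_ (4 * j - 3)) I &
  forall k, f k != 0 -> k \in I /\ `|f k| = F_value j.
Proof.
case: j => // j _ [[I SI [b ->]]|/= ->]; last first.
  exists fset0; last by move=> k; rewrite eqxx.
  rewrite /schreier; case: _.-1 => [|n] /=; first by [].
  by exists [::]; split => //; rewrite big_nil.
exists I => // k.
have -> : (((m_ (4 * j.+1 - 3))%:R ^+ 2)^-1 *:
     \sum_(i <- I) (-1) ^+ b i *: unit_vec i : c00 R) k =
     F_value j.+1 * (if (k \in I) && (0 < k)%N then (-1) ^+ b k else 0).
  have -> h : (((m_ (4 * j.+1 - 3))%:R ^+ 2)^-1 *: h : c00 R) k = F_value j.+1 * h k.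
    by [].
  congr (_ * _); rewrite c00_sumE.
  have E i : ((-1) ^+ b i *: unit_vec i : c00 R) k =
      if i == k then (-1) ^+ b k * (0 < k)%:R else 0.
    have -> : ((-1) ^+ b i *: unit_vec i : c00 R) k = (-1) ^+ b i * unit_vec_fun R i k.
      by [].
    rewrite /unit_vec_fun eq_sym; case: eqP => [->//|_]; by rewrite mulr0.
  under eq_bigr do rewrite E.
  have [kI|kI] := boolP (k \in I); last first.
    rewrite big_seq big1// => i iI; case: eqP => // ik.
    by rewrite -ik iI in kI.
  rewrite (big_fsetD1 k)//= eqxx big_seq big1 ?addr0.
    by case: (0 < k)%N; rewrite ?mulr1 ?mulr0.
  by move=> i; rewrite !inE => /andP[/negbTE ->].
case: ifP => [/andP[kI _] _|_]; last by rewrite mulr0 eqxx.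
split => //; rewrite normrM normrX normrN1 expr1n mulr1 ger0_norm// ltW//.
exact: F_value_gt0.
Qed.

Lemma F_val j f k : F_ j f -> f k != 0 -> `|f k| = F_value j.
Proof.
have [->|j0] := posnP j; last by move=> /(F_shape j0)[I _ fI] /fI[].
move=> [b [n n0 ->]].
have -> : ((-1) ^+ b *: unit_vec n : c00 R) k = (-1) ^+ b * unit_vec_fun R n k by [].
rewrite sign_norm mulf_eq0 negb_or => /andP[_].
by rewrite /unit_vec_fun; case: (_ && _); rewrite ?eqxx// normr1.
Qed.

(** One nonzero coordinate already reveals the index, by injectivity of [F_value]. *)
Lemma F_uniq i j f : f <> 0 -> F_ i f -> F_ j f -> i = j.
Proof.
move=> /c00_neq0[k fk] Fi Fj; apply: F_value_inj.
by rewrite -(F_val Fi fk) (F_val Fj fk).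
Qed.

Lemma F_misses j (t : nat -> nat) : (forall k, (t k < t k.+1)%N) ->
  exists M, forall f, F_ j f ->
    exists2 k, (k < M)%N & forall l, f l != 0 -> ~~ (t k <= l < t k.+1)%N.
Proof.
move=> ht; have [->|j0] := posnP j; last first.
  have [M hM] := schreier_misses (n_ (4 * j - 3)) ht.
  exists M => f /(F_shape j0)[I /hM[k kM kI] fI].
  by exists k => // l /fI[/kI].
exists 2 => f [b [n n0 ->]].
have E k : ((-1) ^+ b *: unit_vec n : c00 R) k != 0 -> k = n.
  have -> : ((-1) ^+ b *: unit_vec n : c00 R) k = (-1) ^+ b * unit_vec_fun R n k by [].
  rewrite mulf_eq0 negb_or => /andP[_].
  by rewrite /unit_vec_fun; case: (k =P n) => //= _; rewrite eqxx.
have [h|h] := boolP (t 0 <= n < t 1)%N; [exists 1%N|exists 0%N] => // l /E ->//.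
by apply/negP => h'; have := slot_inj ht h' h (leqnn n).
Qed.

End F_sets.

(** * Finite special sequences and their indices *)

Section special_sequences.
Variables (R : realType) (c : codings R).
Implicit Types (f g x : c00 R) (s : seq (c00 R)).

Lemma sigmaF_gt0 s : sigmaF_domain s -> (0 < sigmaF c s)%N.
Proof. by move=> /(sigmaF_Xi2 c) sX; apply: (Xi_gt0 (c := c)); right. Qed.

Lemma domain_take s n : sigmaF_domain s -> (0 < n)%N -> sigmaF_domain (take n s).
Proof.
move=> [bs sF] n0; split; first exact: block_take.
by move=> f /mem_take; exact: sF.
Qed.

Lemma F_special_take s n : F_special c s -> (0 < n)%N -> F_special c (take n s).
Proof.
move=> [ds s0 sF] n0; split; first exact: domain_take.
  by rewrite nth_take.
move=> i; rewrite size_take_min leq_min => /andP[h1 h2].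
rewrite nth_take// take_takel; last exact: ltnW h1.
exact: sF.
Qed.

Lemma ind_take s n i : (i < n)%N -> ind c (take n s) i = ind c s i.
Proof.
case: i => [|i] i_n /=; first by rewrite nth_take.
by rewrite take_takel// ltnW.
Qed.

Lemma natmin_mem (A : set nat) : A !=set0 -> A (natmin A).
Proof.
move=> [n An]; rewrite /natmin; case: xgetP => [n0 _ []//|none].
pose P k := `[< A k >].
have exP : exists k, P k by exists n; apply/asboolP.
by have [m /asboolP Am mmin] := ex_minnP exP; case: (none m); split => // k Ak; apply: mmin; apply/asboolP.
Qed.

Lemma natmin_le (A : set nat) k : A k -> (natmin A <= k)%N.
Proof.
move=> Ak; rewrite /natmin; case: xgetP => [n0 _ [_]|none]; first exact.
pose P k := `[< A k >].
have exP : exists k, P k by exists k; apply/asboolP.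
by have [m /asboolP Am mmin] := ex_minnP exP; case: (none m); split => // l Al; apply: mmin; apply/asboolP.
Qed.

Lemma F_special_ind s i : F_special c s -> (i < size s)%N ->
  F_ (ind c s i) s`_i.
Proof.
move=> [_ [l _ s0] sF]; case: i => [|i] si; last exact: sF.
by apply: (@natmin_mem [set j | F_ j s`_0]); exists l.
Qed.

Lemma F_special_ind_gt0 s i : F_special c s -> (i < size s)%N ->
  (0 < ind c s i)%N.
Proof.
move=> sp si; have [ds [l Xl s0] _] := sp.
case: i si => [|i] si.
  rewrite (@F_uniq _ (ind c s 0) l s`_0 _ (F_special_ind sp si))//.
    by apply: (Xi_gt0 (c := c)); left.
  by have [[_ + _] _] := ds; apply; exact: mem_nth.
by apply: sigmaF_gt0; exact: domain_take.
Qed.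

(** As [Xi1] and [Xi2] are disjoint, an index tells first blocks from later ones. *)
Lemma F_special_ind0 s : F_special c s -> Xi1 c (ind c s 0).
Proof.
move=> sp; have [[[s0 sn _] _] [l Xl sl] _] := sp.
have s1 : (0 < size s)%N by case: (s) s0.
rewrite (@F_uniq _ (ind c s 0) l s`_0)//; last exact: F_special_ind.
by apply: sn; exact: mem_nth.
Qed.

End special_sequences.

(** * Stages of the norming set *)

Section stages.
Variables (R : realType) (c : codings R).
Implicit Types (f g x : c00 R) (A : set (c00 R)).

Lemma K_S n w : K_ c n.+1 w = K_step c (K_ c n) (D_ c n) w.
Proof. by rewrite /K_ /D_ /=; case: (stage c n). Qed.

Lemma D_S n : D_ c n.+1 = convQ
  ((\bigcup_w K_ c n.+1 w) `|` G_step c (D_ c n) n.+1 `|` D_ c n).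
Proof. by rewrite /K_ /D_ /=; case: (stage c n). Qed.

Lemma sub_convQ A : A `<=` convQ A.
Proof.
move=> f Af; exists [:: (1, f)]; split.
- by move=> p; rewrite inE => /eqP ->.
- by rewrite big_seq1.
- by rewrite big_seq1 /= rmorph1 scale1r.
Qed.

Lemma D_mono n m : (n <= m)%N -> D_ c n `<=` D_ c m.
Proof.
elim: m => [|m IH]; first by rewrite leqn0 => /eqP ->.
rewrite leq_eqVlt => /orP[/eqP ->//|/IH nm] f /nm Df.
by rewrite D_S; apply: sub_convQ; right.
Qed.

Lemma K_norming n w f : K_ c n w f -> norming_set c f.
Proof.
case: n => [|n] Kf.
  exists 0%N => //; apply: sub_convQ; move: Kf; rewrite /K_ /=.
  by case: w.
by exists n.+1 => //; rewrite D_S; apply: sub_convQ; left; left; exists w.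
Qed.

Lemma G_norming n f : G_step c (D_ c n) n.+1 f -> norming_set c f.
Proof. by move=> Gf; exists n.+1 => //; rewrite D_S; apply: sub_convQ; left; right. Qed.

Lemma convQ_le A x (M : R) : (forall f, A f -> act f x <= M) ->
  forall f, convQ A f -> act f x <= M.
Proof.
move=> AM _ [s [sA s1 ->]]; rewrite act_c00_sum.
have -> : M = \sum_(p <- s) ratr p.1 * M.
  by rewrite -mulr_suml -rmorph_sum s1 rmorph1 mul1r.
rewrite !big_seq; apply: ler_sum => p /sA[p0 Ap].
by rewrite act_c00Z ler_wpM2l ?ler0q// AM.
Qed.

(** Every [D_] arises from these generators by convex combinations, which preserve upper bounds. *)
Lemma norming_le x (M : R) :
  (forall n w f, K_ c n w f -> act f x <= M) ->
  (forall n f, G_step c (D_ c n) n.+1 f -> act f x <= M) ->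
  forall f, norming_set c f -> act f x <= M.
Proof.
move=> KM GM f [n _]; elim: n f => [|n IH].
  by apply: convQ_le => f Ff; apply: (KM 0%N 0%N).
rewrite D_S; apply: convQ_le => f [[[w _]|]|]; [exact: KM|exact: GM|exact: IH].
Qed.

(** The norm induced by [D] is at most the one induced by [D'], so the same witness works. *)
Lemma exact_sub (D D' : set (c00 R)) j f : D `<=` D' ->
  exact_functional D' j f -> exact_functional D j f.
Proof.
move=> DD' [Fj [x [xD xr fx xF]]]; split => //; exists x; split => //.
apply: le_trans xD; apply: ereal_sup_le => _ [g Dg <-].
by exists g => //; exact: DD'.
Qed.

End stages.

(** * Infinite special sequences as functionals *)

Section branches.
Variables (R : realType) (c : codings R) (phi : nat -> c00 R).
Hypothesis phi_sp : F_special_infinite c phi.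
Implicit Types (x : c00 R).

Lemma branch_supp q : supp (phi q) !=set0.
Proof. by have [h _ _ _] := phi_sp; apply: c00_neq0; have [] := h q. Qed.

Lemma branch_before p q : (p < q)%N -> before (supp (phi p)) (supp (phi q)).
Proof.
move=> pq; have [_ h _ _] := phi_sp.
by apply: (@before_chain (fun i => supp (phi i)) q.+1) => // i _; exact: branch_supp.
Qed.

Lemma branch_index_eq p q k : supp (phi p) k -> supp (phi q) k -> p = q.
Proof.
move=> pk qk; apply/eqP; rewrite eqn_leq; apply/andP.
split; rewrite leqNgt; apply/negP => /branch_before.
  by move=> /(_ _ _ qk pk); rewrite ltnn.
by move=> /(_ _ _ pk qk); rewrite ltnn.
Qed.

Lemma branch_index_lt q k : supp (phi q) k -> (q < k)%N.
Proof.
elim: q k => [|q IH] k qk.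
  case: k qk => // k0; suff : False by [].
  by move: k0; rewrite /supp /= c00_at0 eqxx.
have [l ql] := branch_supp q.
by apply: leq_ltn_trans (IH l ql) _; exact: (branch_before (ltnSn q)) qk.
Qed.

(** The sum of all blocks: [phi q] is supported beyond [q], so the blocks before [k] suffice at
    coordinate [k]. *)
Definition branch k : R := \sum_(q < k) phi q k.

Lemma branch_at q k : supp (phi q) k -> branch k = phi q k.
Proof.
move=> qk; rewrite /branch (bigD1 (Ordinal (branch_index_lt qk)))//= big1 ?addr0//.
move=> p pq; apply/eqP; apply: contraNT pq => pk.
by apply/eqP/val_inj/(branch_index_eq pk qk).
Qed.

Lemma branch_neq0 k : branch k != 0 -> exists2 q, (q < k)%N & supp (phi q) k.
Proof.
move=> h; apply: contrapT => nq; move/eqP: h; apply; rewrite /branch big1// => q _.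
by apply: contrapT => /eqP qk; apply: nq; exists q.
Qed.

Lemma branch_sum d k : (k <= d)%N -> (\sum_(q < d) phi q) k = branch k.
Proof.
move=> kd; rewrite c00_sumE /branch !(big_ord_widen _ (fun q => phi q k) kd).
rewrite [RHS]big_mkcond /=; apply: eq_bigr => q _; case: ifP => // /negbT qk.
apply: contrapT => /eqP /branch_index_lt; by rewrite (negbTE qk).
Qed.

Lemma branch_sum_at d q k : (q < d)%N -> supp (phi q) k ->
  (\sum_(p < d) phi p) k = phi q k.
Proof.
move=> qd qk; rewrite c00_sumE (bigD1 (Ordinal qd))//= big1 ?addr0//.
move=> p pq; apply/eqP; apply: contraNT pq => pk.
by apply/eqP/val_inj/(branch_index_eq pk qk).
Qed.

Lemma take_mkseq (T : Type) (u : nat -> T) p d :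
  (p <= d)%N -> take p (mkseq u d) = mkseq u p.
Proof. by move=> pd; rewrite /mkseq -map_take take_iota (minn_idPl pd). Qed.

Lemma branch_block d : (0 < d)%N -> block (mkseq phi d).
Proof.
move=> d0; split.
- by case: d d0.
- move=> f /mapP[q _ ->]; by have [h _ _ _] := phi_sp; have [] := h q.
- move=> q; rewrite size_mkseq => qd.
  by rewrite !nth_mkseq// 1?ltnW//; exact: branch_before.
Qed.

Lemma branch_domain d : (0 < d)%N -> sigmaF_domain (mkseq phi d).
Proof.
move=> d0; split; first exact: branch_block.
by move=> f /mapP[q _ ->]; have [h _ _ _] := phi_sp; have [] := h q.
Qed.

Lemma branch_special d : (0 < d)%N -> F_special c (mkseq phi d).
Proof.
move=> d0; have [_ _ [l Xl l0] h] := phi_sp; split; first exact: branch_domain.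
  by exists l => //; rewrite nth_mkseq.
move=> q; rewrite size_mkseq => qd.
by rewrite nth_mkseq// take_mkseq 1?ltnW//; exact: h.
Qed.

(** The index of a block depends only on the prefix up to it, so any longer prefix gives the same
    value. *)
Definition branch_ind q := ind c (mkseq phi q.+1) q.

Lemma ind_mkseq d q : (q < d)%N -> ind c (mkseq phi d) q = branch_ind q.
Proof.
by move=> qd; rewrite /branch_ind -(ind_take c (mkseq phi d) (ltnSn q)) take_mkseq.
Qed.

Lemma branch_indS q : branch_ind q.+1 = sigmaF c (mkseq phi q.+1).
Proof. by congr sigmaF; exact: take_mkseq. Qed.

Lemma branch_F q : F_ (branch_ind q) (phi q).
Proof.
have := @F_special_ind _ c (mkseq phi q.+1) q (branch_special (ltn0Sn q)).
by rewrite size_mkseq nth_mkseq// => /(_ (ltnSn q)).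
Qed.

Lemma branch_ind_ltS q : (branch_ind q < branch_ind q.+1)%N.
Proof.
rewrite branch_indS; apply: (sigmaF_gt c (branch_domain (ltn0Sn q)) _ (branch_F q)).
by apply/mapP; exists q => //; rewrite mem_iota add0n ltnSn.
Qed.

Lemma branch_ind_ge q : (q < branch_ind q)%N.
Proof.
elim: q => [|q IH]; last exact: leq_trans (branch_ind_ltS q).
by apply: (F_special_ind_gt0 (branch_special (ltn0Sn 0))); rewrite size_mkseq.
Qed.

End branches.

(** * Survivors and the coding *)

Section survivors.
Variables (R : realType) (c : codings R).
Implicit Types (phi psi : nat -> c00 R) (x : c00 R).

(** Beyond the first block an index is the code of the preceding blocks, and the coding is
    injective. *)
Lemma branch_ind_inj phi psi p q : F_special_infinite c phi ->
  F_special_infinite c psi -> (0 < p)%N -> (0 < q)%N ->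
  branch_ind c phi p = branch_ind c psi q ->
  p = q /\ forall r, (r < p)%N -> phi r = psi r.
Proof.
move=> hp hq; case: p => // p _; case: q => // q _; rewrite !branch_indS => h.
have {}h := sigmaF_inj (branch_domain hp (ltn0Sn p)) (branch_domain hq (ltn0Sn q)) h.
have pq : p = q by have := congr1 size h; rewrite !size_mkseq => -[].
split; first by rewrite pq.
by move=> r rp; have := congr1 (nth 0 ^~ r) h; rewrite !nth_mkseq -?pq.
Qed.

(* Distinct blocks of a special sequence have distinct absolute values, so a
   representation of a partial sum in [tau] shows all blocks but the last. *)
Lemma special_sum_inj phi s (b : bool) (E : interval nat) d :
  F_special_infinite c phi -> F_special c s -> (0 < d)%N ->
  \sum_(q < d.+1) phi q = (-1) ^+ b *: restrict E (\sum_(f <- s) f) ->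
  take d s = mkseq phi d /\ (d < size s)%N.
Proof.
move=> hp sp d0 sumE; have [[bs _] _ _] := sp.
have [k dk] := branch_supp hp d.
have at_d := branch_sum_at hp (ltnSn d) dk.
have {}sumE : phi d k = (-1) ^+ b * restrict E (\sum_(f <- s) f) k.
  by rewrite -at_d sumE.
have [kE] : k \in E /\ supp (\sum_(f <- s) f) k.
  apply: restrict_supp; apply/negP => /eqP r0; move/negP: dk; apply.
  by rewrite sumE r0 mulr0.
move=> /block_sum_supp[i si ik].
rewrite restrict_in// (block_sum_at bs si ik) in sumE.
have iE : ind c s i = branch_ind c phi d.
  apply: (@F_value_inj R).
  rewrite -(F_val (F_special_ind sp si) ik) -(F_val (branch_F hp d) dk) sumE.
  by rewrite sign_norm.
have {dk at_d sumE kE} [d' dE] : exists d', d = d'.+1 by exists d.-1; rewrite prednK.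
have X2 : Xi2 c (branch_ind c phi d).
  by rewrite dE branch_indS; apply: sigmaF_Xi2; exact: (branch_domain hp).
have [i0|i0] := posnP i.
  have := F_special_ind0 sp; rewrite -{1}i0 iE => X1.
  by have : (Xi1 c `&` Xi2 c) (branch_ind c phi d) by []; rewrite Xi_disjoint.
move: iE; have -> : ind c s i = sigmaF c (take i s) by case: (i) i0.
rewrite dE branch_indS -dE => /(sigmaF_inj _ _) ti.
have {}ti : take i s = mkseq phi d.
  apply: ti; last exact: (branch_domain hp).
  by have [ds _ _] := sp; exact: domain_take.
have id : i = d by have := congr1 size ti; rewrite size_mkseq size_takel// ltnW.
by rewrite -{1}id ti -id.
Qed.

(** Long partial sums enter [tau] only at late stages, because [tau_rep] bounds the length of the
    sequence by the stage. Exactness there descends to earlier stages. *)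
Lemma survivor_exact phi n q : survivors c phi ->
  exact_functional (D_ c n) (branch_ind c phi q) (phi q).
Proof.
(* The partial sum runs one block past position [maxn n q], since its representation is known to
   reveal all blocks except the last. *)
move=> [hp ht]; have [[|n'] _] := ht (maxn n q).+2 (ltn0Sn _); first by [].
move=> [I [s [b [E [sp sn sex sumE _]]]]].
have [td ds] := special_sum_inj hp sp (ltn0Sn (maxn n q)) sumE.
have qd : (q < (maxn n q).+1)%N by rewrite ltnS leq_maxr.
have qs : (q < size s)%N by apply: leq_trans qd (ltnW ds).
have := sex q qs; rewrite -(ind_take c s qd) td ind_mkseq//.
have -> : s`_q = phi q by rewrite -(nth_take 0 qd) td nth_mkseq.
apply: exact_sub; apply: D_mono.
have := leq_trans ds sn; rewrite ltnS; apply: leq_trans.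
by apply: leq_trans (leqnSn _); exact: leq_maxl.
Qed.

Lemma survivor_tau phi n d (E : interval nat) : survivors c phi ->
  (0 < d <= n.+1)%N ->
  tau_rep c (D_ c n) n.+1 (restrict E (\sum_(q < d) phi q))
    [set branch_ind c phi q | q in [set q | (q < d)%N /\
       exists2 k, k \in E & ran (phi q) k]].
Proof.
move=> sphi /andP[d0 dn]; have hp := sphi.1.
exists (mkseq phi d), false, E; split.
- exact: (branch_special hp).
- by rewrite size_mkseq.
- move=> q; rewrite size_mkseq => qd; rewrite ind_mkseq// nth_mkseq//.
  exact: survivor_exact.
- rewrite expr0 scale1r; congr restrict.
  by rewrite big_map -[in RHS](subn0 d) big_mkord.
- apply/seteqP; split=> _ [q [qd [k kE qk]] <-] /=.
    exists q; last by rewrite ind_mkseq.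
    by split; [rewrite size_mkseq|exists k => //; rewrite nth_mkseq].
  move: qd qk; rewrite size_mkseq => qd; rewrite nth_mkseq// => qk.
  by exists q; [split => //; exists k|rewrite ind_mkseq].
Qed.

Lemma mem_tail (N k : nat) : (k \in `[N.+1, +oo[ : bool) = (N < k)%N.
Proof. by rewrite in_itv /= andbT. Qed.

Definition tail (N : nat) (a : nat -> R) (k : nat) : R :=
  if (N < k)%N then a k else 0.

End survivors.

(** * The norm and the tails of branches *)

Section norm.
Variables (R : realType) (c : codings R) (X : completeNormedModType R).
Variables (i : {linear c00 R -> X}) (hX : is_completion (X_norm c) i).
Implicit Types (phi psi : nat -> c00 R) (x y f : c00 R).

Definition cnorm x : R := `|i x|.

Lemma cnormB x y : cnorm (x - y) <= cnorm x + cnorm y.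
Proof. by rewrite /cnorm linearB /= ler_normB. Qed.

Lemma cnormD x y : cnorm (x + y) <= cnorm x + cnorm y.
Proof. by rewrite /cnorm linearD /= ler_normD. Qed.

Lemma cnormZ (a : R) x : cnorm (a *: x) = `|a| * cnorm x.
Proof. by rewrite /cnorm linearZ /= normrZ. Qed.

Lemma cnorm_ge0 x : 0 <= cnorm x. Proof. exact: normr_ge0. Qed.

(** The norm is a supremum without absolute values; evaluating at [- x] gives the other sign. *)
Lemma norming_abs_le f x : norming_set c f -> `|act f x| <= cnorm x.
Proof.
have le y : norming_set c f -> act f y <= cnorm y.
  by move=> nf; rewrite -lee_fin /cnorm hX.1; apply: ereal_sup_ubound; exists f.
move=> nf; rewrite ler_norml le// andbT.
have := le (- x) nf; rewrite /cnorm linearN normrN -scaleN1r (lfunZ _ _ (@act_lfun _ f)).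
by rewrite mulN1r lerNl.
Qed.

Lemma cnorm_le x (M : R) :
  (forall n w f, K_ c n w f -> act f x <= M) ->
  (forall n f, G_step c (D_ c n) n.+1 f -> act f x <= M) -> cnorm x <= M.
Proof.
move=> KM GM; rewrite -lee_fin /cnorm hX.1; apply: ge_ereal_sup => _ [f nf <-].
by rewrite lee_fin; exact: (norming_le KM GM nf).
Qed.

(** Beyond the place where distinct survivors separate, injectivity of the coding makes their
    indices different. Signed sums of sufficiently late tails, cut to the support of [x], therefore
    lie in some [G_step]. *)
Lemma survivors_sum_le (B : seq (nat -> c00 R)) : uniq B ->
  (forall phi, phi \in B -> survivors c phi) ->
  exists N0, forall N, (N0 <= N)%N -> forall x,
    \sum_(phi <- B) `|act (tail N (branch phi)) x| <= cnorm x.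
Proof.
move=> uB sB.
have /choice[r hr] : forall pq : (nat -> c00 R) * (nat -> c00 R),
    exists r, pq.1 <> pq.2 -> pq.1 r <> pq.2 r.
  move=> [p q] /=; have [->|pq] := pselect (p = q); first by exists 0%N.
  apply: contrapT => nr; apply: pq; apply/funext => k; apply: contrapT => pk.
  by apply: nr; exists k.
have /choice[M hM] := @c00_bound R.
(* Any two distinct members of [B] differ at some position up to [p]. Tails beyond [N0] start after
   [size B] and meet only blocks at positions after [p.+1]. *)
pose p := \max_(phi <- B) \max_(psi <- B) r (phi, psi).
pose N0 := (size B + \max_(phi <- B) \max_(q < p.+2) M (phi q))%N.
exists N0 => N N0N x; have [L hL] := c00_bound x.
pose E : interval nat := `[N.+1, +oo[.
pose S phi := restrict E (\sum_(q < L.+1) phi q).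
have actS phi : phi \in B -> act (tail N (branch phi)) x = act (S phi) x.
  move=> /sB[hp _]; apply: eq_act => k xk.
  have kL : (k < L)%N by rewrite ltnNge; apply: contraNN xk => /hL ->.
  rewrite /tail /S /= /restrict_fun mem_tail.
  by case: ifP => // _; rewrite (branch_sum hp)// leqW// ltnW.
have late phi q : phi \in B -> (exists2 k, k \in E & ran (phi q) k) -> (p.+1 < q)%N.
  move=> pB [k kE [_ [l [_ ql /andP[_ kl]]]]]; rewrite ltnNge; apply/negP => qp.
  have Nl : (N < l)%N.
    by apply: leq_trans kl; rewrite -mem_tail.
  move/negP: ql; apply; rewrite hM//; apply: leq_trans (ltnW Nl).
  apply: leq_trans N0N; apply: leq_trans (leq_addl _ _).
  apply: leq_trans (leq_bigmax_seq _ pB isT).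
  exact: (@leq_bigmax _ (fun q : 'I_p.+2 => M (phi q)) (Ordinal (qp : (q < p.+2)%N))).
rewrite (big_nth (fun=> 0)) big_mkord.
(* These signs turn the sum of absolute values into the action of one functional. *)
pose b (j : 'I_(size B)) := act (S (nth (fun=> 0) B j)) x < 0.
have -> : \sum_(j < size B) `|act (tail N (branch (nth (fun=> 0) B j))) x| =
    act (\sum_(j < size B) (-1) ^+ b j *: S (nth (fun=> 0) B j)) x.
  rewrite act_c00_sum; apply: eq_bigr => j _; rewrite actS ?mem_nth// act_c00Z /b.
  by case: ltP => h; [rewrite ltr0_norm// expr1 mulN1r|rewrite ger0_norm// expr0 mul1r].
apply: le_trans (ler_norm _) _; apply: norming_abs_le; apply: (@G_norming _ c L).
exists (size B), (fun j => S (nth (fun=> 0) B j)),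
  (fun j : 'I_(size B) => [set branch_ind c (nth (fun=> 0) B j) q | q in
    [set q | (q < L.+1)%N /\ exists2 k, k \in E & ran (nth (fun=> 0) B j q) k]]), b.
split => //.
- move=> j; apply: survivor_tau; last by rewrite ltnS leqnn.
  by apply: sB; exact: mem_nth.
- move=> j k /restrict_supp[]; rewrite mem_tail => Nk _.
  by apply: leq_trans (ltnW Nk); apply: leq_trans N0N; exact: leq_addr.
- move=> j j' _ _ [_ [[q [_ ql] <-] [q' [_ ql'] eqi]]].
  have jB : nth (fun=> 0) B j \in B by exact: mem_nth.
  have jB' : nth (fun=> 0) B j' \in B by exact: mem_nth.
  have [||qq' hqq'] := branch_ind_inj (sB _ jB).1 (sB _ jB').1 _ _ (esym eqi).
  + exact: leq_ltn_trans (late _ _ jB ql).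
  + exact: leq_ltn_trans (late _ _ jB' ql').
  apply/val_inj/eqP; rewrite -(nth_uniq (fun=> 0) (ltn_ord j) (ltn_ord j') uB); apply/eqP.
  apply: contrapT => /(hr (_, _)); apply; apply: hqq' => /=.
  apply: leq_ltn_trans (ltnW (late _ _ jB ql)).
  apply: leq_trans (leq_bigmax_seq _ jB isT).
  exact: leq_trans (leq_bigmax_seq _ jB' isT).
Qed.

End norm.

(** * Limits of norming functionals *)

Section tau_limits.
Variables (R : realType) (c : codings R).
Implicit Types (phi psi : nat -> c00 R) (x f : c00 R) (s : seq (c00 R)).

Lemma block_index_lt s q k : block s -> (q < size s)%N -> supp s`_q k -> (q < k)%N.
Proof.
move=> bs; elim: q k => [|q IH] k qs qk.
  case: k qk => // k0; suff : False by [].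
  by move: k0; rewrite /supp /= c00_at0 eqxx.
have [l ql] := block_supp bs (ltnW qs).
have [_ _ sb] := bs.
by apply: leq_ltn_trans (IH l (ltnW qs) ql) _; exact: sb ql qk.
Qed.

Lemma block_sum_take s d k : block s -> (k <= d)%N ->
  (\sum_(f <- s) f) k = (\sum_(f <- take d s) f) k.
Proof.
move=> bs kd; rewrite -{1}(cat_take_drop d s) !c00_sumE big_cat /=.
rewrite [X in _ + X](_ : _ = 0) ?addr0// (big_nth 0) big_mkord big1// => q _.
rewrite nth_drop; apply: contrapT => /eqP qk.
have qs : (d + q < size s)%N.
  by have := ltn_ord q; rewrite [X in (_ < X)%N]size_drop ltn_subRL.
have := block_index_lt bs qs qk; rewrite ltnNge; apply/negP; rewrite negbK.
by apply: leq_trans kd (leq_addr _ _).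
Qed.

Lemma restrictT f : restrict `]-oo, +oo[ f = f.
Proof. by apply/val_inj/funext => k; rewrite /= /restrict_fun in_itv. Qed.

(** Injectivity leaves at most one sequence for each code below [J]. *)
Lemma sigmaF_finite J : exists L : seq (seq (c00 R)),
  forall s, sigmaF_domain s -> (sigmaF c s < J)%N -> s \in L.
Proof.
have /choice[T hT] : forall v, exists s', forall s, sigmaF_domain s -> sigmaF c s = v -> s = s'.
  move=> v; have [[s [ds sv]]|ns] := pselect (exists s, sigmaF_domain s /\ sigmaF c s = v).
    by exists s => s' ds' s'v; apply: (@sigmaF_inj _ c _ _ ds' ds); rewrite s'v sv.
  by exists [::] => s ds sv; case: ns; exists s.
exists (mkseq T J) => s ds sJ; apply/mapP; exists (sigmaF c s).
  by rewrite mem_iota.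
exact: hT.
Qed.

Lemma tau_norming f : tau c f -> norming_set c f.
Proof.
move=> [[|n] _] // [I fI]; apply: (@G_norming _ c n).
exists 1%N, (fun=> f), (fun=> I), (fun=> false); split => //.
- by move=> _ [|k] //; rewrite /supp /= c00_at0 eqxx.
- by move=> [[|//] ?] [[|//] ?] _ _ _; apply/val_inj.
- by rewrite big_ord1 expr0 scale1r.
Qed.

Lemma tauN f : tau c f -> tau c (- f).
Proof.
move=> [[|n] n0] // [I [s [b [E [h1 h2 h3 -> h5]]]]].
exists n.+1 => //; exists I, s, (~~ b), E; split => //.
by case: b; rewrite /= ?expr0 ?expr1 ?scale1r ?scaleN1r ?opprK.
Qed.

Section limit.
Variables (y : nat -> c00 R) (t : nat -> nat) (P : nat -> c00 R) (e : R).
Hypothesis t_incr : forall n, (t n < t n.+1)%N.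
Hypothesis y_slot : forall n k, y n k != 0 -> (t n <= k < t n.+1)%N.
Hypothesis P_tau : forall N, tau c (P N).
Hypothesis e0 : 0 < e.
Hypothesis P_large : forall N n, (n <= N)%N -> e <= `|act (P N) (y n)|.

Lemma slot_lt n n' k k' : (n < n')%N -> y n k != 0 -> y n' k' != 0 -> (k < k')%N.
Proof.
move=> nn' /y_slot/andP[_ kt] /y_slot/andP[tk _].
by apply: leq_trans kt (leq_trans _ tk); exact: incr_homo.
Qed.

(* [e <= `|act (P N) (y n)|] forces a block of bounded index of the special
   sequence behind [P N] to meet the [n]-th slot. If it is not the first block,
   its index codes all previous blocks, which therefore range over a finite set
   and stabilise along an ultrafilter. *)
Lemma tau_limit : exists2 phi, survivors c phi &
  forall n, (0 < n)%N -> e <= `|act (branch phi) (y n)|.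
Proof.
have /choice[w hw] : forall N, exists w : nat * seq (c00 R) * bool * interval nat,
    [/\ F_special c w.1.1.2, (size w.1.1.2 <= w.1.1.1.+1)%N,
      forall q, (q < size w.1.1.2)%N ->
        exact_functional (D_ c w.1.1.1) (ind c w.1.1.2 q) w.1.1.2`_q
    & P N = (-1) ^+ w.1.2 *: restrict w.2 (\sum_(f <- w.1.1.2) f)].
  move=> N; have [[|n] _] // := P_tau N.
  by move=> [I [s [b [E [h1 h2 h3 h4 _]]]]]; exists (n, s, b, E).
pose st N := (w N).1.1.1; pose s N := (w N).1.1.2; pose b N := (w N).1.2.
pose E N := (w N).2.
have sp N : F_special c (s N) by have [] := hw N.
have bs N : block (s N) by have [[]] := sp N.
have PE N : P N = (-1) ^+ b N *: restrict (E N) (\sum_(f <- s N) f).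
  by have [] := hw N.
have PNE N k : P N k = (-1) ^+ b N * restrict (E N) (\sum_(f <- s N) f) k.
  by rewrite PE.
have meet N n : (n <= N)%N -> exists2 k, y n k != 0 & k \in E N.
  move=> nN; have /act_neq0[k yk] : act (P N) (y n) != 0.
    by rewrite -normr_gt0; exact: lt_le_trans (P_large nN).
  rewrite PNE mulf_eq0 negb_or => /andP[_ rk]; exists k => //.
  by have [] := restrict_supp rk.
(* The interval [E N] meets the slots before and after the [n]-th one, hence contains the support of
   [y n] by convexity. *)
have full N n : (0 < n < N)%N ->
    act (P N) (y n) = (-1) ^+ b N * act (\sum_(f <- s N) f) (y n).
  move=> /andP[n0 nN]; rewrite -actZl; apply: eq_act => k yk; rewrite PNE.
  congr (_ * _); apply: restrict_in.
  have n1N : (n.-1 <= N)%N by rewrite (leq_trans (leq_pred _)) ?(ltnW nN).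
  have [k1 y1 E1] := meet N n.-1 n1N.
  have [k2 y2 E2] := meet N n.+1 nN.
  apply: itv_nat_convex E1 E2 _; apply/andP; split.
    by apply: ltnW; apply: slot_lt y1 yk; rewrite prednK.
  by apply: ltnW; apply: slot_lt yk y2.
(* Blocks of large index have coordinates below [e / (2 * B)], too small to produce the value [e] on
   [y n]. *)
have /choice[J hJ] : forall n, exists J, forall N, (n <= N)%N ->
    exists q, [/\ (q < size (s N))%N, (ind c (s N) q < J)%N
      & exists2 k, y n k != 0 & (s N)`_q k != 0].
  move=> n; have [B B0 hB] := act_bound (y n).
  have eB : 0 < e / (2 * B) by rewrite divr_gt0// mulr_gt0.
  have [J hJ] := F_value_small eB.
  exists J => N nN; apply: contrapT => nq.
  have : `|act (P N) (y n)| <= e / (2 * B) * B.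
    apply: hB => [|k yk]; first exact: ltW.
    have [->|Pk] := eqVneq (P N k) 0; first by rewrite normr0 ltW.
    move: Pk; rewrite PNE sign_norm mulf_eq0 negb_or => /andP[_ rk].
    have [kE /block_sum_supp[q qs qk]] := restrict_supp rk.
    rewrite restrict_in// (block_sum_at (bs N) qs qk).
    rewrite (F_val (F_special_ind (sp N) qs) qk) ltW// hJ// leqNgt.
    by apply/negP => qJ; apply: nq; exists q; split => //; exists k.
  apply/negP; rewrite -ltNge; apply: lt_le_trans (P_large nN).
  by rewrite invfM mulrA divfK ?gt_eqF// ltr_pdivrMr// ltr_pMr// ltr1n.
have /choice[ix hix] : forall Nn : nat * nat, exists q, (Nn.2 <= Nn.1)%N ->
    [/\ (q < size (s Nn.1))%N, (ind c (s Nn.1) q < J Nn.2)%N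
      & exists2 k, y Nn.2 k != 0 & (s Nn.1)`_q k != 0].
  move=> [N n] /=; have [/hJ[q hq]|] := boolP (n <= N)%N; first by exists q.
  by exists 0%N.
have ix_mono N n n' : (n <= n')%N -> (n' <= N)%N -> (ix (N, n) <= ix (N, n'))%N.
  rewrite leq_eqVlt => /orP[/eqP ->//|nn'] n'N.
  have [/= h1 _ [k yk sk]] := hix (N, n) (ltnW (leq_trans nn' n'N)).
  have [/= h2 _ [k' yk' sk']] := hix (N, n') n'N.
  apply: (block_index (bs N) h1 h2 sk sk').
  by apply: ltnW; apply: slot_lt nn' yk yk'.
(* If the position [ix] stayed constant for too long, a single block of index below [J n] would meet
   a long run of slots starting at [n], against [F_misses]. *)
have /choice[nx hnx] : forall n, exists n', (n < n')%N /\
    forall N, (n' <= N)%N -> (ix (N, n) < ix (N, n'))%N.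
  move=> n; have /choice[M hM] := fun j => @F_misses R j (fun k => t (n + k)%N)
    ltac:(by move=> k /=; rewrite addnS).
  pose M0 := (\max_(j < J n) M j)%N.
  exists (n + M0).+1; split=> [|N hN]; first by rewrite ltnS leq_addr.
  have nN : (n <= N)%N by apply: leq_trans hN; rewrite leqW// leq_addr.
  rewrite ltn_neqAle; apply/andP; split; last first.
    by apply: ix_mono => //; rewrite leqW// leq_addr.
  apply/negP => /eqP ixE.
  have [/= q1 q2 _] := hix (N, n) nN.
  have [k kM miss] := hM _ _ (F_special_ind (sp N) q1).
  have kM0 : (k <= M0)%N.
    apply: leq_trans (ltnW kM) _.
    exact: (@leq_bigmax _ (fun j : 'I_(J n) => M j) (Ordinal q2)).
  have nkN : (n + k <= N)%N by apply: leq_trans hN; rewrite leqW// leq_add2l.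
  have [/= _ _ [l yl sl]] := hix (N, (n + k)%N) nkN.
  have ixk : ix (N, (n + k)%N) = ix (N, n).
    apply/eqP; rewrite eqn_leq; apply/andP; split; last first.
      by apply: ix_mono => //; exact: leq_addr.
    by rewrite ixE; apply: ix_mono => //; rewrite leqW// leq_add2l.
  rewrite ixk in sl; have /= := miss l sl.
  by rewrite addnS (y_slot yl).
(* At the slot [m q] the chosen block has position at least [q], so its code determines the first
   [q] blocks. *)
pose m q := iter q nx 0%N.
have m_mono q : (m q <= m q.+1)%N by rewrite ltnW//; exact: (hnx _).1.
have ix_ge q N : (m q <= N)%N -> (q <= ix (N, m q))%N.
  elim: q => // q IH qN; have := (hnx (m q)).2 N qN.
  by apply: leq_ltn_trans; apply: IH; exact: leq_trans (m_mono q) qN.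
have [U UU ooU] := free_ultrafilter.
have UF : ProperFilter U by exact: ultra_proper.
have near_ge m' : U [set N | (m' <= N)%N] by apply: ooU; exact: nbhs_infty_ge.
have /choice[phi hphi] : forall q, exists f,
    U [set N | (q < size (s N))%N /\ (s N)`_q = f].
  move=> q; have [L hL] := sigmaF_finite (J (m q.+1)).
  have [|T TL hT] := @ultra_finite _ U (fun N => take (ix (N, m q.+1)) (s N)) L UU.
    apply: filterS (near_ge (m q.+1)) => N mN.
    have q0 : (0 < ix (N, m q.+1))%N by apply: leq_trans (ix_ge q.+1 N mN).
    have [/= _ ixJ _] := hix (N, m q.+1) mN.
    apply: hL; first by have [ds _ _] := sp N; exact: domain_take.
    by move: ixJ; case: (ix _) q0.
  exists T`_q; apply: filterS2 hT (near_ge (m q.+1)) => N /= <- mN.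
  have qi : (q < ix (N, m q.+1))%N := ix_ge q.+1 N mN.
  have [/= ixs _ _] := hix (N, m q.+1) mN.
  by split; [exact: ltn_trans qi ixs|rewrite nth_take].
have pre d : U [set N | (d <= size (s N))%N /\ take d (s N) = mkseq phi d].
  elim: d => [|d IH]; first by apply: (@filterS _ U _ setT) filterT => N _ /=; split => //; rewrite take0.
  apply: filterS2 IH (hphi d) => N /= [_ td] [ds sd]; split => //.
  by rewrite (take_nth 0)// td sd /mkseq -addn1 iotaD map_cat cats1.
have get d : exists N, [/\ (d <= N)%N, (d <= size (s N))%N & take d (s N) = mkseq phi d].
  have [N [[h1 h2] h3]] := @filter_ex _ U _ _ (filterI (pre d) (near_ge d)).
  by exists N; split.
have dom d : (0 < d)%N -> F_special c (mkseq phi d).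
  by move=> d0; have [N [_ _ <-]] := get d; exact: F_special_take.
have sinf : F_special_infinite c phi.
  split.
  - move=> q; have [[[_ h _] h'] _ _] := dom q.+1 (ltn0Sn q).
    have qm : phi q \in mkseq phi q.+1 by apply/mapP; exists q => //; rewrite mem_iota add0n ltnSn.
    by split; [exact: h|exact: h'].
  - move=> q; have [[[_ _ h] _] _ _] := dom q.+2 (ltn0Sn _).
    by have := h q; rewrite size_mkseq !nth_mkseq//; apply.
  - by have [_ h _] := dom 1%N isT.
  - move=> q; have [_ _ h] := dom q.+2 (ltn0Sn _).
    by have := h q; rewrite size_mkseq nth_mkseq// take_mkseq//; apply.
exists phi.
  split => // d d0; have [N [_ ds td]] := get d.
  exists (st N).+1 => //.
  exists [set ind c (mkseq phi d) q | q in [set q | (q < size (mkseq phi d))%N /\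
      exists2 k, k \in `]-oo, +oo[ & ran (mkseq phi d)`_q k]].
  exists (mkseq phi d), false, `]-oo, +oo[; split => //.
  - exact: dom.
  - by rewrite size_mkseq; apply: leq_trans ds _; have [] := hw N.
  - move=> q; rewrite size_mkseq => qd; rewrite -td ind_take// nth_take//.
    by have [_ _ h _] := hw N; apply: h; exact: leq_trans ds.
  - rewrite expr0 scale1r restrictT.
    by rewrite big_map -[in RHS](subn0 d) big_mkord.
(* For a suitable large [N] the sum behind [P N] agrees with [branch phi] on the support of
   [y n]. *)
move=> n n0; have [M hM] := c00_bound (y n).
have [N [MN Ms tM]] := get (maxn M n.+1).
have nN : (n < N)%N by apply: leq_trans MN; exact: leq_maxr.
apply: le_trans (P_large (ltnW nN)) _; rewrite full ?n0// sign_norm.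
rewrite le_eqVlt; apply/orP; left; apply/eqP; congr `|_|; apply: eq_act => k yk.
have kM : (k <= maxn M n.+1)%N.
  by apply: leq_trans (leq_maxl _ _); rewrite ltnW// ltnNge; apply: contraNN yk => /hM ->.
rewrite (block_sum_take (bs N) kM) tM big_map -(branch_sum sinf kM).
by rewrite -[in LHS](subn0 (maxn M n.+1)) big_mkord.
Qed.

End limit.
End tau_limits.

(** * Limits of weighted functionals *)

Section weighted_limits.
Variables (R : realType) (c : codings R) (X : completeNormedModType R).
Variables (i : {linear c00 R -> X}) (hX : is_completion (X_norm c) i).
Local Notation cnorm := (cnorm i).
Implicit Types (x f h : c00 R) (s : seq (c00 R)).

Lemma act_unitr x n : act x (unit_vec n : c00 R) = x n.
Proof. by rewrite -[RHS]act_unit; apply: eq_fsbigr => k _; rewrite mulrC. Qed.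

(** A gliding hump: each chosen index lies beyond the support of the previously chosen vector. *)
Lemma slot_subsequence (z : nat -> c00 R) : (forall n k, (k <= n)%N -> z n k = 0) ->
  exists m : nat -> nat, (forall k, (m k < m k.+1)%N) /\
    forall k l, z (m k) l != 0 -> (m k <= l < m k.+1)%N.
Proof.
move=> z0; have /choice[M hM] := @c00_bound R.
pose m k := iter k (fun n => (n + M (z n)).+1) 0%N.
exists m; split=> [k|k l zl]; first by rewrite ltnS leq_addr.
apply/andP; split; first by rewrite ltnW// ltnNge; apply: contraNN zl => /z0 ->.
rewrite ltnS; apply: leq_trans (leq_addl _ _).
by rewrite ltnW// ltnNge; apply: contraNN zl => /hM ->.
Qed.

(** The three rules for weighted functionals share this shape, with the full interval for the even
    weights. *)
Lemma K_shape n w h : K_ c n w h -> Fset h \/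
  exists w' s (b : bool) (E : interval nat), [/\ (0 < w')%N, admissible (n_ w') s,
    forall f, f \in s -> norming_set c f
    & h = (-1) ^+ b *: restrict E ((m_ w')%:R^-1 *: \sum_(f <- s) f)].
Proof.
elim: n w h => [|n IH] w h; first by rewrite /K_ /=; case: w => //= Fh; left.
rewrite K_S; case=> [{}w {}h /IH//|j s j0 sa sD|j s b E j0 [_ sa _ _ _] sK|
    j s b E j0 [_ sa _ _] sK]; right.
- exists (2 * j)%N, s, false, `]-oo, +oo[; split => //.
  + by rewrite muln_gt0.
  + by move=> f /sD Df; exists n.
  + by rewrite expr0 scale1r restrictT.
- exists (4 * j - 3)%N, s, b, E; split => //; first by lia.
  by move=> f /sK[w' Kf]; exact: K_norming Kf.
- exists (4 * j - 1)%N, s, b, E; split => //; first by lia.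
  by move=> f /sK[w' Kf]; exact: K_norming Kf.
Qed.

(** The value at [y 0] bounds the index in [F_] or the weight of [h N]. If [h N] is in [Fset], it
    then misses some slot. If it is weighted, the minima of the supports miss some slot [k.+1], so
    at most one summand acts on [y k.+1], and the value there is at most [1 / 2 * (4 / 3) = 2 / 3],
    less than [3 / 4]. *)
Lemma K_limit (y : nat -> c00 R) (t : nat -> nat) (h : nat -> c00 R) :
  (forall n, (t n < t n.+1)%N) ->
  (forall n k, y n k != 0 -> (t n <= k < t n.+1)%N) ->
  (forall n, cnorm (y n) <= 4 / 3) ->
  (forall N, exists n w, K_ c n w (h N)) ->
  (forall N n, (n <= N)%N -> 3 / 4 <= act (h N) (y n)) -> False.
Proof.
move=> t_incr y_slot y_norm hK h_large.
have y_neq0 N n : (n <= N)%N -> exists2 k, y n k != 0 & h N k != 0.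
  move=> nN; apply: act_neq0; rewrite gt_eqF//.
  by apply: lt_le_trans (h_large _ _ nN); lra.
have [B B0 hB] := act_bound (y 0%N).
have [J hJ] : exists J, forall j, (J <= j)%N -> F_value R j < 3 / 4 / (2 * B).
  by apply: F_value_small; rewrite divr_gt0// ?mulr_gt0//; lra.
have [L hL] := c00_bound (y 0%N).
pose C : R := \sum_(k < L) cnorm (unit_vec k).
have C0 : 0 <= C by apply: sumr_ge0 => k _; exact: cnorm_ge0.
have hC k : y 0%N k != 0 -> cnorm (unit_vec k) <= C.
  move=> yk; have kL : (k < L)%N by rewrite ltnNge; apply: contraNN yk => /hL ->.
  rewrite /C (bigD1 (Ordinal kL))//= lerDl; apply: sumr_ge0 => ? _; exact: cnorm_ge0.
have [W hW] : exists W : nat, C * B * 2 < W%:R.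
  by eexists; exact: archi_boundP (mulr_ge0 (mulr_ge0 C0 (ltW B0)) (ler0n _ 2)).
have /choice[MF hMF] := fun j => @F_misses R j t t_incr.
(* The slots are shifted by one: the missed slot gets a neighbour on either side, and the interval
   [E], which meets both neighbours, contains the vector between them. *)
have /choice[MK hMK] := fun w => @schreier_misses (n_ w) (fun k => t k.+1) (fun k => t_incr k.+1).
pose MF0 := (\max_(j < J) MF j)%N; pose MK0 := (\max_(w < W) MK w)%N.
pose N := (MF0 + MK0 + 2)%N.
have [n [w Kh]] := hK N.
have [[j _ Fh]|[{n Kh}w' [s [b [E [w0 [bs SA] sn hE]]]]]] := K_shape Kh.
  have jJ : (j < J)%N.
    rewrite ltnNge; apply/negP => /hJ jB.
    have : `|act (h N) (y 0%N)| <= 3 / 4 / (2 * B) * B.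
      apply: hB => [|k _]; first by rewrite divr_ge0// ?mulr_ge0 ?(ltW B0)//; lra.
      have [->|hk] := eqVneq (h N k) 0; last by rewrite (F_val Fh hk) ltW.
      by rewrite normr0 divr_ge0// ?mulr_ge0 ?(ltW B0)//; lra.
    rewrite invfM mulrA divfK ?gt_eqF//.
    have := h_large N 0%N isT; have := ler_norm (act (h N) (y 0%N)); lra.
  have [k kM miss] := hMF _ _ Fh.
  have kN : (k <= N)%N.
    have : (MF j <= MF0)%N.
      exact: (@leq_bigmax _ (fun j : 'I_J => MF j) (Ordinal jJ)).
    by move=> h1; apply: leq_trans (ltnW kM) _; rewrite (leq_trans h1)// /N -addnA leq_addr.
  by have [l yl /miss] := y_neq0 N k kN; rewrite y_slot.
have m0 : 0 < (m_ w')%:R :> R by rewrite ltr0n (ltnW (m_ge2 _)).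
have hval k : h N k = (-1) ^+ b * restrict E ((m_ w')%:R^-1 *: \sum_(f <- s) f) k.
  by rewrite hE.
have sum_norm k : `|(\sum_(f <- s) f) k| <= cnorm (unit_vec k).
  have [->|/block_sum_supp[q qs qk]] := eqVneq ((\sum_(f <- s) f) k) 0.
    by rewrite normr0 cnorm_ge0.
  rewrite (block_sum_at bs qs qk) -act_unitr; apply: (norming_abs_le hX).
  by apply: sn; exact: mem_nth.
(* On the support of [y 0] the unweighted sum has coordinates at most [C], so a weight index from
   [W] on makes the value at [y 0] too small. *)
have wW : (w' < W)%N.
  rewrite ltnNge; apply/negP => Ww.
  have : `|act (h N) (y 0%N)| <= C / (m_ w')%:R * B.
    apply: hB => [|k yk]; first by rewrite divr_ge0// ltW.
    rewrite hval sign_norm /= /restrict_fun; case: ifP => _; last first.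
      by rewrite normr0 divr_ge0// ltW.
    have -> : ((m_ w')%:R^-1 *: \sum_(f <- s) f : c00 R) k =
      (m_ w')%:R^-1 * (\sum_(f <- s) f) k by [].
    rewrite normrM gtr0_norm ?invr_gt0// mulrC ler_pM2r ?invr_gt0//.
    exact: le_trans (sum_norm k) (hC _ yk).
  apply/negP; rewrite -ltNge; apply: lt_le_trans (ler_norm _).
  apply: lt_le_trans (h_large N 0%N isT).
  rewrite mulrAC ltr_pdivrMr//.
  have : W%:R <= (m_ w')%:R :> R.
    rewrite ler_nat (leq_trans Ww)// (leq_trans _ (m_ge_exp2 w0))//.
    by rewrite ltnW// ltn_expl.
  by move: hW; lra.
have [k kM miss] := hMK _ _ SA.
have kN : (k.+2 <= N)%N.
  have : (MK w' <= MK0)%N.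
    exact: (@leq_bigmax _ (fun j : 'I_W => MK j) (Ordinal wW)).
  by rewrite /N; lia.
have yE l : y k.+1 l != 0 -> l \in E.
  move=> yl.
  have [k1 yk1 hk1] := y_neq0 N k (ltnW (ltnW kN)).
  have [k2 yk2 hk2] := y_neq0 N k.+2 kN.
  have inE k' : h N k' != 0 -> k' \in E.
    by rewrite hval mulf_eq0 negb_or => /andP[_ /restrict_supp[]].
  apply: itv_nat_convex (inE _ hk1) (inE _ hk2) _.
  have /andP[_ a1] := y_slot _ _ yk1; have /andP[b1 b2] := y_slot _ _ yl.
  have /andP[c1 _] := y_slot _ _ yk2.
  by rewrite (ltnW (leq_trans a1 b1)) (ltnW (leq_trans b2 c1)).
have actE' : act (h N) (y k.+1) =
    (-1) ^+ b * ((m_ w')%:R^-1 * act (\sum_(f <- s) f) (y k.+1)).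
  rewrite -!actZl; apply: eq_act => l /yE lE; rewrite hval restrict_in//.
have one : `|act (\sum_(f <- s) f) (y k.+1)| <= 4 / 3.
  rewrite act_c00_sum (big_nth 0) big_mkord.
  have [[q qn0]|none] := pselect (exists q : 'I_(size s), act s`_q (y k.+1) != 0); last first.
    rewrite big1 ?normr0; first by lra.
    by move=> q _; apply: contrapT => /eqP qn; apply: none; exists q.
  rewrite (bigD1 q)//= big1 ?addr0.
    apply: le_trans (y_norm k.+1); apply: (norming_abs_le hX).
    by apply: sn; exact: mem_nth.
  move=> q' q'q; apply: contrapT => /eqP q'n0.
  (* Of two summands acting on the vector, the later one would have the minimum of its support
     inside the missed slot. *)
  suff key (p p' : 'I_(size s)) : (p < p')%N -> act s`_p (y k.+1) != 0 ->
      act s`_p' (y k.+1) != 0 -> False.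
    have [lt|gt|eq] := ltngtP q q'; [exact: key lt qn0 q'n0|exact: key gt q'n0 qn0|].
    by move/eqP: q'q; apply; apply/val_inj.
  move=> pp' /act_neq0[l yl sl] /act_neq0[l' yl' sl'].
  have pA : natmin (supp s`_p') \in [fset natmin (supp f) | f in s]%fset.
    by apply/imfsetP; exists s`_p' => //; exact: mem_nth.
  have /= /negP := miss _ pA; apply; apply/andP; split.
    have /andP[tl _] := y_slot _ _ yl; apply: leq_trans tl (ltnW _).
    have [_ _ sb] := bs.
    have sup : supp s`_p' (natmin (supp s`_p')) by apply: natmin_mem; exists l'.
    apply: (@before_chain (fun i => supp s`_i) (size s) sb _ p p' pp' _ l _ sl sup) => //.
    by move=> ? ?; exact: block_supp.
  by have /andP[_ tl] := y_slot _ _ yl'; apply: leq_ltn_trans tl; exact: natmin_le.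
have := h_large N k.+1 (ltnW kN); apply/negP; rewrite -ltNge.
apply: le_lt_trans (ler_norm _) _; rewrite actE' sign_norm normrM.
have mi : (m_ w')%:R^-1 <= 2^-1 :> R by rewrite lef_pV2 ?posrE// ler_nat m_ge2.
rewrite gtr0_norm ?invr_gt0//.
apply: le_lt_trans (ler_pM _ _ mi one) _; rewrite ?invr_ge0 ?(ltW m0)//.
lra.
Qed.

End weighted_limits.

(** * Density of the span of coordinates and branches *)

Section approximation.
Variables (R : realType) (c : codings R) (X : completeNormedModType R).
Variables (i : {linear c00 R -> X}) (hX : is_completion (X_norm c) i).
Local Notation cnorm := (cnorm i).
Implicit Types (x y h : c00 R) (phi : nat -> c00 R).

Definition basic_functional (g : c00 R -> R) : Prop :=
  (exists2 n, (0 < n)%N & g = act (unit_vec n : c00 R)) \/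
  (exists2 phi, survivors c phi & g = act (branch phi)).

Lemma tail_act N (a : nat -> R) x : (forall k, (k <= N)%N -> x k = 0) ->
  act (tail N a) x = act a x.
Proof.
move=> x0; apply: eq_act => k xk; rewrite /tail ltnNge.
by case: leqP => // /x0 x00; rewrite x00 eqxx in xk.
Qed.

Lemma branch_le phi : survivors c phi -> exists N0, forall N, (N0 <= N)%N ->
  forall x, (forall k, (k <= N)%N -> x k = 0) -> `|act (branch phi) x| <= cnorm x.
Proof.
move=> sphi; have [||N0 hN0] := @survivors_sum_le _ _ _ i hX [:: phi].
- by [].
- by move=> psi; rewrite inE => /eqP ->.
by exists N0 => N /hN0 hN x x0; have := hN x; rewrite big_seq1 tail_act.
Qed.

Section far_functional.
Variable f : c00 R -> R.
Hypothesis f_lin : scalar_fun f.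
Hypothesis f_le : forall x, `|f x| <= cnorm x.
Hypothesis f_far : forall r : seq (R * (c00 R -> R)),
  (forall q, q \in r -> basic_functional q.2) ->
  ~ forall x, `|f x - \sum_(q <- r) q.1 * q.2 x| <= 3 / 4 * cnorm x.

(** Normalised vectors on which [f] is large; [4 / 3] is the inverse of the constant [3 / 4] in
    [f_far]. *)
Let C n : set (c00 R) :=
  [set x | [/\ f x = 1, cnorm x <= 4 / 3 & forall k, (k <= n)%N -> x k = 0]].

Let CS n m x : (n <= m)%N -> C m x -> C n x.
Proof.
by move=> nm [h1 h2 h3]; split=> // k kn; apply: h3; exact: leq_trans nm.
Qed.

Let C_conv n x y (t : R) : 0 <= t <= 1 -> C n x -> C n y ->
  C n (t *: x + (1 - t) *: y).
Proof.
move=> /andP[t0 t1] [x1 x2 x3] [y1 y2 y3]; have s0 : 0 <= 1 - t by lra.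
split=> [||k kn].
- by rewrite f_lin (lfunZ _ _ f_lin) x1 y1; lra.
- apply: le_trans (cnormD _ _ _) _; rewrite !cnormZ !ger0_norm//.
  have := ler_wpM2l t0 x2; have := ler_wpM2l s0 y2; lra.
- have -> : (t *: x + (1 - t) *: y) k = t * x k + (1 - t) * y k by [].
  by rewrite x3// y3// !mulr0 addr0.
Qed.

(** If no such vector existed, Helly's theorem would put [f] within [3 / 4] of the span of the first
    [n] coordinates and the branches in [A]. *)
Lemma far_vector n (A : seq (nat -> c00 R)) : (forall phi, phi \in A -> survivors c phi) ->
  exists2 x, C n x & forall phi, phi \in A -> act (branch phi) x = 0.
Proof.
move=> sA; pose s := [seq act (unit_vec k : c00 R) | k <- iota 1 n] ++
  [seq act (branch phi) | phi <- A].
have sl g : g \in s -> scalar_fun g.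
  by rewrite mem_cat => /orP[] /mapP[? _ ->]; exact: act_lfun.
have sb g : g \in s -> basic_functional g.
  rewrite mem_cat => /orP[] /mapP[k kA ->]; [left|right].
    by exists k => //; move: kA; rewrite mem_iota => /andP[].
  by exists k => //; exact: sA.
have [[x xs fx]|none] := pselect (exists2 x,
    (forall g, g \in s -> g x = 0) & 3 / 4 * cnorm x < `|f x|); last first.
  have [||||r rs hr] := @helly _ _ cnorm (3 / 4) _ _ _ s f f_lin sl.
  - exact: cnormB.
  - exact: cnormZ.
  - by lra.
  - move=> x xs; rewrite leNgt; apply/negP => fx; apply: none; by exists x.
  by case: (@f_far r) => [q /rs/sb|].
have fx0 : 0 < `|f x|.
  by apply: le_lt_trans fx; rewrite mulr_ge0 ?cnorm_ge0//; lra.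
have fxn : f x != 0 by rewrite -normr_gt0.
exists ((f x)^-1 *: x).
  split=> [||k kn].
  - by rewrite (lfunZ _ _ f_lin) mulVf.
  - rewrite cnormZ normfV mulrC ler_pdivrMr//; lra.
  - have -> : ((f x)^-1 *: x) k = (f x)^-1 * x k by [].
    have [->|k0] := posnP k; first by rewrite c00_at0 mulr0.
    rewrite -act_unit [X in _ * X]xs ?mulr0// /s mem_cat; apply/orP; left; apply/mapP.
    by exists k => //; rewrite mem_iota k0 add1n ltnS.
move=> phi pA; rewrite (lfunZ _ _ (@act_lfun _ _)) [X in _ * X]xs ?mulr0//.
by rewrite /s mem_cat; apply/orP; right; apply/mapP; exists phi.
Qed.

(* Boundedly many branches can be large on a subsequence: signed sums of tails
   of distinct branches have norm at most one. *)
Lemma few_large_branches (x : nat -> c00 R) (e : R) : (forall n, C n (x n)) -> 0 < e ->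
  exists (M : set nat) (B : seq (nat -> c00 R)),
  [/\ forall n, exists2 m, (n <= m)%N & M m,
    forall phi, phi \in B -> survivors c phi
  & forall phi, survivors c phi -> phi \notin B ->
     exists n0, forall n, M n -> (n0 <= n)%N -> `|act (branch phi) (x n)| <= e].
Proof.
move=> xC e0; apply: contrapT => nMB.
have [r hr] : exists r : nat, 4 / 3 / e < r%:R.
  by eexists; apply: archi_boundP; rewrite divr_ge0 ?(ltW e0)//; lra.
have [M [B [Mu uB sB Br hB]]] : exists (M : set nat) (B : seq (nat -> c00 R)),
    [/\ forall n, exists2 m, (n <= m)%N & M m, uniq B,
      forall phi, phi \in B -> survivors c phi, size B = r &
      forall phi n, phi \in B -> M n -> e < `|act (branch phi) (x n)|].
  elim: r {hr} => [|r [M [B [Mu uB sB Br hB]]]].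
    by exists setT, [::]; split => // n; exists n.
  have [phi [sphi pB hphi]] : exists phi, [/\ survivors c phi, phi \notin B &
      forall n0, exists n, [/\ M n, (n0 <= n)%N & e < `|act (branch phi) (x n)|]].
    apply: contrapT => nphi; apply: nMB; exists M, B; split => // phi sphi pB.
    apply: contrapT => nn0; apply: nphi; exists phi; split => // n0.
    apply: contrapT => nn; apply: nn0; exists n0 => n Mn n0n; rewrite leNgt.
    by apply/negP => h; apply: nn; exists n.
  exists (M `&` [set n | e < `|act (branch phi) (x n)|]), (phi :: B); split.
  - by move=> n; have [m [Mm nm h]] := hphi n; exists m.
  - by rewrite /= pB.
  - by move=> psi; rewrite in_cons => /predU1P[->|/sB].
  - by rewrite /= Br.
  - by move=> psi n; rewrite in_cons => /predU1P[->|pB'] [Mn h] //; exact: hB.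
have [N0 hN0] := survivors_sum_le hX uB sB.
have [m Nm Mm] := Mu N0; have [_ xm x0] := xC m.
have := hN0 m Nm (x m); apply/negP; rewrite -ltNge; apply: le_lt_trans xm _.
rewrite -[ltLHS](divfK (lt0r_neq0 e0)).
have : 4 / 3 / e * e < r%:R * e by rewrite ltr_pM2r.
move=> /lt_le_trans; apply.
have -> : r%:R * e = \sum_(phi <- B) e.
  by rewrite big_const_seq count_predT iter_addr_0 Br mulr_natl.
rewrite !big_seq; apply: ler_sum => phi pB.
by rewrite tail_act// ltW// hB.
Qed.

(** Each of the [r.+1] averaged sequences is killed by the branches that are large on the earlier
    ones. A branch is thus large at most once, and there it costs at most [4 / 3]. *)
Lemma averaged_sequence r (e : R) : 0 < e -> exists y : nat -> c00 R,
  (forall n, C n (y n)) /\ forall phi, survivors c phi ->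
  exists n0, forall n, (n0 <= n)%N ->
    r.+1%:R * `|act (branch phi) (y n)| <= r.+1%:R * e + 4 / 3.
Proof.
(* The list [B] records the branches that may have been large so far. *)
move=> e0; suff [y [B [yC _ hB]]] : exists (y : nat -> c00 R) (B : seq (nat -> c00 R)),
    [/\ forall n, C n (y n), forall phi, phi \in B -> survivors c phi &
    forall phi, survivors c phi -> exists n0, forall n, (n0 <= n)%N ->
    r.+1%:R * `|act (branch phi) (y n)| <= r.+1%:R * e + (phi \in B)%:R * (4 / 3)].
  exists y; split=> // phi /hB[n0 hn0]; exists n0 => n /hn0 /le_trans; apply.
  by rewrite lerD2l; case: (_ \in _); rewrite /= ?mul1r ?mul0r; lra.
have fresh (A : seq (nat -> c00 R)) : (forall phi, phi \in A -> survivors c phi) ->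
    exists (x : nat -> c00 R) (B : seq (nat -> c00 R)) (g : nat -> nat),
    [/\ forall n, C n (x n) /\ (n <= g n)%N, forall phi, phi \in B -> survivors c phi,
     forall phi n, phi \in A -> act (branch phi) (x n) = 0 &
     forall phi, survivors c phi -> exists n0, forall n, (n0 <= n)%N ->
       `|act (branch phi) (x n)| <= if phi \in B then 4 / 3 else e].
  move=> sA; have /choice[x hx] : forall n, exists x, C n x /\
      forall phi, phi \in A -> act (branch phi) x = 0.
    by move=> n; have [x Cx xA] := far_vector n sA; exists x.
  have [M [B [Mu sB hB]]] := few_large_branches (fun n => (hx n).1) e0.
  have /choice[g hg] : forall n, exists m, (n <= m)%N /\ M m.
    by move=> n; have [m nm Mm] := Mu n; exists m.
  exists (x \o g), B, g; split => //=.
  - by move=> n; split; [apply: CS (hx (g n)).1; exact: (hg n).1|exact: (hg n).1].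
  - by move=> phi n pA; exact: (hx (g n)).2.
  move=> phi sphi; case: ifPn => pB.
    have [N0 hN0] := branch_le sphi; exists N0 => n Nn.
    have [_ xn x0] := (hx (g n)).1; apply: le_trans xn.
    by apply: hN0 x0; exact: leq_trans (hg n).1.
  have [n0 hn0] := hB phi sphi pB; exists n0 => n nn0; apply: hn0.
    exact: (hg n).2.
  exact: leq_trans (hg n).1.
elim: r => [|r [y [B [yC sB hy]]]].
  have [//|x [B [g [xC sB _ hx]]]] := @fresh [::].
  exists x, B; split => //; first by move=> n; exact: (xC n).1.
  move=> phi /hx[n0 hn0]; exists n0 => n /hn0.
  by rewrite !mul1r; case: ifP => _ /le_trans; apply; rewrite ?mul1r ?mul0r; lra.
have [x [B' [g [xC sB' xB hx]]]] := fresh B sB.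
have r0 : 0 < r.+2%:R :> R by rewrite ltr0n.
have r1 : r.+2%:R = r.+1%:R + 1 :> R by rewrite -natr1.
(* This weight gives all [r.+2] sequences the same share. *)
pose t : R := r.+1%:R / r.+2%:R.
have t1 : 1 - t = r.+2%:R^-1.
  rewrite /t -[X in X - _](@mulfV _ (r.+2%:R : R)) ?gt_eqF// {1}r1.
  by rewrite mulrDl mul1r addrC addKr.
exists (fun n => t *: y n + (1 - t) *: x n), (B ++ B'); split.
- move=> n; apply: C_conv; [|exact: yC|exact: (xC n).1].
  by rewrite divr_ge0 ?ler0n//= ler_pdivrMr// mul1r ler_nat.
- by move=> phi; rewrite mem_cat => /orP[/sB|/sB'].
move=> phi sphi; have [n0 hn0] := hy phi sphi; have [n1 hn1] := hx phi sphi.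
exists (maxn n0 n1) => n; rewrite geq_max => /andP[/hn0 h1 /hn1 h2].
rewrite act_lfun (lfunZ _ _ (@act_lfun _ _)) t1.
have : r.+2%:R * `|t * act (branch phi) (y n) + r.+2%:R^-1 * act (branch phi) (x n)| <=
    r.+1%:R * `|act (branch phi) (y n)| + `|act (branch phi) (x n)|.
  have rt : r.+2%:R * t = r.+1%:R by rewrite mulrC divfK// gt_eqF.
  rewrite -{1}[r.+2%:R](ger0_norm (ltW r0)) -normrM mulrDr.
  rewrite [_ * (t * _)]mulrA rt mulVKf ?gt_eqF//.
  by rewrite (le_trans (ler_normD _ _))// lerD2r normrM ger0_norm.
move=> /le_trans; apply; rewrite mem_cat; move: h1 h2.
have [pB|pB] := boolP (phi \in B).
  by rewrite xB// normr0 /= !mul1r; rewrite r1; lra.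
by case: ifP => _ /=; rewrite ?mul0r ?mul1r r1; lra.
Qed.

(** The convex hull of the vectors [y m] with [n <= m], as the intersection of all convex sets
    containing them. *)
Definition hull (y : nat -> c00 R) n : set (c00 R) := [set x | forall A : set (c00 R),
  (forall x y (t : R), 0 <= t <= 1 -> A x -> A y -> A (t *: x + (1 - t) *: y)) ->
  (forall m, (n <= m)%N -> A (y m)) -> A x].

(** Otherwise Simons' inequality on the hulls of an averaged sequence yields functionals in [tau]
    that are large on many hull vectors at once, and [tau_limit] gives a survivor that is large on
    hull vectors far out. But its branch is at most [e / 2] on late averages, hence on their
    hulls. *)
Lemma small_on_tau n (e : R) : 0 < e ->
  exists2 y, C n y & forall h, tau c h -> `|act h y| <= e.
Proof.
move=> e0; apply: contrapT => none.
have large x : C n x -> exists2 h, tau c h & e <= act h x.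
  move=> Cx; apply: contrapT => nh; apply: none; exists x => // h th.
  rewrite leNgt; apply/negP => eh; apply: nh.
  have [h0|h0] := leP 0 (act h x).
    by exists h => //; rewrite ger0_norm// in eh; exact: ltW.
  exists (- h); first exact: tauN.
  rewrite ltr0_norm// in eh.
  by rewrite -scaleN1r act_c00Z mulN1r ltW.
(* This [r] makes every branch eventually at most [e / 2], below the [3 * e / 4] left by Simons'
   inequality. *)
have [r hr] : exists r : nat, 4 / 3 / (e / 4) < r%:R.
  by eexists; apply: archi_boundP; rewrite !divr_ge0 ?(ltW e0)//; lra.
have [y [yC hy]] := @averaged_sequence r (e / 4) ltac:(by rewrite divr_gt0).
have {}hy phi : survivors c phi -> exists n0, forall m, (n0 <= m)%N ->
    `|act (branch phi) (y m)| <= e / 2.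
  move=> /hy[n0 hn0]; exists n0 => m /hn0 hm.
  rewrite ltr_pdivrMr ?divr_gt0// in hr.
  have r0 : 0 < r.+1%:R :> R by rewrite ltr0n.
  rewrite -(ler_pM2l r0); apply: le_trans hm _.
  by rewrite -natr1; lra.
have hullC m : hull y (n + m) `<=` C (n + m).
  move=> x hx; apply: (hx (C (n + m))) => [? ? ?|k nk]; first exact: C_conv.
    exact: CS (yC k).
have [||||||||z [hz zl]] := @simons R _ _ (fun h x => act h x) _ (tau c)
    (fun m => hull y (n + m)) (4 / 3) e (e / 4).
- by move=> h a x x'; exact: act_lfun.
- move=> m x hx A Ac Am; apply: hx => // k nk; apply: Am.
  by apply: leq_trans nk; rewrite leq_add2l.
- move=> m x x' t t01 hx hx' A Ac Am; by apply: (Ac) => //; [exact: hx|exact: hx'].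
- by move=> m; exists (y (n + m)%N) => A _ Am; exact: Am _ (leqnn _).
- by lra.
- move=> x h /hullC[_ + _] th; apply: le_trans.
  by apply: (norming_abs_le hX); exact: tau_norming.
- by move=> x /hullC; rewrite addn0; exact: large.
- by apply/andP; split; lra.
have zC m : C (n + m) (z m) by exact: hullC.
have [m [m_incr m_slot]] : exists m : nat -> nat, (forall k, (m k < m k.+1)%N) /\
    forall k l, z (m k) l != 0 -> (m k <= l < m k.+1)%N.
  apply: slot_subsequence => k l lk; have [_ _] := zC k; apply.
  by apply: leq_trans lk _; exact: leq_addl.
have m_ge k : (k <= m k)%N.
  by elim: k => // k IH; exact: leq_ltn_trans (m_incr k).
have m_mono := incr_homo m_incr.
have /choice[P hP] : forall N, exists h, tau c h /\
    forall k, (k <= m N)%N -> e - e / 4 <= act h (z k).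
  by move=> N; have [h th hh] := zl (m N); exists h.
have [|||||phi sphi hphi] := @tau_limit R c (fun k => z (m k)) m P (3 * e / 4).
- exact: m_incr.
- exact: m_slot.
- by move=> N; exact: (hP N).1.
- by lra.
- move=> N k kN; have := (hP N).2 (m k) (m_mono _ _ kN).
  by have := ler_norm (act (P N) (z (m k))); lra.
have [n0 hn0] := hy phi sphi.
have := hphi n0.+1 isT; apply/negP; rewrite -ltNge.
apply: (@le_lt_trans _ _ (e / 2)); last by lra.
apply: (hz _ [set x | `|act (branch phi) x| <= e / 2]) => [x x' t /andP[t0 t1] /= hx hx'|k nk].
  rewrite act_lfun (lfunZ _ _ (@act_lfun _ _)) (le_trans (ler_normD _ _))//.
  have s0 : 0 <= 1 - t by lra.
  rewrite !normrM (ger0_norm t0) (ger0_norm s0).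
  have := ler_wpM2l t0 hx; have := ler_wpM2l s0 hx'; lra.
apply: hn0; apply: leq_trans nk; apply: leq_trans (leq_addl _ _).
exact: leq_trans (leqnSn _) (m_ge _).
Qed.

(** [G_step] with the number of summands kept visible. *)
Definition G_sum n d (h : c00 R) : Prop :=
  exists (P : 'I_d -> c00 R) (I : 'I_d -> set nat) (b : 'I_d -> bool),
    [/\ forall j, tau_rep c (D_ c n) n.+1 (P j) (I j),
        forall j k, supp (P j) k -> (d <= k)%N,
        trivIset [set: 'I_d] I & h = \sum_j (-1) ^+ b j *: P j].

(** A sum of [d] members of [tau] starts at [d] or later. Among successive vectors it is small on
    those starting after [d] and zero on those ending before [d], so at most one vector of the
    average gets the trivial bound [4 / 3]. *)
Lemma small_on_G n (e : R) : 0 < e ->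
  exists2 y, C n y & forall m h, G_step c (D_ c m) m.+1 h -> act h y <= e.
Proof.
move=> e0.
(* The last term of the bound is the allowance for the one exceptional vector, which occurs only if
   [d] exceeds [N]. *)
have sum_seq r N : exists y, [/\ f y = r%:R, cnorm y <= r%:R * (4 / 3),
    forall k, (k <= N)%N -> y k = 0 & forall m d h, G_sum m d h ->
      act h y <= r%:R * (e / 2) + (N < d)%N%:R * (4 / 3)].
  elim: r N => [|r IH] N.
    exists 0; split => //.
    - exact: lfun0.
    - by rewrite mul0r /cnorm linear0 normr0.
    - move=> m d h _; rewrite (lfun0 (@act_lfun _ _)) mul0r add0r.
      by rewrite mulr_ge0 ?ler0n//; lra.
  (* With [d <= N] summands the total is at most [e / 2]; the successor avoids a division by
     zero. *)
  have eN : 0 < e / 2 / N.+1%:R by rewrite !divr_gt0.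
  have [y [y1 y2 y3] y_tau] := small_on_tau N eN.
  have [M hM] := c00_bound y.
  have [y' [y'1 y'2 y'3 y'G]] := IH (maxn M N).
  have S : r.+1%:R = 1 + r%:R :> R by rewrite nat1r.
  exists (y + y'); split.
  - by rewrite -[y]scale1r f_lin y1 y'1 mul1r S.
  - by apply: le_trans (cnormD _ _ _) _; rewrite S; lra.
  - move=> k kN; have -> : (y + y') k = y k + y' k by [].
    by rewrite y3// y'3 ?addr0// (leq_trans kN)// leq_maxr.
  move=> m d h Gh; have hy' := y'G m d h Gh.
  have hnorm : act h y <= cnorm y.
    apply: le_trans (ler_norm _) _; apply: (norming_abs_le hX).
    by apply: (@G_norming _ c m); have [P [I [b Gb]]] := Gh; exists d, P, I, b.
  have -> : act h (y + y') = act h y + act h y'.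
    by rewrite -[y in LHS]scale1r act_lfun mul1r.
  have [P [I [b [hP dP _ hE]]]] := Gh.
  have [dN|Nd] := leqP d N.
    rewrite [(maxn M N < d)%N]ltnNge leq_max dN orbT mul0r addr0 in hy'.
    rewrite mul0r addr0 S.
    suff : act h y <= e / 2 by lra.
    rewrite hE act_c00_sum.
    apply: (@le_trans _ _ (\sum_(j < d) e / 2 / N.+1%:R)).
      apply: ler_sum => j _; rewrite act_c00Z; apply: le_trans (ler_norm _) _.
      by rewrite sign_norm; apply: y_tau; exists m.+1 => //; exists (I j).
    rewrite sumr_const card_ord -[_ *+ d]mulr_natr mulrAC ler_pdivrMr ?ltr0n//.
    by rewrite ler_pM2l ?divr_gt0// ler_nat leqW.
  rewrite mul1r S; have [Md|dM] := leqP d (maxn M N).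
    by move: hy'; rewrite ltnNge Md mul0r addr0; lra.
  suff -> : act h y = 0 by move: hy'; rewrite dM mul1r; lra.
  apply: act0 => k yk; rewrite hE c00_sumE big1// => j _.
  have -> : ((-1) ^+ b j *: P j) k = (-1) ^+ b j * P j k by [].
  apply/eqP; rewrite mulf_eq0; apply/orP; right; apply/negPn/negP => /(dP j k).
  apply/negP; rewrite -ltnNge; apply: leq_ltn_trans _ dM.
  apply: leq_trans (leq_maxl _ _).
  by rewrite ltnW// ltnNge; apply: contraNN yk => /hM ->.
have [r hr] : exists r : nat, 4 / 3 / (e / 2) < r%:R.
  by eexists; apply: archi_boundP; rewrite !divr_ge0 ?(ltW e0)//; lra.
have [y [y1 y2 y3 yG]] := sum_seq r.+1 n.
have r0 : 0 < r.+1%:R :> R by rewrite ltr0n.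
exists (r.+1%:R^-1 *: y).
  split.
  - by rewrite (lfunZ _ _ f_lin) y1 mulVf ?gt_eqF.
  - by rewrite cnormZ gtr0_norm ?invr_gt0// ler_pdivrMl.
  - move=> k kn; have -> : (r.+1%:R^-1 *: y) k = r.+1%:R^-1 * y k by [].
    by rewrite y3// mulr0.
move=> m h [d [P [I [b Gh]]]].
have := yG m d h (ex_intro _ P (ex_intro _ I (ex_intro _ b Gh))).
rewrite (lfunZ _ _ (@act_lfun _ _)) ler_pdivrMl// => /le_trans; apply.
rewrite ltr_pdivrMr ?divr_gt0// in hr.
by case: (n < d)%N; rewrite -natr1 /= ?mul1r ?mul0r; lra.
Qed.

(** A vector in [CG n] has norm at least 1, and members of [G_step] give at most [1 / 2] on it, so
    some functional in [KS] gives at least [5 / 6]. Simons' inequality retains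
    [5 / 6 - 1 / 12 = 3 / 4] on many vectors at once, which [K_limit] excludes. *)
Lemma no_far_functional : False.
Proof.
pose CG n := [set x | C n x /\ forall m h, G_step c (D_ c m) m.+1 h -> act h x <= 1 / 2].
pose KS := [set h | exists n w, K_ c n w h].
have [||||||||z [hz zl]] := @simons R _ _ (fun h x => act h x) _ KS
    CG (4 / 3) (5 / 6) (1 / 12).
- by move=> h a x x'; exact: act_lfun.
- by move=> n x [Cx Gx]; split=> //; exact: CS Cx.
- move=> n x x' t t01 [Cx Gx] [Cx' Gx']; split; first exact: C_conv.
  move=> m h Gh; rewrite act_lfun (lfunZ _ _ (@act_lfun _ _)).
  have /andP[t0 t1] := t01; have s0 : 0 <= 1 - t by lra.
  by have := ler_wpM2l t0 (Gx m h Gh); have := ler_wpM2l s0 (Gx' m h Gh); lra.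
- by move=> n; have [y Cy Gy] := @small_on_G n (1 / 2) ltac:(by lra); exists y.
- by lra.
- move=> x h [[_ + _] _] [n [w Kh]]; apply: le_trans.
  by apply: (norming_abs_le hX); exact: K_norming Kh.
- move=> x [[fx _ _] Gx]; apply: contrapT => nh.
  have : cnorm x <= 5 / 6.
    apply: (cnorm_le hX) => [n w h Kh|n h Gh].
      rewrite leNgt; apply/negP => hx; apply: nh; exists h; last exact: ltW.
      by exists n, w.
    by have := Gx n h Gh; lra.
  by have := f_le x; rewrite fx normr1; lra.
- by apply/andP; split; lra.
have zC n : C n (z n) by have [] := hz n.
have [m [m_incr m_slot]] : exists m : nat -> nat, (forall k, (m k < m k.+1)%N) /\
    forall k l, z (m k) l != 0 -> (m k <= l < m k.+1)%N.
  by apply: slot_subsequence => k l lk; have [_ _] := zC k; apply.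
have m_mono := incr_homo m_incr.
have /choice[P hP] : forall N, exists h, (exists n w, K_ c n w h) /\
    forall k, (k <= m N)%N -> 5 / 6 - 1 / 12 <= act h (z k).
  by move=> N; have [h Kh hh] := zl (m N); exists h.
apply: (@K_limit R c X i hX (fun k => z (m k)) m P).
- exact: m_incr.
- exact: m_slot.
- by move=> n; have [] := zC (m n).
- by move=> N; exact: (hP N).1.
- by move=> N n nN; have := (hP N).2 (m n) (m_mono _ _ nN); lra.
Qed.

End far_functional.

Lemma approximation_step (f : c00 R -> R) (M : R) : scalar_fun f -> 0 <= M ->
  (forall x, `|f x| <= M * cnorm x) ->
  exists2 r : seq (R * (c00 R -> R)), (forall q, q \in r -> basic_functional q.2) &
    forall x, `|f x - \sum_(q <- r) q.1 * q.2 x| <= 3 / 4 * M * cnorm x.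
Proof.
move=> fl; rewrite le_eqVlt => /orP[/eqP <- f0|M0 fM].
  exists [::] => // x; rewrite big_nil subr0 mulr0 mul0r.
  by have := f0 x; rewrite mul0r.
apply: contrapT => none.
apply: (@no_far_functional (fun x => M^-1 * f x)).
- by move=> a x y; rewrite fl mulrDr mulrCA.
- by move=> x; rewrite normrM gtr0_norm ?invr_gt0// ler_pdivrMl.
move=> r rb hr; apply: none; exists [seq (M * q.1, q.2) | q <- r].
  by move=> q /mapP[q' /rb q'b ->].
move=> x; rewrite big_map /=.
under eq_bigr do rewrite -mulrA.
rewrite -mulr_sumr -[f x](mulVKf (lt0r_neq0 M0)) -mulrBr normrM gtr0_norm//.
by rewrite [3 / 4 * M]mulrC -mulrA ler_pM2l.
Qed.

(** Each application of [approximation_step] to the remainder multiplies its norm bound by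
    [3 / 4]. *)
Lemma approximation (f : c00 R -> R) (M e : R) : scalar_fun f -> 0 <= M -> 0 < e ->
  (forall x, `|f x| <= M * cnorm x) ->
  exists2 r : seq (R * (c00 R -> R)), (forall q, q \in r -> basic_functional q.2) &
    forall x, `|f x - \sum_(q <- r) q.1 * q.2 x| <= e * cnorm x.
Proof.
move=> fl M0 e0 fM.
have iter n : exists2 r : seq (R * (c00 R -> R)),
    (forall q, q \in r -> basic_functional q.2) &
    forall x, `|f x - \sum_(q <- r) q.1 * q.2 x| <= (3 / 4) ^+ n * M * cnorm x.
  elim: n => [|n [r rb hr]].
    by exists [::] => // x; rewrite big_nil subr0 expr0 mul1r.
  have fl' : scalar_fun (fun x => f x - \sum_(q <- r) q.1 * q.2 x).
    move=> a x y; rewrite fl (@lfun_sum _ _ _ r (fun q => q.1) (fun q => q.2))//.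
      by rewrite mulrBr opprD addrACA.
    by move=> q /rb[[k _ ->]|[k _ ->]]; exact: act_lfun.
  have [|r' rb' hr'] := approximation_step fl' _ hr.
    by rewrite mulr_ge0// exprn_ge0//; lra.
  exists (r ++ r') => [q|x]; first by rewrite mem_cat => /orP[/rb|/rb'].
  by rewrite big_cat opprD addrA exprS -!mulrA; have := hr' x; rewrite -!mulrA.
have [n hn] : exists n, (3 / 4) ^+ n * M <= e :> R.
  have M1 : 0 < M + 1 by rewrite ltr_wpDl.
  have cv : (fun n => (3 / 4 : R) ^+ n) @ \oo --> (0 : R).
    by apply: cvg_expr; rewrite ger0_norm; lra.
  have [n _ hn] := cvgr0_norm_le _ cv _ (divr_gt0 e0 M1).
  have := hn n (leqnn n); rewrite /=.
  have p0 : 0 <= (3 / 4) ^+ n :> R by apply: exprn_ge0; lra.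
  rewrite ger0_norm// ler_pdivlMr// => h; exists n; apply: le_trans h.
  by rewrite ler_wpM2l// lerDl.
have [r rb hr] := iter n; exists r => // x.
apply: le_trans (hr x) _.
by rewrite ler_wpM2r// cnorm_ge0.
Qed.

End approximation.

(** * Coefficients of functionals along survivors *)

Section ultralimits.
Variables (R : realType) (U : set_system nat).
Hypothesis UU : UltraFilter U.
Hypothesis ooU : \oo `<=` U.
Implicit Types (u v : nat -> R) (l B : R).

Definition tends u l := forall e : R, 0 < e -> U [set n | `|u n - l| <= e].

Let UF : ProperFilter U. Proof. exact: ultra_proper. Qed.

Lemma tends_lim u B : (forall n, `|u n| <= B) -> tends u (lim (u @ U)).
Proof.
move=> uB e e0; have cv := ultra_bounded_cvg UU uB.
have := @cvgrPdist_le _ _ _ U _ u (lim (u @ U)).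
move=> [/(_ cv e e0) + _]; apply: filterS => n /=.
by rewrite distrC.
Qed.

Lemma tends_norm_le u l B : tends u l -> U [set n | `|u n| <= B] -> `|l| <= B.
Proof.
move=> ul uB; apply/ler_addgt0Pr => e e0.
have [n [/= n1 n2]] := @filter_ex _ U _ _ (filterI (ul e e0) uB).
have -> : l = u n - (u n - l) by rewrite opprB addrC subrK.
by rewrite (le_trans (ler_normB _ _))// lerD.
Qed.

Lemma tends_uniq u l l' : tends u l -> tends u l' -> l = l'.
Proof.
move=> ul ul'; apply/eqP; rewrite -subr_eq0 -normr_le0; apply/ler_addgt0Pr => e e0.
rewrite add0r.
have e2 : 0 < e / 2 by rewrite divr_gt0.
have [n [/= n1 n2]] := @filter_ex _ U _ _ (filterI (ul _ e2) (ul' _ e2)).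
have -> : l - l' = (u n - l') - (u n - l) by lra.
by rewrite (le_trans (ler_normB _ _))// [e]splitr lerD.
Qed.

Lemma tends_near u l : (forall e : R, 0 < e -> exists n0, forall n, (n0 <= n)%N ->
  `|u n - l| <= e) -> tends u l.
Proof.
move=> h e /h[n0 hn0]; apply: filterS (ooU (nbhs_infty_ge n0)) => n /=; exact: hn0.
Qed.

Lemma tends_eq u v l : U [set n | u n = v n] -> tends u l -> tends v l.
Proof. by move=> uv ul e /ul; apply: filterS2 uv => n /= ->. Qed.

Lemma tends_cst l : tends (fun=> l) l.
Proof. by apply: tends_near => e e0; exists 0%N => n _; rewrite subrr normr0 ltW. Qed.

Lemma tendsZD (a : R) u v l l' : tends u l -> tends v l' ->
  tends (fun n => a * u n + v n) (a * l + l').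
Proof.
move=> ul vl e e0; have a0 : 0 < `|a| + 1 by rewrite ltr_wpDl.
have e1 : 0 < e / 2 / (`|a| + 1) by rewrite !divr_gt0.
have e2 : 0 < e / 2 by rewrite divr_gt0.
apply: filterS2 (ul _ e1) (vl _ e2) => n /= h1 h2.
have -> : a * u n + v n - (a * l + l') = a * (u n - l) + (v n - l') by lra.
rewrite (le_trans (ler_normD _ _))// [e]splitr lerD// normrM.
apply: (@le_trans _ _ ((`|a| + 1) * `|u n - l|)); first by rewrite ler_wpM2r// lerDl.
by rewrite mulrC -ler_pdivlMr.
Qed.

Lemma tends_sum m (a : nat -> R) (u : nat -> nat -> R) (l : nat -> R) :
  (forall k, tends (u k) (l k)) ->
  tends (fun n => \sum_(k < m) a k * u k n) (\sum_(k < m) a k * l k).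
Proof.
move=> ul; elim: m => [|m IH].
  rewrite big_ord0; apply: tends_eq (tends_cst 0).
  by apply: (@filterS _ U _ setT) filterT => n _; rewrite /= big_ord0.
rewrite big_ord_recr /= addrC; apply: tends_eq (tendsZD (a m) (ul m) IH).
by apply: (@filterS _ U _ setT) filterT => n _; rewrite /= big_ord_recr /= addrC.
Qed.

End ultralimits.

(** * Vectors attached to the blocks of a survivor *)

Section survivor_vectors.
Variables (R : realType) (c : codings R) (X : completeNormedModType R).
Variables (i : {linear c00 R -> X}) (hX : is_completion (X_norm c) i).
Local Notation cnorm := (cnorm i).
Implicit Types (x f : c00 R) (phi psi : nat -> c00 R).

Lemma norm_of_le (A : set (c00 R)) x (r : R) f :
  (norm_of A x <= r%:E)%E -> A f -> `|act f x| <= r.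
Proof.
move=> Ar Af; rewrite -lee_fin; apply: le_trans Ar.
by apply: ereal_sup_ubound; exists f.
Qed.

Lemma scaled_le (K r s t : R) : 0 <= K -> r <= K * s -> s <= t -> r <= K * t.
Proof. by move=> K0 rs st; apply: le_trans rs _; rewrite ler_wpM2l. Qed.

Lemma ran_supp x k : x k != 0 -> ran x k.
Proof. by move=> xk; exists k, k; rewrite leqnn. Qed.

Lemma unit_vec_D n k : (0 < k)%N -> D_ c n (unit_vec k).
Proof.
move=> k0; apply: (D_mono (leq0n n)); apply: sub_convQ.
by exists 0%N => //; exists false, k => //; rewrite expr0 scale1r.
Qed.

(** The estimates for smaller and for larger indices are weakened to one summable bound. *)
Lemma exact_vector (D : set (c00 R)) j f : (0 < j)%N ->
  exact_functional D j f -> exists x,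
  [/\ forall g, D g -> `|act g x| <= 1000, ran x `<=` ran f, act f x = 1 &
    forall k g, (0 < k)%N -> k != j -> F_ k g -> `|act g x| <= 1000 * 2^-1 ^+ k].
Proof.
move=> j0 [_ [x [xD xr xf xF]]]; exists x.
split; [by move=> g; exact: norm_of_le|exact: xr|exact: xf|move=> k g k0 kj Fg].
have [x1 x2] := xF k k0; move: kj; rewrite neq_ltn => /orP[kj|jk].
  apply: scaled_le (norm_of_le (x1 kj) Fg) _; first exact: ler0n.
  by have := F_value_exp2 R k0; rewrite /F_value; case: (k) k0.
apply: scaled_le (norm_of_le (x2 jk) Fg) _; first exact: ler0n.
exact: F_value_ratio.
Qed.

(** All witnesses are supported in the finite set [ran f], so their coordinatewise ultralimit is in
    [c00] and the action of every functional passes to the limit. A member of [D_ c n] is bounded by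
    [K] on all witnesses from [n] on, which gives the norm bound. *)
Lemma vector_limit (f : c00 R) j (K : R) : 0 <= K ->
  (forall n, exists x, [/\ forall g, D_ c n g -> `|act g x| <= K,
    ran x `<=` ran f, act f x = 1 &
    forall k g, (0 < k)%N -> k != j -> F_ k g -> `|act g x| <= K * 2^-1 ^+ k]) ->
  exists x, [/\ cnorm x <= K, ran x `<=` ran f, act f x = 1 &
    forall k g, (0 < k)%N -> k != j -> F_ k g -> `|act g x| <= K * 2^-1 ^+ k].
Proof.
move=> K0 /choice[z hz].
have [U UU ooU] := free_ultrafilter.
have UF : ProperFilter U by exact: ultra_proper.
have [M hM] := c00_bound f.
have ranM k : ran f k -> (k < M)%N.
  move=> [_ [l [_ pl /andP[_ kl]]]]; apply: leq_ltn_trans kl _.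
  by rewrite ltnNge; apply: contraNN pl => /hM ->.
have zb k n : `|z n k| <= K.
  have [->|k0] := posnP k; first by rewrite c00_at0 normr0.
  by rewrite -act_unit; have [h _ _ _] := hz n; apply: h; exact: unit_vec_D.
pose u k := lim ((fun n => z n k) @ U).
have zu k : tends U (fun n => z n k) (u k) by apply: (tends_lim UU (zb k)).
have u_out k : (forall n, z n k = 0) -> u k = 0.
  move=> zk; apply: (tends_uniq UU (zu k)); apply: tends_eq (tends_cst UU ooU 0).
  by apply: (@filterS _ U _ setT) filterT => n _; rewrite /= zk.
have z_out n k : (M <= k)%N -> z n k = 0.
  move=> Mk; apply/eqP; apply: contraTT isT => zk.
  have [_ zr _ _] := hz n; have := ranM k (zr k (ran_supp zk)).
  by rewrite ltnNge Mk.
have [x hx] := c00_trunc u M.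
have xu k : x k = u k.
  rewrite hx; case: ifP => // /negbT; rewrite negb_and -leqNgt leqn0 -leqNgt.
  by move=> /orP[/eqP ->|Mk]; rewrite u_out// => n; [exact: c00_at0|exact: z_out].
have x_out k : (M <= k)%N -> x k = 0 by move=> Mk; rewrite xu u_out// => n; exact: z_out.
have act_tends a : tends U (fun n => act a (z n)) (act a x).
  rewrite (actE a x_out).
  have := @tends_sum _ _ UU ooU M a (fun k n => z n k) x.
  move=> h; apply: tends_eq (h _) => [|k]; last by rewrite xu; exact: zu.
  by apply: (@filterS _ U _ setT) filterT => n _; rewrite /= (actE a (z_out n)).
exists x; split.
- have xD g : norming_set c g -> `|act g x| <= K.
    move=> [n _ Df]; apply: (tends_norm_le UU (act_tends g)).
    apply: filterS (ooU _ (nbhs_infty_ge n)) => m /= nm.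
    by have [h _ _ _] := hz m; apply: h; exact: (D_mono nm).
  apply: (cnorm_le hX) => [n w g Kf|n g Gf]; apply: le_trans (ler_norm _) _; apply: xD.
    exact: K_norming Kf.
  exact: G_norming Gf.
- have sx k : supp x k -> ran f k.
    move=> xk; have [n zn] : exists n, z n k != 0.
      apply: contrapT => none; move/negP: xk; apply; rewrite xu u_out// => n.
      by apply/eqP; apply: contrapT => /negP zn; apply: none; exists n.
    by have [_ zr _ _] := hz n; apply: zr; exact: ran_supp.
  move=> k [a [b [/sx[a1 [_ [pa1 _ /andP[a1a _]]]] /sx[_ [b1 [_ pb1 /andP[_ bb1]]]] /andP[ak kb]]]].
  exists a1, b1; split => //.
  by rewrite (leq_trans a1a ak) (leq_trans kb bb1).
- apply: (tends_uniq UU (act_tends _)); apply: tends_eq (tends_cst UU ooU 1).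
  by apply: (@filterS _ U _ setT) filterT => n _ /=; have [_ _ -> _] := hz n.
- move=> k g k0 kj Fg; apply: (tends_norm_le UU (act_tends g)).
  apply: (@filterS _ U _ setT) filterT => n _ /=.
  by have [_ _ _ h] := hz n; exact: h.
Qed.

Definition block_vector (K : R) phi q (y : c00 R) :=
  [/\ cnorm y <= K, ran y `<=` ran (phi q), act (phi q) y = 1 &
    forall k g, (0 < k)%N -> k != branch_ind c phi q -> F_ k g ->
      `|act g y| <= K * 2^-1 ^+ k].

Definition block_vectors (K : R) phi (x : nat -> c00 R) :=
  forall q, block_vector K phi q (x q).

Lemma block_vectors_exist : exists2 K : R, 0 < K &
  forall phi, survivors c phi -> exists x : nat -> c00 R, block_vectors K phi x.
Proof.
exists 1000; first by rewrite ltr0n.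
move=> phi sphi; suff /choice[x hx] : forall q, exists y, block_vector 1000 phi q y.
  by exists x.
move=> q; apply: vector_limit; first exact: ler0n.
move=> n; apply: exact_vector (survivor_exact n q sphi).
exact: leq_ltn_trans (leq0n q) (branch_ind_ge sphi.1 q).
Qed.

Section vectors.
Variables (K : R) (phi : nat -> c00 R) (x : nat -> c00 R).
Hypothesis K0 : 0 < K.
Hypothesis phi_surv : survivors c phi.
Hypothesis x_vec : block_vectors K phi x.

Lemma vector_supp q k : x q k != 0 -> (q < k)%N.
Proof.
move=> xk; have [_ xr _ _] := x_vec q.
have [a [b [pa _ /andP[ak _]]]] := xr k (ran_supp xk).
exact: leq_trans (branch_index_lt phi_surv.1 pa) ak.
Qed.

(** The vector lives on the range of [phi q], where no other block is supported. *)
Lemma branch_vector_self q : act (branch phi) (x q) = 1.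
Proof.
have [_ xr <- _] := x_vec q; apply: eq_act => k xk.
have [a [b [pa pb /andP[ak kb]]]] := xr k (ran_supp xk).
have [//|none] := pselect (exists p, supp (phi p) k); last first.
  have -> : branch phi k = 0.
    apply/eqP; apply: contrapT => /negP /branch_neq0[p _ pk].
    by apply: none; exists p.
  by apply/esym/eqP; apply: contrapT => /negP pk; apply: none; exists q.
move=> [p pk]; rewrite (branch_at phi_surv.1 pk).
have [pq|qp|-> //] := ltngtP p q.
  by have := branch_before phi_surv.1 pq pk pa; rewrite ltnNge ak.
by have := branch_before phi_surv.1 qp pb pk; rewrite ltnNge kb.
Qed.

(** Early blocks of [psi] end before [x q] begins. Later ones have an index different from that of
    [phi q] once the two survivors have separated, so their actions are summable with a small
    tail. *)
Lemma branch_vector_other psi (e : R) : survivors c psi -> phi <> psi -> 0 < e ->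
  exists q0, forall q, (q0 <= q)%N -> `|act (branch psi) (x q)| <= e.
Proof.
move=> spsi pne e0.
have [r pr] : exists r, phi r <> psi r.
  by apply: contrapT => nr; apply: pne; apply/funext => k; apply: contrapT => pk; apply: nr; exists k.
have [P hP] : exists P : nat, 2 * K * 2^-1 ^+ P <= e.
  have cv : (fun n => (2^-1 : R) ^+ n) @ \oo --> (0 : R).
    by apply: cvg_expr; rewrite ger0_norm ?invr_ge0// invf_lt1// ltr1n.
  have e1 : 0 < e / (2 * K) by rewrite divr_gt0// mulr_gt0.
  have [P _ hP] := cvgr0_norm_le _ cv _ e1; exists P.
  have := hP P (leqnn P); rewrite /= ger0_norm ?exprn_ge0 ?invr_ge0//.
  by rewrite ler_pdivlMr ?mulr_gt0// mulrC.
have /choice[M hM] := @c00_bound R.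
pose L := (\max_(p < P) M (psi p))%N.
exists (maxn r L).+1 => q; rewrite gtn_max => /andP[rq Lq].
have [D hD] := c00_bound (x q).
have [_ _ _ xF] := x_vec q.
have -> : act (branch psi) (x q) = \sum_(p < D) act (psi p) (x q).
  rewrite -act_c00_sum; apply: eq_act => k xk; rewrite (branch_sum spsi.1)//.
  by rewrite ltnW// ltnNge; apply: contraNN xk => /hD ->.
apply: le_trans (ler_norm_sum _ _ _) _.
(* The summand on the right is zero for [p < P] and [K * 2^-1 ^+ p] for [p >= P], and the sum
   telescopes. *)
apply: (@le_trans _ _ (\sum_(p < D) 2 * K * (2^-1 ^+ maxn P p - 2^-1 ^+ maxn P p.+1))).
  apply: ler_sum => p _; have [pP|] := boolP (p < P)%N; last rewrite -leqNgt => Pp.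
    have -> : act (psi p) (x q) = 0.
      apply: act0 => k /vector_supp qk; apply: hM; apply: leq_trans (ltnW qk).
      apply: leq_trans (ltnW Lq).
      exact: (@leq_bigmax _ (fun p : 'I_P => M (psi p)) (Ordinal pP)).
    by rewrite normr0 (maxn_idPl (ltnW pP)) (maxn_idPl pP) subrr mulr0.
  rewrite (maxn_idPr Pp) (maxn_idPr (leqW Pp)) exprS.
  have p0 := branch_ind_ge spsi.1 p.
  apply: le_trans (xF (branch_ind c psi p) _ _ _ (branch_F spsi.1 p)) _.
  - exact: leq_ltn_trans p0.
  - apply/eqP => pqE.
    have q0 : (0 < q)%N by apply: leq_ltn_trans rq.
    (* The index of a first block lies in [Xi1], that of [phi q] with [q > 0] in [Xi2]. *)
    case: (posnP p) => [p00|p00].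
      have X1 : Xi1 c (branch_ind c psi p).
        by rewrite p00; apply: F_special_ind0; apply: branch_special => //; exact: spsi.1.
      have X2 : Xi2 c (branch_ind c phi q).
        rewrite -(prednK q0) branch_indS; apply: sigmaF_Xi2.
        by apply: (branch_domain phi_surv.1).
      rewrite -pqE in X2.
      by have : (Xi1 c `&` Xi2 c) (branch_ind c psi p) by []; rewrite Xi_disjoint.
    have [pq] := branch_ind_inj spsi.1 phi_surv.1 p00 q0 pqE.
    by move=> /(_ r); rewrite pq => /(_ rq) /esym.
  have : 2^-1 ^+ (branch_ind c psi p) <= 2^-1 ^+ p :> R.
    by rewrite ler_wiXn2l ?invr_ge0 ?invf_le1 ?ler1n// ltnW.
  move: (2^-1 ^+ (branch_ind c psi p)) (2^-1 ^+ p) => a b /(ler_wpM2l (ltW K0)); lra.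
rewrite -mulr_sumr; apply: le_trans hP; apply: ler_wpM2l.
  by rewrite mulr_ge0// ltW.
have -> : forall n, \sum_(p < n) (2^-1 ^+ maxn P p - 2^-1 ^+ maxn P p.+1) =
    2^-1 ^+ maxn P 0 - 2^-1 ^+ maxn P n :> R.
  by elim=> [|n IH]; [rewrite big_ord0 subrr|rewrite big_ord_recr IH /= addrA subrK].
by rewrite maxn0 lerBlDr lerDl exprn_ge0// invr_ge0.
Qed.

End vectors.

End survivor_vectors.

Lemma lipschitz_cts (R : realType) (V W : normedModType R) (f : V -> W) (K : R) :
  0 < K -> (forall x y, `|f x - f y| <= K * `|x - y|) -> continuous f.
Proof.
move=> K0 fK x; apply/cvgrPdist_le => e e0; near=> y.
apply: le_trans (fK x y) _; rewrite -ler_pdivlMl//.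
by near: y; apply: cvgr_dist_le; [exact: cvg_id|rewrite mulr_gt0 ?invr_gt0].
Unshelve. all: by end_near. Qed.

(** * Bounded functionals on the completion *)

Section dual_extension.
Variables (R : realType) (c : codings R) (X : completeNormedModType R).
Variables (i : {linear c00 R -> X}) (hX : is_completion (X_norm c) i).
Local Notation cnorm := (cnorm i).
Implicit Types (x : c00 R) (y : X) (G H : dual X).

Lemma dual_linE (a : R) G H y : (a *: G + H) y = a * G y + H y.
Proof. by []. Qed.

Lemma dual_lin G (a : R) y y' : G (a *: y + y') = a * G y + G y'.
Proof. exact: (dual_linear G). Qed.

Lemma dense_approx y (e : R) : 0 < e -> exists x, `|y - i x| < e.
Proof.
move=> e0; have [||z [zO [x _ xz]]] := hX.2 (ball y e).
- by exists y; exact: ballxx.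
- exact: ball_open.
by exists x; rewrite xz; move: zO; rewrite -ball_normE.
Qed.

Lemma dual_le_norm G y : `|G y| <= `|G| * `|y|.
Proof.
have [->|y0] := eqVneq y 0.
  have -> : G 0 = 0 by have := dual_lin G 1 0 0; rewrite scaler0 addr0; lra.
  by rewrite normr0 mulr_ge0.
have n0 : 0 < `|y| by rewrite normr_gt0.
have := @opnorm_ub _ _ G (`|y|^-1 *: y).
rewrite normrZ normfV normr_id mulVf ?gt_eqF// => /(_ (lexx _)).
have -> : G (`|y|^-1 *: y) = `|y|^-1 * G y.
  have := dual_lin G (`|y|^-1) y 0; have := dual_lin G 1 0 0.
  by rewrite !addr0 scaler0; lra.
by rewrite normrM normfV normr_id ler_pdivrMl// mulrC dual_normE.
Qed.

Lemma dual_norm_le G (M : R) : 0 <= M ->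
  (forall x, `|G (i x)| <= M * cnorm x) -> `|G| <= M.
Proof.
move=> M0 GM; rewrite dual_normE; apply: opnorm_le => y y1.
apply/ler_addgt0Pr => e e0.
have K0 : 0 < `|G| + M + 1 by rewrite ltr_wpDl// addr_ge0.
have d0 : 0 < e / (`|G| + M + 1) by rewrite divr_gt0.
have [x yx] := dense_approx y d0.
have E : G y = G (y - i x) + G (i x).
  by rewrite -[in LHS](subrK (i x) y) -[y - i x in LHS]scale1r dual_lin mul1r.
have h1 := dual_le_norm G (y - i x); have h2 := GM x.
have h3 : cnorm x <= 1 + `|y - i x|.
  have := ler_normB y (y - i x); rewrite opprB [y + _]addrC subrK => /le_trans; apply.
  by rewrite lerD2r.
have h4 : `|G y| <= `|G (y - i x)| + `|G (i x)| by rewrite E ler_normD.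
have h5 := ler_wpM2l M0 h3.
have h6 : `|G| * `|y - i x| <= `|G| * (e / (`|G| + M + 1)) by rewrite ler_wpM2l// ltW.
have h7 : M * `|y - i x| <= M * (e / (`|G| + M + 1)) by rewrite ler_wpM2l// ltW.
have h8 : (`|G| + M + 1) * (e / (`|G| + M + 1)) = e by rewrite mulrC divfK// gt_eqF.
move: d0 h6 h7 h8; set d := e / _; rewrite !mulrDl; lra.
Qed.

(** McShane's formula, the supremum over [x] of [g x - M * |y - i x|], gives values [f y] with
    [|f y - g x| <= M * |y - i x|]. Linearity follows by approximation from [range i]. *)
Lemma dual_extend (g : c00 R -> R) (M : R) : scalar_fun g -> 0 <= M ->
  (forall x, `|g x| <= M * cnorm x) ->
  exists G : dual X, (forall x, G (i x) = g x) /\ `|G| <= M.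
Proof.
move=> gl M0 gM.
pose A y : set R := [set g x - M * `|y - i x| | x in setT].
have Aub y x : ubound (A y) (g x + M * `|y - i x|).
  move=> _ [x' _ <-]; have := gM (x' - x); rewrite lfunB// => h.
  have : cnorm (x' - x) <= `|y - i x| + `|y - i x'|.
    have := ler_normB (y - i x) (y - i x').
    by rewrite opprB addrC addrA subrK -linearB.
  move=> /(ler_wpM2l M0); have := ler_norm (g x' - g x); lra.
pose f (y : X) : R := sup (A y).
have f_near y x : `|f y - g x| <= M * `|y - i x|.
  have Ax : A y (g x - M * `|y - i x|) by exists x.
  have hA : has_sup (A y).
    by split; [exists (g x - M * `|y - i x|)|exists (g x + M * `|y - i x|); exact: Aub].
  have h1 := ub_le_sup hA.2 Ax; have h2 := ge_sup hA.1 (@Aub y x).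
  by rewrite ler_norml; apply/andP; split; rewrite /f; lra.
have f_lin (a : R) y z : f (a *: y + z) = a * f y + f z.
  apply/eqP; rewrite -subr_eq0 -normr_le0; apply/ler_addgt0Pr => e e0.
  rewrite add0r.
  have K0 : 0 < 2 * M * (`|a| + 1) + 1 by rewrite ltr_wpDl// !mulr_ge0// addr_ge0.
  have d0 : 0 < e / (2 * M * (`|a| + 1) + 1) by rewrite divr_gt0.
  have [x yx] := dense_approx y d0; have [x' zx'] := dense_approx z d0.
  have h1 := f_near y x; have h2 := f_near z x'.
  have h3 : `|f (a *: y + z) - (a * g x + g x')| <= M * `|a *: y + z - (a *: i x + i x')|.
    by rewrite -gl -(linearP i); exact: f_near.
  have h4 : `|a *: y + z - (a *: i x + i x')| <= `|a| * `|y - i x| + `|z - i x'|.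
    by rewrite opprD addrACA -scalerBr (le_trans (ler_normD _ _))// normrZ.
  have -> : f (a *: y + z) - (a * f y + f z) = (f (a *: y + z) - (a * g x + g x')) -
     a * (f y - g x) - (f z - g x').
    by lra.
  have h5 := ler_wpM2l M0 h4.
  have h6 : `|a * (f y - g x)| <= `|a| * (M * `|y - i x|) by rewrite normrM ler_wpM2l.
  have h7 : M * `|a| * `|y - i x| <= M * `|a| * (e / (2 * M * (`|a| + 1) + 1)).
    by rewrite ler_wpM2l ?mulr_ge0// ltW.
  have h8 : M * `|z - i x'| <= M * (e / (2 * M * (`|a| + 1) + 1)).
    by rewrite ler_wpM2l// ltW.
  have h9 : (2 * M * (`|a| + 1) + 1) * (e / (2 * M * (`|a| + 1) + 1)) = e.
    by rewrite mulrC divfK// gt_eqF.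
  apply: le_trans (ler_normB _ _) _.
  have := ler_normB (f (a *: y + z) - (a * g x + g x')) (a * (f y - g x)).
  move: d0 h7 h8 h9; set d := e / _; lra.
have f_le y : `|f y| <= M * `|y|.
  by have := f_near y 0; rewrite linear0 !subr0 lfun0// subr0.
have f_cts : continuous (f : X -> R^o).
  apply: (@lipschitz_cts _ _ _ _ (M + 1)); first by rewrite ltr_wpDl.
  move=> y z; have -> : f y - f z = f (y - z).
    have := f_lin (-1) z y; rewrite scaleN1r [- z + y]addrC => ->.
    by rewrite mulN1r addrC.
  by apply: le_trans (f_le _) _; rewrite ler_wpM2r// lerDl.
have fd : (f : X -> R^o) \in @dual_pred R X.
  by apply/asboolP; split=> // a y z; exact: f_lin.
have fi x : f (i x) = g x.
  have := f_near (i x) x; rewrite subrr normr0 mulr0 normr_le0 subr_eq0.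
  by move=> /eqP.
by exists (Dual fd); split => //; apply: dual_norm_le => // x; rewrite /= fi.
Qed.

End dual_extension.

Lemma lin_span_sum (R : realType) (V : normedModType R) (A : set V) (I : eqType)
    (r : seq I) (F : I -> V) :
  (forall j, j \in r -> lin_span A (F j)) -> lin_span A (\sum_(j <- r) F j).
Proof.
elim: r => [|j r IH] rA; first by rewrite big_nil; exists [::]; rewrite ?big_nil.
rewrite big_cons -[F j]scale1r; apply: lin_span_submod; first exact/rA/mem_head.
by apply: IH => k kr; apply: rA; rewrite in_cons kr orbT.
Qed.

Lemma lin_span_mem (R : realType) (V : normedModType R) (A : set V) (a : R) v :
  A v -> lin_span A (a *: v).
Proof.
by move=> Av; exists [:: (a, v)]; [move=> p; rewrite inE => /eqP ->|rewrite big_seq1].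
Qed.

Lemma lin_span_closed (R : realType) (V : normedModType R) (A : set V) v :
  lin_span A v -> subspace_set (closed_span A) v.
Proof. exact: subset_closure. Qed.

Lemma act_tail (R : realType) (N : nat) (a : nat -> R) (x : c00 R) :
  act a x = act (tail N a) x + \sum_(1 <= k < N.+1) a k * x k.
Proof.
elim: N => [|N IH].
  rewrite big_geq// addr0; apply: eq_act => -[|k] // /negP[].
  by rewrite c00_at0 eqxx.
rewrite IH [in RHS]big_nat_recr//= addrA addrAC; congr (_ + _).
rewrite addrC -(act_unit N.+1 x) -actDl; apply: eq_act => k _ /=.
rewrite /tail /unit_vec_fun andbT; have [kN|Nk|->] := ltngtP k N.+1.
- by rewrite /= mulr0 addr0.
- by rewrite /= mulr0 add0r.
- by rewrite /= mulr1 addr0.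
Qed.

Lemma branch_norm_le (R : realType) (c : codings R) (X : completeNormedModType R)
    (i : {linear c00 R -> X}) (phi : nat -> c00 R) (x : c00 R) :
  is_completion (X_norm c) i -> survivors c phi ->
  `|act (branch phi) x| <= cnorm i x.
Proof.
move=> hX [sphi tphi]; have [M hM] := c00_bound x.
rewrite (_ : act _ _ = act (\sum_(q < M.+1) phi q) x).
  by apply: (norming_abs_le hX); apply: tau_norming; exact: tphi.
apply: eq_act => k xk; rewrite (branch_sum sphi)// ltnW// ltnS ltnW// ltnNge.
by apply: contraNN xk => /hM ->.
Qed.

(** * The isomorphism *)

Section isomorphism.
Variables (R : realType) (c : codings R) (X : completeNormedModType R).
Variables (i : {linear c00 R -> X}) (hX : is_completion (X_norm c) i).
Local Notation cnorm := (cnorm i).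
Local Notation Gamma := (survivors c).
Local Notation coords := (coordinate_functionals i).

Variables (U : set_system nat) (UU : UltraFilter U) (ooU : \oo `<=` U).
Variables (K : R) (K0 : 0 < K) (vec : Gamma -> nat -> c00 R).
Hypothesis vecP : forall t, block_vectors c i K (val t) (vec t).
Variables (B : Gamma -> dual X) (E : nat -> dual X).
Hypothesis BP : forall t x, B t (i x) = act (branch (val t)) x.
Hypothesis EP : forall n x, E n (i x) = x n.

Implicit Types (g h w : dual X) (t u : Gamma) (s : seq Gamma) (a : Gamma -> R).

Let surv t : survivors c (val t). Proof. exact: set_valP. Qed.

(** The ultrafilter makes this limit exist for every [g] and depend linearly on [g]. *)
Definition limit_coef g t : R := lim ((fun q => g (i (vec t q))) @ U).

Lemma limit_coefP g t : tends U (fun q => g (i (vec t q))) (limit_coef g t).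
Proof.
apply: (@tends_lim _ _ UU _ (`|g| * K)) => q.
apply: le_trans (dual_le_norm g _) _; rewrite ler_wpM2l//.
by have [] := vecP t q.
Qed.

Lemma limit_coef_lin b g h t :
  limit_coef (b *: g + h) t = b * limit_coef g t + limit_coef h t.
Proof.
apply: (tends_uniq UU (limit_coefP _ t)).
exact: (tendsZD UU b (limit_coefP g t) (limit_coefP h t)).
Qed.

Lemma limit_coef0 t : limit_coef 0 t = 0.
Proof. by have := limit_coef_lin 1 0 0 t; rewrite scaler0 addr0; lra. Qed.

Lemma limit_coef_sum (I : Type) (r : seq I) (b : I -> R) (G : I -> dual X) t :
  limit_coef (\sum_(j <- r) b j *: G j) t = \sum_(j <- r) b j * limit_coef (G j) t.
Proof.
elim: r => [|j r IH]; first by rewrite !big_nil limit_coef0.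
by rewrite !big_cons limit_coef_lin IH.
Qed.

Lemma limit_coef_le g t : `|limit_coef g t| <= K * `|g|.
Proof.
apply: (tends_norm_le UU (limit_coefP g t)).
have UF : ProperFilter U by exact: ultra_proper.
apply: (@filterS _ U _ setT) filterT => q _ /=.
apply: le_trans (dual_le_norm g _) _; rewrite mulrC ler_wpM2r//.
by have [] := vecP t q.
Qed.

Lemma limit_coef_coord g t : coords g -> limit_coef g t = 0.
Proof.
move=> [n n0 gE]; apply: (tends_uniq UU (limit_coefP g t)).
apply: tends_near => // e e0; exists n => q nq.
rewrite gE pairing_act act_unit subr0.
have [->|/(vector_supp (surv t) (vecP t))] := eqVneq (vec t q n) 0.
  by rewrite normr0 ltW.
by rewrite ltnNge nq.
Qed.

Lemma limit_coef_span w t : lin_span coords w -> limit_coef w t = 0.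
Proof.
move=> [r rc ->]; rewrite limit_coef_sum big_seq big1// => p /rc pc.
by rewrite limit_coef_coord// mulr0.
Qed.

Lemma limit_coef_closed g t : subspace_set (closed_span coords) g ->
  limit_coef g t = 0.
Proof.
move=> /closure_ballP gc; apply/eqP; rewrite -normr_le0; apply/ler_addgt0Pr => e e0.
rewrite add0r; have [w wc gw] := gc (e / K) (divr_gt0 e0 K0).
have -> : limit_coef g t = limit_coef (g - w) t.
  have := limit_coef_lin (-1) w g t; rewrite scaleN1r addrC => ->.
  by rewrite (limit_coef_span t wc); lra.
apply: le_trans (limit_coef_le _ _) _.
by rewrite mulrC -ler_pdivlMr// ltW.
Qed.

Lemma limit_coef_branch t u : limit_coef (B t) u = (t == u)%:R.
Proof.
apply: (tends_uniq UU (limit_coefP _ u)); apply: tends_near => // e e0.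
have [->|tu] := eqVneq t u.
  exists 0%N => q _; rewrite BP (branch_vector_self (surv u) (vecP u)).
  by rewrite subrr normr0 ltW.
have ne : val u <> val t by move=> /val_inj ut; rewrite ut eqxx in tu.
have [q0 hq0] := branch_vector_other K0 (surv u) (vecP u) (surv t) ne e0.
by exists q0 => q qq; rewrite BP subr0 hq0.
Qed.

Lemma limit_coef_branches s a w u : uniq s -> lin_span coords w ->
  limit_coef (w + \sum_(t <- s) a t *: B t) u = if u \in s then a u else 0.
Proof.
move=> us wc; rewrite -[w]scale1r limit_coef_lin (limit_coef_span u wc) mulr0 add0r.
rewrite limit_coef_sum; under eq_bigr do rewrite limit_coef_branch.
case: ifPn => uin.
  rewrite (bigD1_seq u)//= eqxx mulr1 big1 ?addr0// => t /negbTE ->.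
  by rewrite mulr0.
rewrite big_seq big1// => t ts; case: eqP => [tu|]; last by rewrite mulr0.
by rewrite -tu ts in uin.
Qed.

Lemma E_coord n : (0 < n)%N -> coords (E n).
Proof. by move=> n0; exists n => // x; rewrite EP pairing_act act_unit. Qed.

(** Collects the terms given by [approximation]: repeated survivors are merged, since the norm
    estimates concern distinct ones, and the coordinates are gathered in [w]. *)
Lemma dual_approximation g (e : R) : 0 < e -> exists s a w,
  [/\ uniq s, lin_span coords w & `|g - (w + \sum_(t <- s) a t *: B t)| <= e].
Proof.
move=> e0.
have gl : scalar_fun (fun x => g (i x)) by move=> b x y; rewrite linearP dual_lin.
have [x|r rb hr] := approximation hX gl (normr_ge0 g) e0.
  exact: dual_le_norm.
have [s [a [w [us wc sE]]]] : exists s a w, [/\ uniq s, lin_span coords w &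
    forall x, \sum_(q <- r) q.1 * q.2 x = (w + \sum_(t <- s) a t *: B t) (i x)].
  elim: r rb {hr} => [|[b f] r IH] rb.
    exists [::], (fun=> 0), 0; split => //.
      by exists [::]; rewrite ?big_nil.
    by move=> x; rewrite !big_nil addr0.
  have [|s [a [w [us wc sE]]]] := IH; first by move=> q qr; apply: rb; rewrite in_cons qr orbT.
  have [[n n0 fE]|[phi sphi fE]] := rb (b, f) (mem_head _ _).
    exists s, a, (b *: E n + w); split => //.
      apply: lin_span_submod => //; rewrite -[E n]scale1r.
      exact/lin_span_mem/E_coord.
    move=> x; rewrite big_cons sE -addrA dual_linE EP; congr (_ + _).
    by move: fE => /= ->; rewrite act_unit.
  pose t : Gamma := exist _ phi (mem_set sphi).
  have tE x : (b, f).1 * (b, f).2 x = b * B t (i x) by rewrite BP; move: fE => /= ->.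
  have [ts|ts] := boolP (t \in s).
    exists s, (fun u => a u + (u == t)%:R * b), w; split => // x.
    rewrite big_cons sE tE.
    have -> : \sum_(u <- s) (a u + (u == t)%:R * b) *: B u =
        b *: B t + \sum_(u <- s) a u *: B u.
      under eq_bigr do rewrite scalerDl.
      rewrite big_split /= addrC; congr (_ + _).
      rewrite (bigD1_seq t)//= eqxx mul1r big1 ?addr0// => u /negbTE ->.
      by rewrite mul0r scale0r.
    by rewrite [w + (_ + _)]addrCA dual_linE.
  exists (t :: s), (fun u => if u == t then b else a u), w; split => //.
    by rewrite /= ts.
  move=> x; rewrite big_cons sE tE big_cons eqxx.
  have -> : \sum_(u <- s) (if u == t then b else a u) *: B u = \sum_(u <- s) a u *: B u.
    apply: eq_big_seq => u us'; case: eqP => // ut.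
    by rewrite -ut us' in ts.
  by rewrite [w + (_ + _)]addrCA dual_linE.
exists s, a, w; split => //; apply: (dual_norm_le hX) => [|x]; first exact: ltW.
by have := hr x; rewrite sE.
Qed.

(** The correction [w] cancels the first [N0] coordinates of the combination and leaves tails, whose
    absolute values add up to at most the norm by [survivors_sum_le]. *)
Lemma branches_norm s a (M : R) : uniq s -> 0 <= M ->
  (forall t, t \in s -> `|a t| <= M) ->
  exists2 w, lin_span coords w & `|w + \sum_(t <- s) a t *: B t| <= M.
Proof.
move=> us M0 aM.
have [||N0 hN0] := @survivors_sum_le _ c X i hX [seq val t | t <- s].
- by rewrite map_inj_uniq//; exact: val_inj.
- by move=> phi /mapP[t _ ->].
pose b k := - \sum_(t <- s) a t * branch (val t) k.
exists (\sum_(1 <= k < N0.+1) b k *: E k).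
  apply: lin_span_sum => k; rewrite mem_index_iota => /andP[k0 _].
  exact/lin_span_mem/E_coord.
apply: (dual_norm_le hX) => // x.
have sumE (I : Type) (r : seq I) (F : I -> R) (G : I -> dual X) y :
    (\sum_(j <- r) F j *: G j) y = \sum_(j <- r) F j * G j y.
  by elim: r => [|j r IH]; rewrite ?big_nil// !big_cons dual_linE IH.
have -> : (\sum_(1 <= k < N0.+1) b k *: E k + \sum_(t <- s) a t *: B t) (i x) =
    \sum_(t <- s) a t * act (tail N0 (branch (val t))) x.
  have -> : forall g h y, (g + h) y = g y + h y by [].
  rewrite !sumE.
  under [X in X + _]eq_bigr do rewrite EP /b mulNr mulr_suml.
  rewrite sumrN exchange_big /= addrC -sumrB; apply: eq_bigr => t _.
  rewrite BP (act_tail N0) mulrDr mulr_sumr -addrA.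
  rewrite [X in _ + X](_ : _ = 0) ?addr0//; apply/eqP; rewrite subr_eq0; apply/eqP.
  by apply: eq_bigr => k _; rewrite mulrA.
apply: le_trans (ler_norm_sum _ _ _) _.
apply: (@le_trans _ _ (\sum_(t <- s) M * `|act (tail N0 (branch (val t))) x|)).
  rewrite !big_seq; apply: ler_sum => t ts.
  by rewrite normrM ler_wpM2r// aM.
rewrite -mulr_sumr ler_wpM2l//.
by have := hN0 N0 (leqnn _) x; rewrite big_map.
Qed.

(** Passing from [g] to a finite combination within [e / (2 * K)] changes each coefficient by at
    most [e / 2], so only survivors in the combination can carry a coefficient of size [e]. *)
Lemma limit_coef_c0 g : (limit_coef g : Gamma -> R^o) \in @c0_pred R Gamma.
Proof.
apply/asboolP => e e0.
have d0 : 0 < e / (2 * K) by rewrite divr_gt0// mulr_gt0.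
have [s [a [w [us wc gs]]]] := dual_approximation g d0.
apply: (@sub_finite_set _ _ [set` s]); last exact: finite_seq.
move=> t /= et; apply: contraTT et => ts; rewrite -ltNge.
have := limit_coef_lin (-1) (w + \sum_(t <- s) a t *: B t) g t.
rewrite limit_coef_branches// (negbTE ts) mulr0 add0r scaleN1r addrC => <-.
apply: le_lt_trans (limit_coef_le _ _) _.
apply: le_lt_trans (ler_wpM2l (ltW K0) gs) _.
have : 2 * K * (e / (2 * K)) = e by rewrite mulrC divfK// gt_eqF// mulr_gt0.
by move: (e / _) => d; lra.
Qed.

Definition coef_c0 g : c0 R Gamma := C0 (limit_coef_c0 g).

Lemma coef_c0_lin b g h : coef_c0 (b *: g + h) = b *: coef_c0 g + coef_c0 h.
Proof. by apply/val_inj/funext => t /=; exact: limit_coef_lin. Qed.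

Lemma coef_c0B g h : coef_c0 (g - h) = coef_c0 g - coef_c0 h.
Proof. by rewrite addrC -scaleN1r coef_c0_lin scaleN1r addrC. Qed.

Lemma coef_c0_le g : `|coef_c0 g| <= K * `|g|.
Proof.
apply: supnorm_le => [|t]; first by rewrite mulr_ge0// ltW.
exact: limit_coef_le.
Qed.

(** For [M > 0] only finitely many entries of [x] have size at least [M / 2], and a combination from
    [branches_norm] realises exactly these. *)
Lemma coef_c0_halve (x : c0 R Gamma) (M : R) : 0 <= M -> `|x| <= M ->
  exists g, `|g| <= M /\ `|x - coef_c0 g| <= M / 2.
Proof.
move=> M0 xM; have xtM t : `|x t| <= M by apply: le_trans xM; exact: supnorm_ub.
have [M00|M0'] := eqVneq M 0.
  exists 0; rewrite normr0; split => //.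
  have -> : coef_c0 0 = 0 by apply/val_inj/funext => t; exact: limit_coef0.
  by rewrite subr0 M00 mul0r -M00.
have M2 : 0 < M / 2 by rewrite divr_gt0// lt_neqAle eq_sym M0'.
have /asboolP/(_ _ M2)/finite_seqP[s sE] := c0P x.
have us := undup_uniq s.
have [t _|w wc wM] := @branches_norm (undup s) x M us M0; first exact: xtM.
exists (w + \sum_(t <- undup s) x t *: B t); split => //.
apply: supnorm_le => [|t]; first exact: ltW.
have -> : (x - coef_c0 (w + \sum_(t <- undup s) x t *: B t)) t =
  x t - limit_coef (w + \sum_(t <- undup s) x t *: B t) t by [].
rewrite limit_coef_branches// mem_undup; case: ifPn => [_|ts].
  by rewrite subrr normr0 ltW.
rewrite subr0 leNgt; apply/negP => /ltW tx; move/negP: ts; apply.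
by have : [set` s] t by rewrite -sE.
Qed.

(** Iterated halving writes [x] as a series of coefficient families whose preimages have
    geometrically decreasing norms. *)
Lemma coef_c0_surj (x : c0 R Gamma) : exists g, coef_c0 g = x.
Proof.
have /choice[pick pickP] : forall xM : c0 R Gamma * R, exists g,
    0 <= xM.2 -> `|xM.1| <= xM.2 -> `|g| <= xM.2 /\ `|xM.1 - coef_c0 g| <= xM.2 / 2.
  move=> [y M] /=; have [/andP[M0 yM]|nM] := boolP ((0 <= M) && (`|y| <= M)).
    by have [g hg] := coef_c0_halve M0 yM; exists g.
  by exists 0 => M0 yM; rewrite M0 yM in nM.
pose M n : R := `|x| / 2 ^+ n.
have M0 n : 0 <= M n by rewrite divr_ge0// exprn_ge0.
pose y := fix y n := if n is k.+1 then y k - coef_c0 (pick (y k, M k)) else x.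
pose p n := pick (y n, M n).
have MS n : M n.+1 = M n / 2 by rewrite /M exprSr invfM mulrA.
have yM n : `|y n| <= M n.
  elim: n => [|n IH]; first by rewrite /M expr0 divr1.
  by rewrite MS; exact: (pickP (y n, M n) (M0 n) IH).2.
have pM n : `|p n| <= M n := (pickP (y n, M n) (M0 n) (yM n)).1.
pose G n : dual X := \sum_(k < n) p k.
have GS n : G n.+1 = G n + p n by rewrite /G big_ord_recr.
have yG n : coef_c0 (G n) = x - y n.
  elim: n => [|n IH].
    rewrite /G big_ord0 /= subrr; apply/val_inj/funext => t; exact: limit_coef0.
  rewrite GS -[G n]scale1r coef_c0_lin scale1r IH /= -/(p n).
  by rewrite opprB addrA addrAC.
have GB m n : `|G (m + n)%N - G m| <= 2 * M m - 2 * M (m + n)%N.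
  elim: n => [|n IH]; first by rewrite addn0 !subrr normr0.
  rewrite addnS GS addrAC MS; have := ler_normD (G (m + n)%N - G m) (p (m + n)%N).
  by have := pM (m + n)%N; lra.
have G_le m n : (m <= n)%N -> `|G n - G m| <= 2 * M m.
  move=> mn; have := GB m (n - m)%N; rewrite subnKC//.
  by have := M0 n; lra.
have UF : ProperFilter U by exact: ultra_proper.
(* The sum of the preimages is formed pointwise on [c00] and then extended to the completion. *)
pose f z : R := lim ((fun n => G n (i z)) @ U).
have fP z : tends U (fun n => G n (i z)) (f z).
  apply: (@tends_lim _ _ UU _ (2 * M 0%N * `|i z|)) => n.
  apply: le_trans (dual_le_norm _ _) _; rewrite ler_wpM2r//.
  by have := G_le 0%N n (leq0n n); rewrite {2}/G big_ord0 subr0.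
have f_near m z : `|f z - G m (i z)| <= 2 * M m * cnorm z.
  have := tendsZD UU (-1) (tends_cst UU ooU (G m (i z))) (fP z).
  rewrite mulN1r addrC => h; apply: (tends_norm_le UU h).
  apply: filterS (ooU (nbhs_infty_ge m)) => n /= mn.
  rewrite addrC -[G n (i z) - _]/((G n - G m) (i z)).
  by apply: le_trans (dual_le_norm _ _) _; rewrite ler_wpM2r// G_le.
have fl : scalar_fun f.
  move=> b z z'; apply: (tends_uniq UU (fP _)).
  apply: tends_eq (tendsZD UU b (fP z) (fP z')).
  by apply: (@filterS _ U _ setT) filterT => n _; rewrite /= linearP dual_lin.
have [|z|H [Hf _]] := @dual_extend _ c X i hX f (2 * M 0%N) fl.
- by rewrite mulr_ge0.
- by have := f_near 0%N z; rewrite /G big_ord0 (_ : (0 : dual X) (i z) = 0)// subr0.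
exists H; apply/eqP; rewrite -subr_eq0 -normr_le0; apply/ler_addgt0Pr => e e0.
rewrite add0r.
have bound m : `|coef_c0 H - x| <= (2 * K + 1) * M m.
  have -> : coef_c0 H - x = coef_c0 (H - G m) - y m.
    by rewrite coef_c0B yG opprB addrA addrAC addrK.
  apply: le_trans (ler_normB _ _) _.
  have h1 : `|H - G m| <= 2 * M m.
    apply: (dual_norm_le hX) => [|z]; first by rewrite mulr_ge0.
    by rewrite -[(H - G m) (i z)]/(H (i z) - G m (i z)) Hf.
  have := coef_c0_le (H - G m); have := yM m.
  by have := ler_wpM2l (ltW K0) h1; lra.
have K1 : 0 < 2 * K + 1 by rewrite ltr_wpDl// mulr_ge0// ltW.
have x0 : 0 < `|x| + 1 by rewrite ltr_wpDl.
have cv : (fun n => (2^-1 : R) ^+ n) @ \oo --> (0 : R).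
  by apply: cvg_expr; rewrite ger0_norm ?invr_ge0// invf_lt1// ltr1n.
have [m _ hm] := cvgr0_norm_le _ cv _ (divr_gt0 e0 (mulr_gt0 K1 x0)).
apply: le_trans (bound m) _; have := hm m (leqnn m).
rewrite /= ger0_norm ?exprn_ge0 ?invr_ge0// ler_pdivlMr ?mulr_gt0// => h.
apply: le_trans h; rewrite [leRHS]mulrCA ler_pM2l// /M -exprVn [leLHS]mulrC.
by rewrite ler_wpM2l ?lerDl ?exprn_ge0 ?invr_ge0.
Qed.

Lemma coef_c0_closed g h : quotient_proj (closed_span coords) g =
  quotient_proj (closed_span coords) h -> coef_c0 g = coef_c0 h.
Proof.
move=> /quotient_proj_eq gh; apply/eqP; rewrite -subr_eq0 -coef_c0B; apply/eqP.
by apply/val_inj/funext => t; exact: limit_coef_closed.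
Qed.

Local Notation Q := (quotient_space (closed_span coords)).

(** An arbitrary representative; [coef_c0] is constant on classes. *)
Definition quotient_lift (q : Q) : dual X := projT1 (cid (quotient_projP q)).

Lemma quotient_liftK q : quotient_proj (closed_span coords) (quotient_lift q) = q.
Proof. exact: (projT2 (cid (quotient_projP q))). Qed.

Definition coef_quotient (q : Q) : c0 R Gamma := coef_c0 (quotient_lift q).

Lemma coef_quotientE g :
  coef_quotient (quotient_proj (closed_span coords) g) = coef_c0 g.
Proof. by apply: coef_c0_closed; rewrite quotient_liftK. Qed.

Lemma coef_quotient_linear : linear coef_quotient.
Proof.
move=> b p q; rewrite -{1}(quotient_liftK p) -{1}(quotient_liftK q) -quotient_projZ -quotient_projD.
by rewrite coef_quotientE coef_c0_lin.
Qed.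

HB.instance Definition _ :=
  GRing.isLinear.Build R Q (c0 R Gamma) _ coef_quotient coef_quotient_linear.

Lemma coef_quotient_le q : `|coef_quotient q| <= K * `|q|.
Proof.
rewrite -ler_pdivrMl//; apply: quotient_norm_ge => g <-.
by rewrite coef_quotientE ler_pdivrMl// coef_c0_le.
Qed.

(** Up to a small error, [g] is a combination of coordinates plus branches whose scalars are nearly
    its coefficients. Replacing the coordinate part by the correction from [branches_norm] keeps the
    class and brings the norm down to nearly [|coef_c0 g|]. *)
Lemma coef_quotient_ge q : `|q| <= `|coef_quotient q|.
Proof.
apply/ler_addgt0Pr => e e0; have [g <-] := quotient_projP q.
rewrite coef_quotientE.
(* The approximation error counts once directly and [K] times through the coefficients. *)
have d0 : 0 < e / (K + 1) by rewrite divr_gt0// addr_gt0.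
have [s [a [w [us wc gs]]]] := dual_approximation g d0.
set z := w + _ in gs.
have [|t ts|w' wc' w'M] := @branches_norm s a (`|coef_c0 g| + K * (e / (K + 1))) us.
- by rewrite addr_ge0// mulr_ge0// ltW.
- have -> : a t = limit_coef g t - limit_coef (g - z) t.
    have := limit_coef_lin (-1) z g t; rewrite scaleN1r addrC => ->.
    by rewrite limit_coef_branches// ts; lra.
  apply: le_trans (ler_normB _ _) _; apply: lerD; first exact: (supnorm_ub (coef_c0 g)).
  by apply: le_trans (limit_coef_le _ _) _; rewrite ler_wpM2l// ltW.
have -> : quotient_proj (closed_span coords) g = quotient_proj (closed_span coords)
    ((g - z) + (w' + \sum_(t <- s) a t *: B t)).
  apply/quotient_proj_eq; apply: lin_span_closed.
  have -> : g - (g - z + (w' + \sum_(t <- s) a t *: B t)) = (-1) *: w' + w.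
    rewrite /z scaleN1r; move: (\sum_(t <- s) _) => S.
    rewrite !opprD !opprK !addrA subrr add0r.
    by rewrite [w + S - w' - S]addrAC addrK addrC.
  exact: lin_span_submod.
apply: le_trans (quotient_norm_le _ _) _; apply: le_trans (ler_normD _ _) _.
apply: le_trans (lerD gs w'M) _.
have : (K + 1) * (e / (K + 1)) = e by rewrite mulrC divfK// gt_eqF// addr_gt0.
lra.
Qed.

Lemma quotient_isomorphic : isomorphic Q (c0 R Gamma).
Proof.
have /choice[S SP] : forall x : c0 R Gamma, exists q : Q, coef_quotient q = x.
  move=> x; have [g gx] := coef_c0_surj x.
  by exists (quotient_proj _ g); rewrite coef_quotientE.
have sub (p q : Q) : coef_quotient (p - q) = coef_quotient p - coef_quotient q.
  exact: linearB.
exists coef_quotient, S; split.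
- by apply: (lipschitz_cts K0) => p q; rewrite -sub; exact: coef_quotient_le.
- apply: (lipschitz_cts ltr01) => x y; rewrite mul1r.
  by rewrite (le_trans (coef_quotient_ge _))// sub !SP.
- move=> q; apply/eqP; rewrite -subr_eq0 -normr_le0.
  by rewrite (le_trans (coef_quotient_ge _))// sub SP subrr normr0.
- exact: SP.
Qed.

End isomorphism.

Theorem proposition6p26 (R : realType) (c : codings R)
    (X : completeNormedModType R) (i : {linear c00 R -> X})
    (hX : is_completion (X_norm c) i) :
  isomorphic (quotient_space (closed_span (coordinate_functionals i)))
    (c0 R (survivors c)).
Proof.
have [U UU ooU] := free_ultrafilter.
have [K K0 vecs] := block_vectors_exist hX.
have /choice[vec vecP] : forall t : survivors c, exists x : nat -> c00 R,
    block_vectors c i K (val t) x.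
  by move=> t; apply: vecs; exact: set_valP.
have /choice[B BP] : forall t : survivors c, exists G : dual X,
    forall x, G (i x) = act (branch (val t)) x.
  move=> t; have [|G [GE _]] := dual_extend hX (@act_lfun _ (branch (val t))) (@ler01 R).
  - by move=> x; rewrite mul1r; apply: (branch_norm_le x hX); exact: set_valP.
  - by exists G.
have /choice[E EP] : forall n, exists G : dual X, forall x, G (i x) = x n.
  move=> n; have [|G [GE _]] := dual_extend hX (@act_lfun _ (unit_vec n : c00 R)) (@ler01 R).
  (* Index 0 is the dummy position, where every vector vanishes. *)
  - move=> x; rewrite mul1r; have [->|n0] := posnP n.
      by rewrite act_unit c00_at0 normr0 cnorm_ge0.
    by apply: (norming_abs_le hX); exists 0%N => //; exact: unit_vec_D.
  - by exists G => x; rewrite GE act_unit.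
exact: (quotient_isomorphic hX UU ooU K0 vecP BP EP).
Qed.
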